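(* Let $n\ge 2$. Let $u:\overline{\mathbb{B}_n}\to\mathbb{R}$ be the function defined by \[ u(x):=\sum_{j=1}^\infty \frac{1}{j^2}\,\mathrm{Re}\bigl((x_1+ix_2)^{2^j}\bigr)\quad\text{for all }x=(x_1,\dots,x_n)\in\overline{\mathbb{B}_n}. \] Then $u$ is harmonic in $\mathbb{B}_n$, continuous on $\overline{\mathbb{B}_n}$, does not belong to $C^{0,\epsilon}(\overline{\mathbb{B}_n})$ for any $\epsilon>0$, and does not belong to $H^{\sigma+1/2}(\mathbb{B}_n)$ for any $\sigma>(n-2)/4$.
   Context: $\mathbb{B}_n$ is the open unit ball of $\mathbb{R}^n$ centered at the origin. $C^{0,\epsilon}$ denotes the space of H\''older continuous functions with exponent $\epsilon$. $H^s$ denotes the usual $L^2$-based Sobolev space of (possibly fractional) order $s$. *)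

(* Defs.v *)
From HB Require Import structures.
From mathcomp Require Import all_boot all_order all_algebra.
From mathcomp Require Import complex.
From mathcomp Require Import all_classical all_reals all_analysis.

Set Implicit Arguments.
Unset Strict Implicit.
Unset Printing Implicit Defensive.

Import Order.TTheory GRing.Theory Num.Theory.
Import numFieldNormedType.Exports.

Local Open Scope classical_set_scope.
Local Open Scope ring_scope.

Section euclidean.
Context {R : realType}.

(* The norm that the library puts on ['rV[R]_n] is the sup norm.  Continuity,
   compactness and derivatives do not depend on the choice of norm, but balls
   and distances do. *)
Definition enorm n (x : 'rV[R]_n) : R := Num.sqrt (\sum_(i < n) x 0 i ^+ 2).

Definition unit_ball n : set 'rV[R]_n := [set x | enorm x < 1].

Definition closed_unit_ball n : set 'rV[R]_n := [set x | enorm x <= 1].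

Definition holder_on n (e : R) (A : set 'rV[R]_n) (f : 'rV[R]_n -> R) : Prop :=
  exists C : R, forall x y, A x -> A y ->
    `|f x - f y| <= C * enorm (x - y) `^ e.

End euclidean.
Arguments unit_ball R n : clear implicits.
Arguments closed_unit_ball R n : clear implicits.

Section partial_derivatives.
Context {R : realType} {n : nat}.
Implicit Types (f : 'rV[R]_n -> R) (A : set 'rV[R]_n).

Definition partial (i : 'I_n) f : 'rV[R]_n -> R :=
  fun x => 'D_(delta_mx 0 i) f x.

Definition iter_partial (s : seq 'I_n) f : 'rV[R]_n -> R := foldr partial f s.

(* [A] is meant to be open, so that the values of [f] outside [A] are
   irrelevant. *)
Definition Ck_on (k : nat) A f : Prop :=
  forall s : seq 'I_n, (size s <= k)%N ->
    (forall x, A x -> {for x, continuous (iter_partial s f)}) /\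
    ((size s < k)%N -> forall x i, A x ->
       derivable (iter_partial s f) x (delta_mx 0 i)).

Definition laplacian f : 'rV[R]_n -> R :=
  fun x => \sum_(i < n) partial i (partial i f) x.

Definition harmonic_on A f : Prop :=
  Ck_on 2 A f /\ forall x, A x -> laplacian f x = 0.

Definition multi_index := {ffun 'I_n -> nat}.

Definition mi_order (a : multi_index) : nat := \sum_(i < n) a i.

Definition mi_partial (a : multi_index) f : 'rV[R]_n -> R :=
  iter_partial (flatten [seq nseq (a i) i | i <- enum 'I_n]) f.

Definition test_function A (phi : 'rV[R]_n -> R) : Prop :=
  let supp := closure [set x | phi x != 0] in
  [/\ forall k, Ck_on k setT phi, compact supp & supp `<=` A].

End partial_derivatives.
Arguments multi_index : clear implicits.

Definition rV_display : measure_display -> measure_display.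
Proof. exact. Qed.

(* The sigma-algebra generated by the coordinate functions, i.e., the Borel
   sets of R^n. *)
Section borel_rV.
Context {R : realType} (n : nat).

Let coors : 'I_n -> 'rV[R]_n -> R := fun i x => x 0 i.

Let rV_set0 : g_sigma_preimage coors set0.
Proof. exact: sigma_algebra0. Qed.

Let rV_setC A : g_sigma_preimage coors A -> g_sigma_preimage coors (~` A).
Proof. exact: sigma_algebraC. Qed.

Let rV_bigcup (F : (set 'rV[R]_n)^nat) :
  (forall i, g_sigma_preimage coors (F i)) ->
  g_sigma_preimage coors (\bigcup_i (F i)).
Proof. exact: sigma_algebra_bigcup. Qed.

HB.instance Definition _ :=
  @isMeasurable.Build (rV_display default_measure_display)
    'rV[R]_n (g_sigma_preimage coors) rV_set0 rV_setC rV_bigcup.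

End borel_rV.

Lemma measurable_fun_rVP {R : realType} d (T : measurableType d) n
    (f : T -> 'rV[R]_n) :
  measurable_fun setT f <-> forall i, measurable_fun setT (fun t => f t 0 i).
Proof.
split=> [mf i|mf].
  move=> _ Y mY; rewrite setTI.
  have := mf measurableT ((fun x : 'rV[R]_n => x 0 i) @^-1` Y).
  rewrite setTI; apply; apply: sub_sigma_algebra.
  rewrite -bigcup_seq/=; exists i => /=; first by rewrite mem_index_enum.
  by exists Y => //; rewrite setTI.
apply: measurability => //= A.
rewrite /preimage_set_system/= -bigcup_seq => -[B [i /= _ [C mC <-]] <-].
by have := mf i measurableT C mC; rewrite !setTI.
Qed.

Section lebesgue_rV.
Context {R : realType}.

Definition cons_rV n (z : measurableTypeR R * 'rV[R]_n) : 'rV[R]_n.+1 :=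
  \row_(i < n.+1) if unlift ord0 i is Some j then z.2 0 j else z.1.

Lemma measurable_cons_rV n : measurable_fun setT (@cons_rV n).
Proof.
apply/measurable_fun_rVP => i; rewrite /cons_rV.
under eq_fun do rewrite mxE.
case: (unlift ord0 i) => [j|]; last exact: measurable_fst.
have /measurable_fun_rVP := @measurable_id _ 'rV[R]_n setT.
by move=> /(_ j) mj; exact: (measurableT_comp mj measurable_snd).
Qed.

Definition uncons_rV n (x : 'rV[R]_n.+1) : measurableTypeR R * 'rV[R]_n :=
  (x 0 ord0, \row_(j < n) x 0 (lift ord0 j)).

Lemma cons_rVK n : cancel (@cons_rV n) (@uncons_rV n).
Proof.
case=> a v; rewrite /cons_rV /uncons_rV/= mxE unlift_none; congr pair.
by apply/rowP => j; rewrite !mxE liftK.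
Qed.

Lemma measurable_uncons_rV n : measurable_fun setT (@uncons_rV n).
Proof.
have /measurable_fun_rVP mid := @measurable_id _ 'rV[R]_n.+1 setT.
apply: measurable_fun_pair; first exact: mid.
by apply/measurable_fun_rVP => j; under eq_fun do rewrite mxE; exact: mid.
Qed.

Section step.
Variables (n : nat) (m : {sigma_finite_measure set 'rV[R]_n -> \bar R}).

Definition lebesgue_rV_step : set 'rV[R]_n.+1 -> \bar R :=
  pushforward (lebesgue_measure \x m)%E (@cons_rV n).

Let preim A : measurable A -> measurable (@cons_rV n @^-1` A).
Proof.
by move=> mA; rewrite -[X in measurable X]setTI; exact: measurable_cons_rV.
Qed.

Let step0 : lebesgue_rV_step set0 = 0%E.
Proof. by rewrite /lebesgue_rV_step /pushforward preimage_set0 measure0. Qed.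

Let step_ge0 A : (0 <= lebesgue_rV_step A)%E.
Proof. by rewrite /lebesgue_rV_step /pushforward; exact: measure_ge0. Qed.

Let step_sigma_additive : semi_sigma_additive lebesgue_rV_step.
Proof.
move=> F mF tF mUF; rewrite /lebesgue_rV_step /pushforward preimage_bigcup.
apply: measure_semi_sigma_additive.
- by move=> k; exact: preim.
- apply/trivIsetP => /= i j _ _ ij; rewrite -preimage_setI.
  by move/trivIsetP : tF => /(_ _ _ _ _ ij) ->//; rewrite preimage_set0.
- by rewrite -preimage_bigcup; exact: preim.
Qed.

HB.instance Definition _ := isMeasure.Build _ _ _ lebesgue_rV_step
  step0 step_ge0 step_sigma_additive.

Let step_sigma_finite : sigma_finite setT lebesgue_rV_step.
Proof.
have /sigma_finiteP[F [TF ndF Foo]] :=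
  sigma_finiteT (@lebesgue_measure R : {sigma_finite_measure set _ -> \bar R}).
have /sigma_finiteP[G [TG ndG Goo]] := sigma_finiteT m.
exists (fun k => @uncons_rV n @^-1` (F k `*` G k)).
  rewrite -preimage_bigcup; apply/esym; rewrite -subTset => x _.
  have : setT (uncons_rV x).1 by [].
  rewrite TF => -[i _ Fi]; have : setT (uncons_rV x).2 by [].
  rewrite TG => -[j _ Gj]; exists (maxn i j) => //; split.
    by move: Fi; exact/subsetPset/ndF/leq_maxl.
  by move: Gj; exact/subsetPset/ndG/leq_maxr.
move=> k; have [mF Fk] := Foo k; have [mG Gk] := Goo k; split.
  rewrite -[X in measurable X]setTI.
  by apply: measurable_uncons_rV => //; exact: measurableX.
rewrite /lebesgue_rV_step /pushforward -comp_preimage.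
rewrite (_ : _ \o _ = id); last by apply/funext => z /=; exact: cons_rVK.
by rewrite preimage_id product_measure1E// lte_mul_pinfty// ge0_fin_numE.
Qed.

HB.instance Definition _ := Measure_isSigmaFinite.Build _ _ _
  lebesgue_rV_step step_sigma_finite.

End step.

Fixpoint lebesgue_rV n : {sigma_finite_measure set 'rV[R]_n -> \bar R} :=
  if n is k.+1 then lebesgue_rV_step (lebesgue_rV k)
  else \d_(0 : 'rV[R]_0).

Lemma lebesgue_rV_box n (a b : 'I_n -> R) : (forall i, a i <= b i) ->
  lebesgue_rV n [set x | forall i, x 0 i \in `[a i, b i]] =
  (\prod_(i < n) (b i - a i))%:E.
Proof.
elim: n a b => [|n IH] a b ab.
  by rewrite big_ord0 /= diracE mem_set//= => -[].
rewrite big_ord_recl /= /lebesgue_rV_step /pushforward.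
rewrite (_ : _ @^-1` _ = `[a ord0, b ord0] `*`
    [set x : 'rV[R]_n | forall i,
       x 0 i \in `[a (lift ord0 i), b (lift ord0 i)]]); last first.
  apply/seteqP; split=> -[t v] /=.
    move=> h; split; first by have := h ord0; rewrite mxE unlift_none.
    by move=> i; have := h (lift ord0 i); rewrite mxE liftK.
  by move=> [h0 h] i; rewrite mxE; case: unliftP => [j|] ->//; exact: h.
rewrite product_measure1E//=; last first.
  rewrite (_ : mkset _ = \bigcap_(i in [set: 'I_n])
      (fun x : 'rV[R]_n => x 0 i) @^-1`
        `[a (lift ord0 i), b (lift ord0 i)]); last first.
    by apply/seteqP; split=> x /= h i; [move=> _|]; exact: h.
  apply: fin_bigcap_measurable => // i _.
  rewrite -[X in measurable X]setTI.
  have /measurable_fun_rVP := @measurable_id _ 'rV[R]_n setT.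
  by apply.
rewrite IH; last by move=> i; exact: ab.
rewrite lebesgue_measure_itv/= lte_fin; case: ltP => [_|ba].
  by rewrite -EFinB EFinM.
have -> : b ord0 = a ord0 by apply/le_anti; rewrite ba ab.
by rewrite subrr mul0r mul0e.
Qed.

End lebesgue_rV.
Arguments lebesgue_rV {R} n.

Section sobolev.
Context {R : realType} {n : nat}.
Implicit Types (f g : 'rV[R]_n -> R) (A : set 'rV[R]_n) (a : multi_index n).

Definition L2_on A f : Prop :=
  measurable_fun A f /\
  (\int[lebesgue_rV n]_(x in A) (f x ^+ 2)%:E < +oo)%E.

Definition weak_partial A a f g : Prop :=
  forall phi, test_function A phi ->
    (\int[lebesgue_rV n]_(x in A) (f x * mi_partial a phi x)%:E =
     ((-1) ^+ mi_order a)%:E *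
       \int[lebesgue_rV n]_(x in A) (g x * phi x)%:E)%E.

(* Square of the Gagliardo (Sobolev-Slobodeckij) seminorm.  On the diagonal
   the integrand is [0 / 0 = 0]. *)
Definition gagliardo A (t : R) g : \bar R :=
  (\int[lebesgue_rV n]_(x in A) \int[lebesgue_rV n]_(y in A)
     ((g x - g y) ^+ 2 / enorm (x - y) `^ (n%:R + 2 * t))%:E)%E.

(* [f] restricted to the open set [A] belongs to H^s(A), for [0 <= s]
   (negative orders are not covered): with
   [s = k + t], [k] the integer part and [0 <= t < 1], the weak derivatives of
   order at most [k] are in L^2(A) and, if [t > 0], those of order exactly [k]
   have a finite Gagliardo seminorm of order [t]. *)
Definition in_Hs (s : R) A f : Prop :=
  let k := Num.truncn s in
  let t := s - k%:R in
  L2_on A f /\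
  exists D : multi_index n -> 'rV[R]_n -> R,
    (forall a, (mi_order a <= k)%N ->
       L2_on A (D a) /\ weak_partial A a f (D a)) /\
    (0 < t -> forall a, mi_order a = k -> (gagliardo A t (D a) < +oo)%E).

End sobolev.

Section lacunary.
Context {R : realType} {n : nat}.
Hypothesis n_ge2 : (2 <= n)%N.

(* The library numbers coordinates from 0. *)
Definition coord1 (x : 'rV[R]_n) : R := x 0 (Ordinal (ltnW n_ge2)).
Definition coord2 (x : 'rV[R]_n) : R := x 0 (Ordinal n_ge2).

Definition lacunary_term (x : 'rV[R]_n) (j : nat) : R :=
  (j%:R ^+ 2)^-1 * complex.Re ((coord1 x +i* coord2 x)%C ^+ (2 ^ j)).

Definition lacunary_psum (x : 'rV[R]_n) (N : nat) : R :=
  \sum_(1 <= j < N.+1) lacunary_term x j.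

Definition lacunary (x : 'rV[R]_n) : R := limn (lacunary_psum x).

End lacunary.

(* Main.v *)
(* Write [z = x1 + i x2] and [N = 2 ^ j0], with [j0 = 2 M].

   On [|z| <= r < 1] the second-order Taylor remainders of the terms are
   dominated by a convergent series, so [u] may be differentiated termwise.
   Along the first axis, Bernoulli's inequality bounds the increment of [u]
   between [1 - 2 ^ - M] and [1] from below by [1 / (2 M ^ 2)], which beats
   every Hoelder modulus.

   For the Sobolev statement, let [s = k + t] with [k] the integer part of [s],
   and let [g] be the weak derivative [d_1 ^ k u].  Take a bump [chi] invariant
   under the rotations of the [z]-plane and supported at distance about [1 / N]
   from the part of the unit sphere where the other coordinates are small, put
   [p = N - 1 - k] and test [g] against the increments of
   [phi = Re (z ^ p) chi].  The rotation field [x1 d_2 - x2 d_1] makes the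
   harmonics of different degrees orthogonal for the weight [chi], so that
   [d_1 ^ k phi] only sees the degree [N - 1], which does not occur in [u].
   After a translation by [h], the degree [N - 1] appears in [(z + h) ^ (2 ^ j)]
   for [j >= j0], and for [h] small compared with [1 / N] the term [j = j0]
   dominates.  This bounds the pairing of [g - g (. + h)] and [phi] from below.
   By the Cauchy-Schwarz inequality the integral of [(g - g (. + h)) ^ 2] over
   the support of [chi] is at least a constant times
   [2 ^ (M (4 k - n)) / M ^ 4], and integrating over [h] of size about [1 / N]
   bounds the Gagliardo seminorm of order [t] from below by
   [2 ^ (M (4 s - n)) / M ^ 4].  This is unbounded in [M] when [4 s > n]. *)

Require Import Defs.
From mathcomp Require Import all_boot all_order all_algebra.
From mathcomp Require Import complex.
From mathcomp Require Import all_classical all_reals all_analysis.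
From mathcomp Require Import measurable_realfun.
From mathcomp Require Import ring lra zify.

Set Implicit Arguments.
Unset Strict Implicit.
Unset Printing Implicit Defensive.

Import Order.TTheory GRing.Theory Num.Theory.
Import numFieldNormedType.Exports.

Local Open Scope classical_set_scope.
Local Open Scope ring_scope.

(** The weak derivative [g] is known only through pairings with test functions, and for [t > 0] the
    seminorm only sees its increments; hence a translated test function, built from explicit smooth
    functions. The degree [N - 1] lies one below [N] so that the leading coefficient is
    ['C(N, N - 1) * Re h = N * Re h]: linear in the step, and of constant size when [h] is of order
    [1 / N]. Lower degrees of the series cannot produce it, since a translation only lowers degrees.
    The threshold [n / 4] is a matter of volume. For [|z| ^ (2 p)] to stay bounded below, the
    support must lie within [1 / N] of [|z| = 1]; by the curvature of the sphere the [n - 2] other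
    coordinates then have size [N ^ (- 1 / 2)], so the support has measure of order [N ^ (- n / 2)].
    Against it stand [N ^ (2 k)], from the square of [k] derivatives, and [N ^ (2 t)], from the
    kernel. When [s] is an integer there is no seminorm: the increments of [g] are then bounded by
    its L2 norm, and the same lower bound contradicts [L2_on]. Polar coordinates are avoided:
    orthogonality comes from integration by parts, and integration by parts from translation
    invariance of the measure. *)

Section inverse_square_series.
Context {R : realType}.
Implicit Types (a : nat -> R) (C : R).

(** Comparison with the telescoping differences [1 / j - 1 / (j + 1)]. *)
Lemma sum_inv_sqr_le (m n : nat) : (0 < m)%N ->
  \sum_(m.+1 <= j < n) (j%:R ^+ 2)^-1 <= m%:R^-1 :> R.
Proof.
move=> m0; case: n => [|n]; first by rewrite big_geq// invr_ge0.
have [nm|mn] := leqP n m; first by rewrite big_geq// invr_ge0.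
rewrite big_add1/=; apply: (@le_trans _ _
    (\sum_(m <= j < n) (- (j.+1%:R^-1) - - j%:R^-1))).
  rewrite big_nat_cond [leRHS]big_nat_cond; apply: ler_sum => j.
  rewrite andbT => /andP[mj _].
  have j0 : 0 < j%:R :> R by rewrite ltr0n (leq_trans m0).
  rewrite -natr1 -subr_ge0 opprK.
  have -> : - (j%:R + 1)^-1 + j%:R^-1 - ((j%:R + 1) ^+ 2)^-1
      = (j%:R * (j%:R + 1) ^+ 2)^-1 :> R.
    by field; rewrite gt_eqF//= gt_eqF ?ltr_wpDr ?ltW.
  by rewrite invr_ge0 mulr_ge0 ?sqr_ge0 ?ltW.
rewrite telescope_sumr ?(ltnW mn)// opprK addrC gerBl.
by rewrite invr_ge0.
Qed.

Lemma sum1_inv_sqr_le (n : nat) :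
  \sum_(1 <= j < n) (j%:R ^+ 2)^-1 <= 2 :> R.
Proof.
have [n1|n1] := leqP n 1; first by rewrite big_geq.
rewrite big_ltn// expr1n invr1 -[leRHS]/(1 + 1) lerD2l.
by apply: (le_trans (@sum_inv_sqr_le 1 n _)); rewrite // invr1.
Qed.

Definition psum a (N : nat) : R := \sum_(1 <= j < N.+1) a j.

(** The analytic estimates on the series are reduced to this domination with an explicit [C]: it
    yields convergence, the bound [2 C] on the sum and the tail [C / m]. Index [0] is excluded,
    since the right-hand side would be [0] there. *)
Definition sqr_dominated C a := forall j, (0 < j)%N -> `|a j| <= C * (j%:R ^+ 2)^-1.

Lemma psum_tail C a (m N : nat) : sqr_dominated C a -> 0 <= C -> (0 < m <= N)%N ->
  `|psum a N - psum a m| <= C / m%:R.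
Proof.
move=> aC C0 /andP[m0 mN]; rewrite /psum (@big_cat_nat _ _ _ m.+1 1 N.+1)//=.
rewrite addrAC subrr add0r (le_trans (ler_norm_sum _ _ _))//.
apply: (@le_trans _ _ (\sum_(m.+1 <= j < N.+1) C * (j%:R ^+ 2)^-1)).
  rewrite big_nat_cond [leRHS]big_nat_cond; apply: ler_sum => j.
  by rewrite andbT => /andP[mj _]; apply: aC; exact: leq_trans mj.
by rewrite -mulr_sumr ler_wpM2l// sum_inv_sqr_le.
Qed.

Lemma psum_norm C a (N : nat) : sqr_dominated C a -> 0 <= C -> `|psum a N| <= C * 2.
Proof.
move=> aC C0; rewrite (le_trans (ler_norm_sum _ _ _))//.
apply: (@le_trans _ _ (\sum_(1 <= j < N.+1) C * (j%:R ^+ 2)^-1)).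
  rewrite big_nat_cond [leRHS]big_nat_cond; apply: ler_sum => j.
  by rewrite andbT => /andP[mj _]; exact: aC.
by rewrite -mulr_sumr ler_wpM2l// sum1_inv_sqr_le.
Qed.

Lemma cvg_psum C a : sqr_dominated C a -> 0 <= C -> cvgn (psum a).
Proof.
move=> aC C0; apply/cauchy_cvgP/cauchy_exP => e e0.
have C1 : 0 < C + 1 by rewrite ltr_wpDl.
have [m [m0 Cm]] : exists m, (0 < m)%N /\ C / m%:R < e.
  exists (Num.truncn (C / e)).+1; split => //.
  by rewrite ltr_pdivrMr ?ltr0n// mulrC -ltr_pdivrMr// truncnS_gt.
exists (psum a m); exists m => // N /= mN.
rewrite -ball_normE /= distrC (le_lt_trans _ Cm)//.
by apply: psum_tail => //; rewrite m0.
Qed.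

Lemma lim_psum_norm_le C a : sqr_dominated C a -> 0 <= C ->
  `|limn (psum a)| <= C * 2.
Proof.
move=> aC C0; have ca := cvg_psum aC C0.
rewrite -lim_norm//; apply: limr_le; first exact: is_cvg_norm.
by near=> N; apply: psum_norm.
Unshelve. all: by end_near. Qed.

Lemma lim_psum_tail C a m : sqr_dominated C a -> 0 <= C -> (0 < m)%N ->
  `|limn (psum a) - psum a m| <= C / m%:R.
Proof.
move=> aC C0 m0; have ca := cvg_psum aC C0.
have c2 : psum a N - psum a m @[N --> \oo] --> limn (psum a) - psum a m.
  by apply: cvgB => //; exact: cvg_cst.
rewrite -(cvg_lim _ c2)// -lim_norm; last by apply: cvgP c2.
apply: limr_le; first by apply: is_cvg_norm; apply: cvgP c2.
by near=> N; apply: psum_tail => //; rewrite m0/=; near: N; exists m.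
Unshelve. all: by end_near. Qed.

End inverse_square_series.

(** * Powers of a complex number *)

Section modulus.
Context {R : realType}.
Implicit Types (w h : R[i]) (r : R).

Notation cmod := (@Normc.normc R).
Notation "'iC" := ('i%C : R[i]).

Lemma cmod_ge0 w : 0 <= cmod w.
Proof. by case: w => a b; exact: sqrtr_ge0. Qed.

Lemma cmodD w h : cmod (w + h) <= cmod w + cmod h.
Proof. exact: (@le_normcD R). Qed.

Lemma cmodX w n : cmod (w ^+ n) = cmod w ^+ n.
Proof.
by elim: n => [|n IH]; rewrite ?expr0 ?Normc.normc1// !exprS Normc.normcM IH.
Qed.

Lemma cmod_i n : cmod ('iC ^+ n) = 1.
Proof.
by rewrite cmodX /= expr0n/= expr1n add0r sqrtr1 expr1n.
Qed.

Lemma cmod_real (a : R) : cmod a%:C%C = `|a|.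
Proof. by rewrite /= expr0n/= addr0 sqrtr_sqr. Qed.

Lemma cmod_nat n : cmod n%:R = n%:R.
Proof.
by rewrite -[n%:R](rmorph_nat (@real_complex R)) cmod_real ger0_norm.
Qed.

Lemma norm_Re_le w : `|complex.Re w| <= cmod w.
Proof.
by case: w => a b /=; rewrite -sqrtr_sqr ler_wsqrtr// lerDl sqr_ge0.
Qed.

Lemma cmod_le_norm (a b : R) : cmod (a +i* b)%C <= `|a| + `|b|.
Proof.
rewrite /= -(@ler_pXn2r _ 2)// ?nnegrE ?sqrtr_ge0 ?addr_ge0//.
rewrite sqr_sqrtr ?addr_ge0 ?sqr_ge0// sqrrD !real_normK ?num_real//.
by rewrite lerD2r lerDl mulrn_wge0// mulr_ge0.
Qed.

(** The usual bound [n r ^ (n - 1) |h|], multiplied through by [r] to avoid a truncated exponent. *)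
Lemma cmod_lipX w h r n : cmod w <= r -> cmod (w + h) <= r ->
  cmod ((w + h) ^+ n - w ^+ n) * r <= n%:R * r ^+ n * cmod h.
Proof.
move=> wr whr; have r0 : 0 <= r := le_trans (cmod_ge0 _) wr.
elim: n => [|n IH]; first by rewrite !expr0 subrr Normc.normc0 !mul0r.
have -> : (w + h) ^+ n.+1 - w ^+ n.+1
    = (w + h) * ((w + h) ^+ n - w ^+ n) + h * w ^+ n by rewrite !exprS; ring.
rewrite (le_trans (ler_wpM2r r0 (cmodD _ _)))// mulrDl !Normc.normcM.
apply: (@le_trans _ _ (r * (n%:R * r ^+ n * cmod h) + cmod h * r ^+ n * r)).
  apply: lerD.
    by rewrite -[leLHS]mulrA; apply: ler_pM; rewrite ?mulr_ge0 ?cmod_ge0.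
  rewrite ler_wpM2r// ler_wpM2l ?cmod_ge0// cmodX.
  by rewrite lerXn2r ?nnegrE ?cmod_ge0.
by rewrite exprS -natr1 le_eqVlt; apply/orP; left; apply/eqP; ring.
Qed.

(** The constant [n ^ 2] is cruder than [n (n - 1) / 2], but the induction closes at once: step [n]
    costs [n], and [n ^ 2 + n <= (n + 1) ^ 2]. *)
Lemma cmod_taylorX w h r n : cmod w <= r -> cmod (w + h) <= r ->
  cmod ((w + h) ^+ n - w ^+ n - n%:R * h * w ^+ n.-1) * r ^+ 2
    <= n%:R ^+ 2 * r ^+ n * cmod h ^+ 2.
Proof.
move=> wr whr; have r0 : 0 <= r := le_trans (cmod_ge0 _) wr.
elim: n => [|n IH].
  by rewrite !expr0 subrr !mul0r subrr Normc.normc0 !mul0r expr0n !mul0r.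
have -> : (w + h) ^+ n.+1 - w ^+ n.+1 - n.+1%:R * h * w ^+ n.+1.-1
  = (w + h) * ((w + h) ^+ n - w ^+ n - n%:R * h * w ^+ n.-1)
    + n%:R * h ^+ 2 * w ^+ n.-1.
  by case: n {IH} => [|n]; rewrite -?natr1 /= !exprS ?expr0; ring.
rewrite (le_trans (ler_wpM2r (exprn_ge0 2 r0) (cmodD _ _)))// mulrDl !Normc.normcM.
apply: (@le_trans _ _ (r * (n%:R ^+ 2 * r ^+ n * cmod h ^+ 2)
    + n%:R * cmod h ^+ 2 * r ^+ n * r)).
  apply: lerD.
    by rewrite -[leLHS]mulrA; apply: ler_pM; rewrite ?mulr_ge0 ?cmod_ge0 ?exprn_ge0.
  rewrite !cmodX cmod_nat; case: n {IH} => [|n] /=; first by rewrite !mul0r.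
  rewrite [leRHS](_ : _ = n.+1%:R * cmod h ^+ 2 * r ^+ n * r ^+ 2); last first.
    by rewrite [r ^+ n.+1]exprS; ring.
  rewrite ler_wpM2r ?exprn_ge0// ler_wpM2l ?mulr_ge0 ?exprn_ge0 ?cmod_ge0//.
  by rewrite lerXn2r ?nnegrE ?cmod_ge0.
rewrite [r ^+ n.+1]exprS -natr1 -subr_ge0.
have -> : (n%:R + 1) ^+ 2 * (r * r ^+ n) * cmod h ^+ 2 -
  (r * (n%:R ^+ 2 * r ^+ n * cmod h ^+ 2) + n%:R * cmod h ^+ 2 * r ^+ n * r)
  = (n%:R + 1) * (r * r ^+ n) * cmod h ^+ 2 by ring.
by rewrite !mulr_ge0 ?exprn_ge0 ?cmod_ge0 ?addr_ge0.
Qed.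

(** This is [x ^ D / D! <= exp x] at [x = - n ln r]. It serves the differentiation of the series,
    the Hoelder statement and the final comparison of growth. *)
Lemma natX_geom_bounded r D : 0 < r < 1 ->
  exists2 C, 0 <= C & forall n : nat, n%:R ^+ D * r ^+ n <= C.
Proof.
move=> /andP[r0 r1]; have l0 : 0 < - ln r.
  by rewrite oppr_gt0 ln_lt0// r0.
exists (D`!%:R / (- ln r) ^+ D).
  by rewrite divr_ge0// exprn_ge0// ltW.
move=> n; rewrite -{1}[r]lnK ?posrE// -expRM_natl.
have -> : n%:R * ln r = - (n%:R * - ln r) by rewrite mulrN opprK.
rewrite expRN ler_pdivrMr ?expR_gt0// mulrAC ler_pdivlMr ?exprn_gt0// -exprMn.
rewrite [D`!%:R * _]mulrC -ler_pdivrMr ?ltr0n ?fact_gt0//.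
case: D => [|D].
  rewrite expr0 [0`!%:R](_ : _ = 1)// divr1 (le_trans _ (expR_ge1Dx _))//.
  by rewrite lerDl mulr_ge0// ltW.
apply: le_trans (expR_ge1Dxn D _); first by rewrite lerDr.
by rewrite mulr_ge0// ltW.
Qed.

End modulus.

(** * The series and its formal derivatives *)

Section lacunary_series.
Context {R : realType} {m : nat}.
Notation cmod := (@Normc.normc R).
Notation "'iC" := ('i%C : R[i]).
Notation V := ('rV[R]_m.+2).
Implicit Types (x y v : V) (w h : R[i]) (k d j : nat).

Definition zcoord x : R[i] := (x 0 ord0 +i* x 0 (lift ord0 ord0))%C.

Lemma ReD w h : complex.Re (w + h) = complex.Re w + complex.Re h.
Proof. by case: w; case: h. Qed.

Lemma ReN w : complex.Re (- w) = - complex.Re w.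
Proof. by case: w. Qed.

Lemma Re_real (a : R) w : complex.Re (a%:C%C * w) = a * complex.Re w.
Proof. by case: w => b c /=; rewrite mul0r subr0. Qed.

Definition dcoef d j : R := (j%:R ^+ 2)^-1 * ((2 ^ j) ^_ d)%:R.

(* [zterm k d j] is [Re (i^k (z^(2^j) / j^2)^(d))]; differentiating in the
   first two coordinates increments [d], resp. both [k] and [d]. *)
Definition zterm k d w j : R :=
  dcoef d j * complex.Re ('iC ^+ k * w ^+ (2 ^ j - d)).

Definition zseries k d x : R := limn (psum (zterm k d (zcoord x))).

Lemma dcoef_ge0 d j : 0 <= dcoef d j.
Proof. by rewrite mulr_ge0// invr_ge0 sqr_ge0. Qed.

Lemma ztermS2 k d w j : zterm k.+2 d w j = - zterm k d w j.
Proof.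
rewrite /zterm -mulrN -ReN; congr (_ * complex.Re _).
by rewrite -addn2 exprD sqr_i mulrN1 mulNr.
Qed.

(** The falling factorial is at most [(2 ^ j) ^ d], which the geometric factor absorbs; the exponent
    [2 ^ j - d] costs a constant [r ^ - d]. The values [D = 0, 1, 2] are those of the size, the
    Lipschitz bound and the Taylor remainder of a term. *)
Lemma dcoef_geom_bounded r d D : 0 < r < 1 ->
  exists2 C, 0 <= C & forall j, (0 < j)%N ->
    dcoef d j * ((2 ^ j - d)%:R ^+ D * r ^+ (2 ^ j - d)) <= C * (j%:R ^+ 2)^-1.
Proof.
move=> r01; have [C C0 Cn] := natX_geom_bounded (d + D) r01.
move: (r01) => /andP[r0 r1].
exists (C / r ^+ d); first by rewrite divr_ge0// exprn_ge0// ltW.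
move=> j _; rewrite /dcoef -[leLHS]mulrA [leLHS]mulrC ler_wpM2r ?invr_ge0 ?sqr_ge0//.
rewrite ler_pdivlMr ?exprn_gt0//; apply: le_trans (Cn (2 ^ j)%N).
rewrite exprD -!mulrA; apply: ler_pM => //.
- by rewrite !mulr_ge0// ?exprn_ge0// ltW.
- rewrite -natrX ler_nat; have [dj|jd] := leqP d (2 ^ j); last first.
    by rewrite ffact_small.
  elim: d {Cn} dj => // d IH dj; rewrite ffactnSr expnSr leq_mul ?leq_subr//.
  by apply: IH; exact: ltnW.
apply: ler_pM => //.
- by rewrite mulr_ge0// exprn_ge0// ltW.
- by rewrite lerXn2r ?nnegrE// ler_nat leq_subr.
- rewrite -exprD; apply: ler_wiXn2l; rewrite ?ltW//.
  by rewrite addnC -leq_subLR.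
Qed.

Lemma zterm_dominated r k d : 0 < r < 1 ->
  exists2 C, 0 <= C & forall w, cmod w <= r -> sqr_dominated C (zterm k d w).
Proof.
move=> r01; have [C C0 Cj] := dcoef_geom_bounded d 0 r01; exists C => // w wr j j0.
apply: le_trans (Cj j j0).
rewrite normrM ger0_norm; last by exact: dcoef_ge0.
rewrite ler_wpM2l//; first by exact: dcoef_ge0.
rewrite (le_trans (norm_Re_le _))// Normc.normcM cmod_i mul1r expr0 mul1r cmodX.
by rewrite lerXn2r ?nnegrE ?cmod_ge0// (le_trans (cmod_ge0 w)).
Qed.

Lemma zterm_lip r k d : 0 < r < 1 ->
  exists2 C, 0 <= C & forall w h, cmod w <= r -> cmod (w + h) <= r ->
    sqr_dominated (C * cmod h) (fun j => zterm k d (w + h) j - zterm k d w j).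
Proof.
move=> r01; have [C C0 Cj] := dcoef_geom_bounded d 1 r01.
move: (r01) => /andP[r0 r1].
exists (C / r); first by rewrite divr_ge0// ltW.
move=> w h wr whr j j0; rewrite /zterm -mulrBr -ReN -ReD -mulrN -mulrDr.
rewrite normrM ger0_norm; last by exact: dcoef_ge0.
rewrite [leRHS](_ : _ = C * (j%:R ^+ 2)^-1 * cmod h / r); last by ring.
rewrite ler_pdivlMr// -[leLHS]mulrA.
apply: le_trans (ler_wpM2r (cmod_ge0 h) (Cj j j0)).
rewrite -[leRHS]mulrA ler_wpM2l ?dcoef_ge0//.
rewrite expr1; apply: le_trans (cmod_lipX _ wr whr); rewrite ler_wpM2r ?(ltW r0)//.
by rewrite (le_trans (norm_Re_le _))// Normc.normcM cmod_i mul1r.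
Qed.

(** A real step [t] along the first ([l = 0]) or the second ([l = 1]) axis moves [z] by [t] times
    ['i ^+ l], and differentiation brings out the same factor, whence [k + l]. *)
Lemma zterm_taylor r k d l : 0 < r < 1 ->
  exists2 C, 0 <= C & forall w (t : R), cmod w <= r ->
    cmod (w + t%:C%C * 'iC ^+ l) <= r ->
    sqr_dominated (C * t ^+ 2)
      (fun j => zterm k d (w + t%:C%C * 'iC ^+ l) j - zterm k d w j
                - t * zterm (k + l) d.+1 w j).
Proof.
move=> r01; have [C C0 Cj] := dcoef_geom_bounded d 2 r01.
move: (r01) => /andP[r0 r1].
exists (C / r ^+ 2); first by rewrite divr_ge0// exprn_ge0// ltW.
move=> w t; set h := (X in w + X) => wr whr j j0.
have -> : zterm k d (w + h) j - zterm k d w j - t * zterm (k + l) d.+1 w j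
  = dcoef d j * complex.Re ('iC ^+ k * ((w + h) ^+ (2 ^ j - d) - w ^+ (2 ^ j - d)
      - (2 ^ j - d)%:R * h * w ^+ (2 ^ j - d).-1)).
  rewrite /zterm !mulrBr !ReD !ReN !mulrDr !mulrN; congr (_ + _ - _).
  rewrite -subnS /h /dcoef ffactnSr natrM -[(2 ^ j - d)%:R in RHS](rmorph_nat (@real_complex R)).
  rewrite [X in _ = _ * complex.Re X](_ : _ = ((2 ^ j - d)%:R * t)%:C%C * ('iC ^+ (k + l) * w ^+ (2 ^ j - d.+1))).
    by rewrite Re_real; ring.
  by rewrite exprD rmorphM; ring.
rewrite normrM ger0_norm; last by exact: dcoef_ge0.
have -> : t ^+ 2 = cmod h ^+ 2.
  by rewrite /h Normc.normcM cmod_i mulr1 cmod_real real_normK// num_real.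
rewrite [leRHS](_ : _ = C * (j%:R ^+ 2)^-1 * cmod h ^+ 2 / r ^+ 2); last by ring.
rewrite ler_pdivlMr ?exprn_gt0// -[leLHS]mulrA.
apply: le_trans (ler_wpM2r (exprn_ge0 2 (cmod_ge0 h)) (Cj j j0)).
rewrite -[leRHS]mulrA ler_wpM2l ?dcoef_ge0//.
apply: le_trans (cmod_taylorX _ wr whr); rewrite ler_wpM2r ?exprn_ge0 ?(ltW r0)//.
by rewrite (le_trans (norm_Re_le _))// Normc.normcM cmod_i mul1r.
Qed.

Lemma lim_psum_taylor_le (C t : R) (a b c : nat -> R) :
  sqr_dominated C (fun j => a j - b j - t * c j) -> 0 <= C ->
  cvgn (psum a) -> cvgn (psum b) -> cvgn (psum c) ->
  `|limn (psum a) - limn (psum b) - t * limn (psum c)| <= C * 2.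
Proof.
move=> abc C0 ca cb cc.
have : psum (fun j => a j - b j - t * c j) @ \oo -->
    limn (psum a) - limn (psum b) - t * limn (psum c).
  rewrite (_ : psum _ = fun N => psum a N - psum b N - t * psum c N); last first.
    by apply/funext => N; rewrite /psum mulr_sumr !sumrB.
  by apply: cvgB; [exact: cvgB|exact: cvgMr].
by move/cvg_lim => <- //; exact: lim_psum_norm_le.
Qed.

Lemma lim_psum_sub_le (C : R) (a b : nat -> R) :
  sqr_dominated C (fun j => a j - b j) -> 0 <= C ->
  cvgn (psum a) -> cvgn (psum b) ->
  `|limn (psum a) - limn (psum b)| <= C * 2.
Proof.
move=> ab C0 ca cb.
have := @lim_psum_taylor_le C 0 a b b; rewrite mul0r subr0; apply => //.
by move=> j j0; rewrite mul0r subr0; exact: ab.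
Qed.

Lemma zseries_cvg k d x : cmod (zcoord x) < 1 -> cvgn (psum (zterm k d (zcoord x))).
Proof.
move=> x1; have [r /andP[xr r1]] : exists r, cmod (zcoord x) < r < 1.
  by exists ((cmod (zcoord x) + 1) / 2); have := cmod_ge0 (zcoord x); lra.
have r0 : 0 < r by rewrite (le_lt_trans _ xr)// cmod_ge0.
have [|C C0 /(_ _ (ltW xr)) xC] := @zterm_dominated r k d; first by rewrite r0.
exact: cvg_psum xC C0.
Qed.

End lacunary_series.
Arguments zcoord : simpl never.

(** * Termwise differentiation *)

Section harmonic.
Context {R : realType} {m : nat}.
Notation cmod := (@Normc.normc R).
Notation "'iC" := ('i%C : R[i]).
Notation V := ('rV[R]_m.+2).
Implicit Types (x y v : V) (w h : R[i]) (k d j : nat).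

(** Turns a dominated second-order remainder directly into a directional derivative. Besides the
    series, it handles [flat] at [0]. *)
Lemma is_derive_quadratic (W : normedModType R) (f : W -> R) (x v : W) (L C e : R) : 0 < e ->
  (forall t, `|t| < e -> `|f (t *: v + x) - f x - t * L| <= C * t ^+ 2) ->
  is_derive x v f L.
Proof.
move=> e0 fC.
suff h : (fun t : R => t^-1 *: ((f \o shift x) (t *: v) - f x)) @ 0^' --> L.
  apply: DeriveDef; first by apply: cvgP h.
  exact: cvg_lim h.
have C1 : 0 < `|C| + 1 by rewrite ltr_wpDl.
apply/cvgrPdist_lt => eps eps0.
exists (Order.min e (eps / (`|C| + 1))) => /=.
  by rewrite lt_min e0 divr_gt0.
move=> t /=; rewrite sub0r normrN lt_min => /andP[te teps] t0.
have -> : L - t^-1 *: (f (t *: v + x) - f x)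
    = - (t^-1 * (f (t *: v + x) - f x - t * L)).
  by rewrite -[t^-1 *: _]/(t^-1 * _); field.
rewrite normrN normrM normfV ltr_pdivrMl ?normr_gt0//.
apply: le_lt_trans (fC _ te) _.
apply: (@le_lt_trans _ _ (`|C| * t ^+ 2)).
  by rewrite ler_wpM2r ?sqr_ge0// ler_norm.
rewrite -[t ^+ 2]real_normK ?num_real// expr2 mulrA [`|C| * _]mulrC -mulrA.
rewrite ltr_pM2l ?normr_gt0//.
rewrite ltr_pdivlMr// in teps; apply: le_lt_trans teps.
by rewrite mulrC ler_wpM2l// lerDl.
Qed.

Lemma continuous_dist (f : V -> R) x :
  (forall e : R, 0 < e -> \forall y \near x, `|f y - f x| < e) ->
  {for x, continuous f}.
Proof.
move=> H; rewrite /prop_for/continuous_at.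
by apply/(@cvgrPdistC_lt _ _ _ (nbhs x) _ f); exact: H.
Qed.

Lemma coord_near x (i : 'I_m.+2) (e : R) : 0 < e -> \forall y \near x, `|(y : V) 0 i - x 0 i| < e.
Proof.
move=> e0; have /cvgrPdist_lt/(_ _ e0) := @coord_continuous _ _ _ 0 i x.
by apply: filterS => y; rewrite distrC.
Qed.

Lemma zcoord_near x (e : R) : 0 < e -> \forall y \near x, cmod (zcoord y - zcoord x) < e.
Proof.
move=> e0; have e20 : 0 < e / 2 by rewrite divr_gt0.
near=> y; apply: (le_lt_trans (cmod_le_norm _ _)).
rewrite [ltRHS]splitr ltrD//.
  by near: y; exact: coord_near.
by near: y; exact: coord_near.
Unshelve. all: by end_near. Qed.

Definition zdisk : set V := [set x | cmod (zcoord x) < 1].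

Lemma open_zdisk : open zdisk.
Proof.
rewrite openE => x x1; rewrite /interior.
have : 0 < 1 - cmod (zcoord x) by rewrite subr_gt0.
move=> /(zcoord_near x); apply: filterS => y yx; rewrite -[zdisk y]/(is_true (cmod (zcoord y) < 1)).
rewrite -[zcoord y](subrK (zcoord x)) (le_lt_trans (cmodD _ _))//.
by rewrite -ltrBrDr.
Qed.

(** [Some l] when a unit step along axis [i] moves [z] by ['i ^+ l], and [None] for the axes that
    leave [z] fixed. *)
Definition zdir (i : 'I_m.+2) : option nat :=
  if i == ord0 then Some 0%N else if i == lift ord0 ord0 then Some 1%N else None.

Lemma zcoord_shift x (i : 'I_m.+2) (t : R) :
  zcoord (t *: delta_mx 0 i + x) =
  zcoord x + (if zdir i is Some l then t%:C%C * 'iC ^+ l else 0).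
Proof.
rewrite /zcoord /zdir !mxE !eqxx/= [ord0 == i]eq_sym [lift _ _ == i]eq_sym.
case: eqP => [->|_].
  by rewrite mulr1 mulr0 add0r expr0 mulr1 addrC; congr (_ +i* _)%C; rewrite /= ?addr0.
by case: eqP => [_|_]; rewrite ?mulr1 ?mulr0 ?add0r ?addr0// expr1 addrC;
  congr (_ +i* _)%C; rewrite /= ?mulr1 ?mulr0 ?mul0r ?subr0 ?addr0 ?add0r.
Qed.

Lemma zdisk_radius x : zdisk x -> exists r, cmod (zcoord x) < r /\ 0 < r < 1.
Proof.
move=> x1; have {}x1 : cmod (zcoord x) < 1 by [].
have x0 := cmod_ge0 (zcoord x).
by exists ((cmod (zcoord x) + 1) / 2); split; [lra|apply/andP; split; lra].
Qed.

Lemma continuous_zseries k d x : zdisk x -> {for x, continuous (zseries k d)}.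
Proof.
move=> /[dup] x1 /zdisk_radius[r [xr r01]].
have [C C0 lipC] := zterm_lip k d r01.
apply: continuous_dist => e e0.
have C1 : 0 < C * 2 + 1 by rewrite ltr_wpDl// mulr_ge0.
have d1 : 0 < r - cmod (zcoord x) by rewrite subr_gt0.
have d2 : 0 < e / (C * 2 + 1) by rewrite divr_gt0.
move: (zcoord_near x d1) (zcoord_near x d2); apply: filterS2 => y yx1 yx2.
set h := zcoord y - zcoord x in yx1 yx2.
have yE : zcoord y = zcoord x + h by rewrite addrC subrK.
have yr : cmod (zcoord x + h) <= r.
  by rewrite (le_trans (cmodD _ _))// addrC -lerBrDr ltW.
have cy : cvgn (psum (zterm k d (zcoord y))).
  by apply: zseries_cvg; rewrite yE (le_lt_trans yr)//; case/andP : r01.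
have Ch0 : 0 <= C * cmod h by rewrite mulr_ge0// cmod_ge0.
have lipxy := lipC _ _ (ltW xr) yr; rewrite -yE in lipxy.
have := lim_psum_sub_le lipxy Ch0 cy (zseries_cvg x1).
move=> /le_lt_trans; apply; rewrite mulrAC.
rewrite ltr_pdivlMr// in yx2; apply: le_lt_trans yx2.
by rewrite mulrC ler_wpM2l ?cmod_ge0// lerDl.
Qed.

Lemma is_derive_zseries k d x i : zdisk x ->
  is_derive x (delta_mx 0 i) (zseries k d)
    (if zdir i is Some l then zseries (k + l) d.+1 x else 0).
Proof.
move=> /[dup] x1 /zdisk_radius[r [xr r01]].
have d1 : 0 < r - cmod (zcoord x) by rewrite subr_gt0.
have := zcoord_shift x i; case: (zdir i) => [l|] xt; last first.
  apply: (@is_derive_quadratic _ _ _ _ _ 0 1) => // t _.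
  by rewrite /zseries xt addr0 subrr mulr0 subr0 normr0 mul0r.
have [C C0 tayC] := zterm_taylor k d l r01.
apply: (@is_derive_quadratic _ _ _ _ _ (C * 2) (r - cmod (zcoord x))) => // t td.
have tr : cmod (zcoord x + t%:C%C * 'iC ^+ l) <= r.
  rewrite (le_trans (cmodD _ _))// addrC -lerBrDr ltW//.
  by rewrite Normc.normcM cmod_i cmod_real mulr1.
have Ct0 : 0 <= C * t ^+ 2 by rewrite mulr_ge0// sqr_ge0.
have cx l' d' : cvgn (psum (zterm l' d' (zcoord x))) by exact: zseries_cvg.
have cy : cvgn (psum (zterm k d (zcoord (t *: delta_mx 0 i + x)))).
  by apply: zseries_cvg; rewrite xt (le_lt_trans tr)//; case/andP : r01.
have tayx := tayC _ _ (ltW xr) tr; rewrite -xt in tayx.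
rewrite mulrAC; exact: lim_psum_taylor_le tayx Ct0 cy (cx _ _) (cx _ _).
Qed.

(** A class stable under all partial derivatives, so that [Ck_on] becomes an induction over the list
    of directions. The second alternative arises from the axes that leave [z] fixed; equality is
    asked on [zdisk] only, where the series are controlled. *)
Definition zseries_like (f : V -> R) : Prop :=
  (exists k d, {in zdisk, f =1 zseries k d}) \/ {in zdisk, f =1 cst 0}.

Lemma near_zdisk x (f g : V -> R) : zdisk x -> {in zdisk, f =1 g} ->
  {near x, f =1 g}.
Proof.
move=> x1 fg; have := open_nbhs_nbhs (conj open_zdisk x1).
by apply: filterS => y y1; apply: fg; rewrite inE.
Qed.

Lemma zseries_like_continuous f x : zseries_like f -> zdisk x -> {for x, continuous f}.
Proof.
move=> ff x1.
suff [g gc fg] : exists2 g : V -> R, {for x, continuous g} & {in zdisk, f =1 g}.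
  apply: continuous_dist => e e0; rewrite fg ?inE//.
  have /(@cvgrPdistC_lt _ _ _ (nbhs x) _ g)/(_ e e0) := gc.
  by move: (near_zdisk x1 fg); apply: filterS2 => y ->.
case: ff => [[k [d fE]]|fE]; last by exists (cst 0) => //; exact: cst_continuous.
by exists (zseries k d) => //; exact: continuous_zseries.
Qed.

Lemma is_derive_zdisk (f g : V -> R) x v L : zdisk x -> {in zdisk, f =1 g} ->
  is_derive x v g L -> is_derive x v f L.
Proof.
move=> x1 fg; apply: near_eq_is_derive.
by move: (near_zdisk x1 fg); apply: filterS => y ->.
Qed.

Lemma zseries_like_derive f i : zseries_like f ->
  {in zdisk, forall x, derivable f x (delta_mx 0 i)} /\ zseries_like (partial i f).
Proof.
move=> [[k [d fE]]|fE].
  have fD x : zdisk x -> is_derive x (delta_mx 0 i) f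
      (if zdir i is Some l then zseries (k + l) d.+1 x else 0).
    by move=> x1; apply: (is_derive_zdisk x1 fE); exact: is_derive_zseries.
  split=> [x|]; first by rewrite inE => /fD[].
  move: fD; case: (zdir i) => [l|] fD; [left; exists (k + l)%N, d.+1|right];
    by move=> x /[!inE] x1; rewrite /partial; have /(@derive_val _ _ _ _ _ _ _) -> := fD x x1.
have fD x : zdisk x -> is_derive x (delta_mx 0 i) f 0.
  by move=> x1; apply: (is_derive_zdisk x1 fE); exact: is_derive_cst.
split=> [x|]; first by rewrite inE => /fD[].
by right=> x /[!inE] x1; rewrite /partial; have /(@derive_val _ _ _ _ _ _ _) -> := fD x x1.
Qed.

Lemma zseries_like_Ck k f A : A `<=` zdisk -> zseries_like f -> Ck_on k A f.
Proof.
move=> A1 ff s _.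
have fs : zseries_like (iter_partial s f).
  by elim: s => //= i s IH; exact: (zseries_like_derive i IH).2.
split=> [x /A1|_ x i /A1 x1]; first exact: zseries_like_continuous.
by apply: (zseries_like_derive i fs).1; rewrite inE.
Qed.

Lemma partial_zseries k d i (f : V -> R) : {in zdisk, f =1 zseries k d} ->
  {in zdisk, partial i f =1
    fun x => if zdir i is Some l then zseries (k + l) d.+1 x else 0}.
Proof.
move=> fE x /[!inE] x1; rewrite /partial.
by have /(@derive_val _ _ _ _ _ _ _) -> := is_derive_zdisk x1 fE (is_derive_zseries k d i x1).
Qed.

Lemma partial2_zseries k d i x : zdisk x ->
  partial i (partial i (zseries k d)) x =
    if zdir i is Some l then zseries (k + l + l) d.+2 x else 0.
Proof.
move=> x1; have h := @partial_zseries k d i (zseries k d) (fun _ _ => erefl).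
case il: (zdir i) h => [l|] h; first by rewrite (partial_zseries i h) ?inE// il.
by rewrite {1}/partial; have [_ ->] := is_derive_zdisk x1 h (is_derive_cst 0 x (delta_mx 0 i)).
Qed.

Lemma zseriesS2 k d x : zdisk x -> zseries k.+2 d x = - zseries k d x.
Proof.
move=> x1; rewrite /zseries.
have -> : psum (zterm k.+2 d (zcoord x)) = - psum (zterm k d (zcoord x)).
  apply/funext => N; transitivity (- psum (zterm k d (zcoord x)) N) => //.
  by rewrite /psum -sumrN; apply: eq_bigr => j _; exact: ztermS2.
by rewrite limN//; exact: zseries_cvg.
Qed.

Lemma harmonic_zseries k d A : A `<=` zdisk -> harmonic_on A (zseries k d : V -> R).
Proof.
move=> A1; split; first by apply: zseries_like_Ck => //; left; exists k, d.
move=> x /A1 x1; rewrite /laplacian; under eq_bigr do rewrite partial2_zseries//.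
(* The two surviving terms are [zseries k d.+2] and [zseries k.+2 d.+2], opposite because
   ['i ^+ 2 = -1]. *)
rewrite big_ord_recl big_ord_recl /= big1 ?addr0//.
by rewrite !addn0 !addn1 zseriesS2// subrr.
Qed.

End harmonic.

(** * Behaviour at the boundary *)

Section boundary.
Context {R : realType} {m : nat}.
Notation cmod := (@Normc.normc R).
Notation V := ('rV[R]_m.+2).
Implicit Types (x y : V) (w : R[i]).

Lemma enorm_ge_zcoord x : cmod (zcoord x) <= enorm x.
Proof.
rewrite /enorm ler_wsqrtr// 2!big_ord_recl addrA lerDl sumr_ge0// => i _.
exact: sqr_ge0.
Qed.

Lemma unit_ball_zdisk : unit_ball R m.+2 `<=` zdisk.
Proof. by move=> x; apply: le_lt_trans; exact: enorm_ge_zcoord. Qed.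

Lemma zterm00_dominated w : cmod w <= 1 -> sqr_dominated 1 (zterm 0 0 w).
Proof.
move=> w1 j j0; rewrite mul1r /zterm /dcoef ffactn0 mulr1 subn0 expr0 mul1r.
rewrite normrM ger0_norm ?invr_ge0 ?sqr_ge0// ler_piMr ?invr_ge0 ?sqr_ge0//.
by rewrite (le_trans (norm_Re_le _))// cmodX exprn_ile1 ?cmod_ge0.
Qed.

Lemma closed_ball_zcoord x : closed_unit_ball R m.+2 x -> cmod (zcoord x) <= 1.
Proof. by apply: le_trans; exact: enorm_ge_zcoord. Qed.

Lemma psum_zterm_lip w w' N : cmod w <= 1 -> cmod w' <= 1 ->
  `|psum (zterm 0 0 w') N - psum (zterm 0 0 w) N| <=
     (\sum_(1 <= j < N.+1) (2 ^ j)%:R) * cmod (w' - w).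
Proof.
move=> w1 w'1; rewrite /psum -sumrB mulr_suml (le_trans (ler_norm_sum _ _ _))//.
rewrite big_nat_cond [leRHS]big_nat_cond; apply: ler_sum => j /[!andbT] /andP[j0 _].
rewrite /zterm -mulrBr -ReN -ReD -mulrN -mulrDr expr0 mul1r /dcoef ffactn0 mulr1 subn0.
rewrite normrM ger0_norm ?invr_ge0 ?sqr_ge0//.
have wE : w' = w + (w' - w) by rewrite addrC subrK.
have := @cmod_lipX _ w (w' - w) 1 (2 ^ j) w1; rewrite -wE => /(_ w'1).
rewrite expr1n !mulr1; apply: le_trans.
rewrite -[leRHS]mul1r; apply: ler_pM; rewrite ?invr_ge0 ?sqr_ge0//; last exact: norm_Re_le.
by rewrite invf_le1 ?exprn_gt0 ?ltr0n// -natrX ler1n expn_gt0 j0.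
Qed.

Lemma norm_sub_three (a b c d e : R) : `|a - c| < e / 3 -> `|b - d| < e / 3 ->
  `|c - d| < e / 3 -> `|a - b| < e.
Proof.
move=> /ltr_normlP[a1 a2] /ltr_normlP[b1 b2] /ltr_normlP[c1 c2].
by apply/ltr_normlP; split; lra.
Qed.

(** Used with [a = 2 ^ - M] and [n = 2 ^ M], where it reads [(1 - a) ^ n <= 1 / 2]. *)
Lemma bernoulli_inv (a : R) n : 0 <= a <= 1 -> (1 - a) ^+ n * (1 + n%:R * a) <= 1.
Proof.
move=> /andP[a0 a1]; elim: n => [|n IH]; first by rewrite mul0r addr0 mulr1.
apply: le_trans IH; rewrite exprSr -mulrA ler_wpM2l ?exprn_ge0 ?subr_ge0// -natr1.
have n0 : 0 <= n%:R :> R by [].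
have : 0 <= n%:R * a * a by rewrite !mulr_ge0.
have : 0 <= a * a by rewrite mulr_ge0.
nra.
Qed.

(** At real points of [[0, 1]] every term of the difference is nonnegative, so the single term [M]
    bounds the sum from below. *)
Lemma psum_one_sub (b : R) M N : 0 <= b <= 1 -> (0 < M <= N)%N ->
  (M%:R ^+ 2)^-1 * (1 - b ^+ (2 ^ M)) <=
    psum (zterm 0 0 (1%:C%C : R[i])) N - psum (zterm 0 0 b%:C%C) N.
Proof.
move=> /andP[b0 b1] /andP[M0 MN]; rewrite /psum -sumrB.
have E j : zterm 0 0 (1%:C%C : R[i]) j - zterm 0 0 b%:C%C j = (j%:R ^+ 2)^-1 * (1 - b ^+ (2 ^ j)).
  rewrite /zterm /dcoef !ffactn0 !mulr1 subn0 !expr0 !mul1r -mulrBr.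
  by rewrite -!(rmorphXn (@real_complex R)) expr1n.
have E0 j : 0 <= (j%:R ^+ 2)^-1 * (1 - b ^+ (2 ^ j)).
  by rewrite mulr_ge0 ?invr_ge0 ?sqr_ge0// subr_ge0 exprn_ile1.
under eq_bigr do rewrite E.
rewrite (@big_cat_nat _ _ _ M)//= ?leqW//.
rewrite [X in _ <= _ + X]big_ltn// addrCA lerDl addr_ge0// sumr_ge0// => j _; exact: E0.
Qed.

Lemma enorm_scale_delta (a : R) (i : 'I_m.+2) : enorm (a *: delta_mx 0 i : V) = `|a|.
Proof.
rewrite /enorm (bigD1 i)//= big1 ?addr0; last first.
  by move=> j ji; rewrite !mxE eqxx (negbTE ji) mulr0 expr0n.
by rewrite !mxE !eqxx mulr1 sqrtr_sqr.
Qed.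

(** Here [q] is [M] and [s] is [2 ^ (- e M)]. Of the three powers of [q], two absorb the size of the
    increment and one is left to be unbounded. *)
Lemma holder_growth_contra (C D q s : R) : 0 < q -> 0 <= s -> q ^+ 3 * s <= D ->
  (q ^+ 2)^-1 / 2 <= C * s -> q <= 2 * `|C| * D.
Proof.
move=> q0 s0 qs h.
have q2 : 0 < q ^+ 2 by rewrite exprn_gt0.
have : (q ^+ 2)^-1 / 2 <= `|C| * s by apply: (le_trans h); rewrite ler_wpM2r ?ler_norm.
rewrite -invfM -div1r ler_pdivrMr ?mulr_gt0// => h1.
have -> : q = q * 1 by rewrite mulr1.
apply: (@le_trans _ _ (q * (`|C| * s * (q ^+ 2 * 2)))); first by rewrite ler_pM2l.
have -> : q * (`|C| * s * (q ^+ 2 * 2)) = 2 * `|C| * (q ^+ 3 * s) by ring.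
by rewrite ler_wpM2l// mulr_ge0.
Qed.

Lemma lim_sub_ge (a b : nat -> R) c M : cvgn a -> cvgn b ->
  (forall N, (M <= N)%N -> c <= a N - b N) -> c <= limn a - limn b.
Proof.
move=> ca cb cab; rewrite -limB//; apply: limr_ge; first exact: is_cvgB.
by exists M => // N MN; exact: cab.
Qed.

Hypothesis m_ge2 : (2 <= m.+2)%N.
Notation u := (@lacunary R m.+2 m_ge2).

Lemma lacunary_termE x : lacunary_term m_ge2 x = zterm 0 0 (zcoord x).
Proof.
apply/funext => j; rewrite /lacunary_term /zterm /dcoef ffactn0 mulr1 subn0 expr0 mul1r.
by rewrite /coord1 /coord2 /zcoord; congr (_ * complex.Re ((x 0 _ +i* x 0 _)%C ^+ _)); exact: val_inj.
Qed.

Lemma lacunaryE : u = zseries 0 0.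
Proof.
apply/funext => x; rewrite /lacunary /zseries -lacunary_termE.
by congr (limn _); apply/funext.
Qed.

Lemma lacunary_psumE x : lacunary_psum m_ge2 x = psum (zterm 0 0 (zcoord x)).
Proof. by rewrite -lacunary_termE; apply/funext. Qed.

Lemma lacunary_cvg x : closed_unit_ball R m.+2 x -> cvgn (lacunary_psum m_ge2 x).
Proof.
move=> /closed_ball_zcoord/zterm00_dominated x1; rewrite lacunary_psumE.
exact: cvg_psum x1 ler01.
Qed.

(** Uniform approximation on the closed ball: the tail after [N] terms is at most [1 / N], and each
    partial sum is Lipschitz in [z]. *)
Lemma lacunary_continuous : {within closed_unit_ball R m.+2, continuous u}.
Proof.
apply/subspace_continuousP => x x1; rewrite lacunaryE.
apply/(@cvgrPdistC_lt _ _ _ (within _ (nbhs x))) => e e0.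
have [N [N0 Ne]] : exists N, (0 < N)%N /\ 1 / N%:R < e / 3.
  exists (Num.truncn (3 / e)).+1; split => //.
  by rewrite ltr_pdivrMr ?ltr0n// mulrAC ltr_pdivlMr// mul1r mulrC -ltr_pdivrMr// truncnS_gt.
pose K : R := \sum_(1 <= j < N.+1) (2 ^ j)%:R.
have K0 : 0 <= K by rewrite sumr_ge0.
have d0 : 0 < e / (3 * (K + 1)) by rewrite divr_gt0// mulr_gt0// ltr_wpDl.
suff : \forall y \near x, closed_unit_ball R m.+2 y -> `|zseries 0 0 y - zseries 0 0 x| < e by [].
move: (zcoord_near x d0); apply: filterS => y yx y1.
have tl z : closed_unit_ball R m.+2 z ->
    `|zseries 0 0 z - psum (zterm 0 0 (zcoord z)) N| < e / 3.
  move=> z1; apply: le_lt_trans Ne; apply: lim_psum_tail => //.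
  exact/zterm00_dominated/closed_ball_zcoord.
apply: (norm_sub_three (tl y y1) (tl x x1)).
apply: (le_lt_trans (psum_zterm_lip _ _ _)); try exact: closed_ball_zcoord.
apply: (@le_lt_trans _ _ ((K + 1) * cmod (zcoord y - zcoord x))).
  by rewrite ler_wpM2r ?cmod_ge0// lerDl.
by rewrite mulrC -ltr_pdivlMr ?ltr_wpDl// -mulrA -invfM.
Qed.

Lemma lacunary_not_holder (e : R) : 0 < e ->
  ~ holder_on e (closed_unit_ball R m.+2) u.
Proof.
(* [r] is [2 ^ - e], so that [(2 ^ - M) ^ e = r ^ M]. *)
move=> e0 [C hC]; pose r := expR (- (e * ln 2)).
have l2 : 0 < ln 2 :> R by rewrite ln_gt0// ltr1n.
have r01 : 0 < r < 1.
  by rewrite expR_gt0 expR_lt1 oppr_lt0 mulr_gt0.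
have [D D0 hD] := natX_geom_bounded 3 r01.
have main M : (0 < M)%N -> (M%:R ^+ 2)^-1 / 2 <= C * r ^+ M.
  move=> M0; pose b : R := 1 - 2^-1 ^+ M.
  have h01 : 0 <= (2^-1 : R) ^+ M <= 1.
    by rewrite exprn_ge0// exprn_ile1// invf_le1// ler1n.
  have b01 : 0 <= b <= 1 by rewrite /b; apply/andP; split; lra.
  have in1 a : 0 <= a <= 1 -> closed_unit_ball R m.+2 (a *: delta_mx 0 ord0).
    by move=> /andP[a0 a1]; rewrite /closed_unit_ball/= enorm_scale_delta ger0_norm.
  have zE a : zcoord (a *: delta_mx 0 ord0 : V) = a%:C%C.
    by rewrite /zcoord !mxE/= mulr1 mulr0.
  have x1 := in1 _ (introT andP (conj ler01 (lexx 1))); have y1 := in1 _ b01.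
  have := hC _ _ x1 y1; rewrite -scalerBl enorm_scale_delta lacunaryE /zseries !zE.
  have bE : 1 - b = 2^-1 ^+ M by rewrite /b subKr.
  rewrite bE [`|2^-1 ^+ M|]ger0_norm; last by case/andP : h01.
  have -> : (2^-1 ^+ M : R) `^ e = r ^+ M.
    have h0 : (0 : R) < 2^-1 ^+ M by rewrite exprn_gt0// invr_gt0.
    rewrite /powR gt_eqF// lnXn ?invr_gt0// lnV ?posrE// /r -expRM_natl.
    by congr expR; rewrite -mulr_natl; ring.
  apply: le_trans; apply: le_trans (ler_norm _).
  have c1 a : 0 <= a <= 1 -> cvgn (psum (zterm 0 0 (a%:C%C : R[i]))).
    move=> a01; have := zterm00_dominated (closed_ball_zcoord (in1 _ a01)).
    by rewrite zE => /cvg_psum/(_ ler01).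
  have cx := c1 _ (introT andP (conj ler01 (lexx 1))); have cy := c1 _ b01.
  apply: (lim_sub_ge (M := M) cx cy) => N MN; apply: le_trans (@psum_one_sub b M N b01 _); last first.
    by rewrite M0.
  rewrite ler_wpM2l ?invr_ge0 ?sqr_ge0//.
  have := @bernoulli_inv (2^-1 ^+ M) (2 ^ M) h01; rewrite -/b natrX -exprMn divff// expr1n.
  by move=> ?; lra.
pose M := (Num.truncn (2 * `|C| * D)).+1.
have M0 : 0 < M%:R :> R by rewrite ltr0n.
have s0 : 0 <= r ^+ M by rewrite exprn_ge0// ltW//; case/andP : r01.
have := holder_growth_contra M0 s0 (hD M) (main M isT).
by rewrite leNgt truncnS_gt.
Qed.

End boundary.

Lemma is_derive_comp1 {R : realType} (V : normedModType R) (f : V -> R)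
    (g : R -> R) x v dg :
  differentiable f x -> is_derive (f x) 1 g dg ->
  is_derive x v (fun y => g (f y)) (dg * 'D_v f x).
Proof.
move=> df [gd gE]; have dg' : differentiable g (f x) by apply/derivable1_diffP.
have dgf : differentiable (g \o f) x by exact: differentiable_comp.
apply: DeriveDef; first exact: diff_derivable.
rewrite -[fun y => g (f y)]/(g \o f) deriveE// diff_comp//= (deriveE v df).
set w := 'd f x v; rewrite -[w in LHS]mulr1 -[w * 1]/(w *: (1 : R)) linearZ /=.
by rewrite -deriveE// gE -[_ *: _]/(_ * _) mulrC.
Qed.

(** * Explicit smooth functions *)

Section flat.
Context {R : realType}.
Implicit Types (s t : R) (k : nat).

(* With the powers of [t^-1], the span of the family is closed under
   differentiation. *)
Definition flat k t : R := if 0 < t then t^-1 ^+ k * expR (- t^-1) else 0.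

Lemma flat_ge0 k t : 0 <= flat k t.
Proof.
by rewrite /flat; case: ifPn => // t0; rewrite mulr_ge0 ?expR_ge0// exprn_ge0 ?invr_ge0 ?ltW.
Qed.

Lemma flat_le_fact k t : flat k t <= k`!%:R.
Proof.
rewrite /flat; case: ifPn => [t0|_]; last exact: ler0n.
have s0 : 0 <= t^-1 by rewrite invr_ge0 ltW.
rewrite expRN ler_pdivrMr ?expR_gt0// mulrC -ler_pdivrMr ?ltr0n ?fact_gt0//.
case: k => [|k].
  by rewrite expr0 [0`!%:R](_ : _ = 1)// divr1 (le_trans _ (expR_ge1Dx _))// lerDl.
by apply: le_trans (expR_ge1Dxn k s0); rewrite lerDr.
Qed.

(** Two factors [t] are traded for two more powers of [t^-1]. This quadratic bound is why [flat k]
    has derivative [0] at [0]. *)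
Lemma flat_le_sqr k t : flat k t <= k.+2`!%:R * t ^+ 2.
Proof.
have [t0|t0] := ltP 0 t; last first.
  by rewrite {1}/flat ltNge t0/= mulr_ge0// sqr_ge0.
have -> : flat k t = flat k.+2 t * t ^+ 2.
  by rewrite /flat t0 !exprS; field; rewrite gt_eqF.
by rewrite ler_wpM2r ?sqr_ge0// flat_le_fact.
Qed.

Lemma is_derive_flat k t :
  is_derive t 1 (flat k) (flat k.+2 t - k%:R * flat k.+1 t).
Proof.
have [t0|t0|->] := ltgtP t 0.
- rewrite {2 3}/flat ltNge ltW//= mulr0 subrr.
  apply: (@near_eq_is_derive _ _ _ (cst 0)).
  by near=> s; rewrite /flat ltNge ltW//; near: s; exact: lt_nbhsl.
- apply: (@near_eq_is_derive _ _ _ (fun s : R => s^-1 ^+ k * expR (- s^-1))).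
    by near=> s; rewrite /flat ifT//; near: s; exact: lt_nbhsr.
  have t0' : t != 0 by rewrite gt_eqF.
  have dV : is_derive t 1 (fun s : R => s^-1) (- t^-1 ^+ 2).
    apply: DeriveDef; first exact: (@derivableV _ _ id t 1 t0' (@derivable_id _ _ t 1)).
    rewrite (@deriveV _ _ id t 1 t0' (@derivable_id _ _ t 1)).
    by rewrite derive_id exprVn -[_ *: _]/(_ * _) mulr1.
  have dX := is_deriveX k dV.
  have dN := is_deriveN dV.
  have dfN : differentiable (fun s : R => - s^-1) t by apply/derivable1_diffP; case: dN.
  have dE := @is_derive_comp1 _ _ _ _ t 1 _ dfN (is_derive_expR (- t^-1)).
  rewrite (@derive_val _ _ _ _ _ _ _ dN) in dE.
  rewrite exprfctE in dX; have dM := is_deriveM dX dE; apply: (is_derive_eq dM).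
  rewrite /flat t0 -![_ *: _]/(_ * _).
  by case: k {dX dM} => [|k]; rewrite /= ?expr0 ?mul0r ?exprS; ring.
- rewrite {2 3}/flat ltxx mulr0 subrr.
  apply: (@is_derive_quadratic _ _ _ _ _ _ (k.+2`!%:R) 1) => // s _.
  have -> : flat k 0 = 0 by rewrite /flat ltxx.
  rewrite mulr0 !subr0 addr0 -[s *: 1]/(s * 1) mulr1.
  by rewrite ger0_norm ?flat_ge0// flat_le_sqr.
Unshelve. all: by end_near. Qed.

Lemma continuous_flat k : continuous (flat k).
Proof.
move=> t; apply: differentiable_continuous; apply/derivable1_diffP.
by have [] := is_derive_flat k t.
Qed.

End flat.

Section elementary.
Context {R : realType} {n : nat}.
Notation V := ('rV[R]_n).
Implicit Types (f g : V -> R) (x y v : V) (i : 'I_n).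

(** A syntactic class of smooth functions containing the harmonics and the bump. Closure under
    partial derivatives and translations, measurability and boundedness on boxes all follow by
    induction on the construction. *)
Inductive elementary : (V -> R) -> Prop :=
| elementary_cst c : elementary (fun=> c)
| elementary_coord i : elementary (fun x => x 0 i)
| elementaryD f g : elementary f -> elementary g -> elementary (fun x => f x + g x)
| elementaryM f g : elementary f -> elementary g -> elementary (fun x => f x * g x)
| elementary_flat k f : elementary f -> elementary (fun x => flat k (f x)).

Lemma elementaryN f : elementary f -> elementary (fun x => - f x).
Proof.
move=> ef; rewrite (_ : (fun x => _) = (fun x => -1 * f x)).
  by apply: elementaryM => //; exact: elementary_cst.
by apply/funext => x; rewrite mulN1r.
Qed.

Lemma elementaryB f g : elementary f -> elementary g ->
  elementary (fun x => f x - g x).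
Proof. by move=> ef eg; apply: elementaryD => //; exact: elementaryN. Qed.

Lemma elementaryZ c f : elementary f -> elementary (fun x => c * f x).
Proof. by move=> ef; apply: elementaryM => //; exact: elementary_cst. Qed.

Lemma elementaryX k f : elementary f -> elementary (fun x => f x ^+ k).
Proof.
move=> ef; elim: k => [|k IH]; first exact: elementary_cst.
rewrite (_ : (fun x => _) = (fun x => f x * f x ^+ k)); first exact: elementaryM.
by apply/funext => x; rewrite exprS.
Qed.

Lemma elementary_sum (I : Type) (r : seq I) (P : pred I) (F : I -> V -> R) :
  (forall a, P a -> elementary (F a)) ->
  elementary (fun x => \sum_(a <- r | P a) F a x).
Proof.
move=> eF; elim: r => [|a r IH].
  rewrite (_ : (fun x => _) = fun=> 0); first exact: elementary_cst.
  by apply/funext => x; rewrite big_nil.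
have [Pa|Pa] := boolP (P a); last first.
  rewrite (_ : (fun x => _) = (fun x => \sum_(a <- r | P a) F a x)) //.
  by apply/funext => x; rewrite big_cons (negbTE Pa).
rewrite (_ : (fun x => _) = (fun x => F a x + \sum_(a <- r | P a) F a x)).
  exact: elementaryD (eF _ Pa) IH.
by apply/funext => x; rewrite big_cons Pa.
Qed.

Lemma elementary_shift f v : elementary f -> elementary (fun x => f (x + v)).
Proof.
elim=> [c|i|g h _ eg _ eh|g h _ eg _ eh|k g _ eg].
- exact: elementary_cst.
- rewrite (_ : (fun x => _) = (fun x => x 0 i + v 0 i)).
    by apply: elementaryD; [exact: elementary_coord|exact: elementary_cst].
  by apply/funext => x; rewrite !mxE.
- exact: elementaryD.
- exact: elementaryM.
- exact: elementary_flat.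
Qed.

Lemma elementary_differentiable f x : elementary f -> differentiable f x.
Proof.
elim=> [c|i|g h _ eg _ eh|g h _ eg _ eh|k g _ eg].
- exact: differentiable_cst.
- exact: differentiable_coord.
- exact: differentiableD.
- exact: differentiableM.
- apply: (@differentiable_comp _ _ _ _ g (flat k)) => //.
  by apply/derivable1_diffP; have [] := is_derive_flat k (g x).
Qed.

Lemma elementary_partial i f : elementary f -> elementary (partial i f).
Proof.
have dv g x v : elementary g -> derivable g x v.
  by move=> eg; apply: diff_derivable; exact: elementary_differentiable.
elim=> [c|j|g h eg eg' eh eh'|g h eg eg' eh eh'|k g eg eg'].
- rewrite (_ : partial _ _ = fun=> 0); first exact: elementary_cst.
  by apply/funext => x; rewrite /partial derive_cst.
- rewrite (_ : partial _ _ = fun=> (delta_mx 0 i : V) 0 j); first exact: elementary_cst.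
  apply/funext => x; rewrite /partial.
  have [] // := @is_derive_quadratic R V (fun x : V => x 0 j) x (delta_mx 0 i) ((delta_mx 0 i : V) 0 j) 0 1 ltr01 _.
  by move=> t _; rewrite !mxE addrK subrr normr0 mul0r.
- rewrite (_ : partial _ _ = fun x => partial i g x + partial i h x).
    exact: elementaryD.
  by apply/funext => x; rewrite /partial deriveD//; exact: dv.
- rewrite (_ : partial _ _ = fun x => g x * partial i h x + h x * partial i g x).
    by apply: elementaryD; exact: elementaryM.
  by apply/funext => x; rewrite /partial deriveM//; exact: dv.
- rewrite (_ : partial _ _ = fun x => (flat k.+2 (g x) - k%:R * flat k.+1 (g x)) * partial i g x).
    apply: elementaryM => //; apply: elementaryB; first exact: elementary_flat.
    by apply: elementaryZ; exact: elementary_flat.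
  apply/funext => x; rewrite /partial.
  have dg := elementary_differentiable x eg.
  by have [_ ->] := is_derive_comp1 (delta_mx 0 i) dg (is_derive_flat k (g x)).
Qed.

Lemma elementary_Ck k A f : elementary f -> Ck_on k A f.
Proof.
move=> ef s _; have es : elementary (iter_partial s f).
  by elim: s => //= i s IH; exact: elementary_partial.
split=> [x _|_ x i _].
  by apply: differentiable_continuous; exact: elementary_differentiable.
by apply: diff_derivable; exact: elementary_differentiable.
Qed.

Lemma measurable_coord i : measurable_fun setT (fun x : V => x 0 i).
Proof. by have /measurable_fun_rVP := @measurable_id _ V setT; exact. Qed.

Lemma elementary_measurable f : elementary f -> measurable_fun setT f.
Proof.
elim=> [c|i|g h _ eg _ eh|g h _ eg _ eh|k g _ eg].
- exact: measurable_cst.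
- exact: measurable_coord.
- exact: measurable_funD.
- exact: measurable_funM.
- apply: (@measurableT_comp _ _ _ _ _ _ (flat k)) => //.
  by apply: continuous_measurable_fun; exact: continuous_flat.
Qed.

Definition box (r : R) : set V := [set x | forall i, `|x 0 i| <= r].

Lemma elementary_bounded f r : elementary f -> exists C, forall x, box r x -> `|f x| <= C.
Proof.
elim=> [c|i|g h _ [C eg] _ [D eh]|g h _ [C eg] _ [D eh]|k g _ _].
- by exists `|c|.
- by exists r => x; exact.
- exists (C + D) => x xr; rewrite (le_trans (ler_normD _ _))// lerD//; [exact: eg|exact: eh].
- by exists (C * D) => x xr; rewrite normrM ler_pM//; [exact: eg|exact: eh].
- by exists k`!%:R => x _; rewrite ger0_norm ?flat_ge0// flat_le_fact.
Qed.

Lemma partial_shift f v i : partial i (fun x => f (x + v)) = fun x => partial i f (x + v).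
Proof.
apply/funext => x; rewrite /partial /derive; congr (lim (_ @ 0^')).
by apply/funext => t /=; rewrite addrA.
Qed.

Lemma iter_partial_shift f v s :
  iter_partial s (fun x => f (x + v)) = fun x => iter_partial s f (x + v).
Proof. by elim: s => //= i s ->; rewrite partial_shift. Qed.

Lemma elementary_iter_partial s f : elementary f -> elementary (iter_partial s f).
Proof. by move=> ef; elim: s => //= i s; exact: elementary_partial. Qed.

Definition vanishes_off (A : set V) f := forall x, ~ A x -> f x = 0.

End elementary.

(** * Lebesgue measure and integration by parts *)

Section translation.
Context {R : realType}.

Lemma lebesgue_measure_shift (a : R) (A : set (measurableTypeR R)) :
  measurable A ->
  lebesgue_measure ((fun t : measurableTypeR R => t + a : measurableTypeR R) @^-1` A) = lebesgue_measure A.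
Proof.
move=> mA; set phi := (fun t : measurableTypeR R => t + a : measurableTypeR R).
have mphi : measurable_fun setT phi.
  by apply: measurable_realfun.measurable_funD => //; exact: measurable_cst.
pose mu := measure_function_pushforward__canonical__measure_function_Measure
  (@lebesgue_measure R) mphi.
rewrite [RHS](@lebesgue_measure_unique R mu)// => X [[x y] _ <-] /=.
rewrite /pushforward (_ : phi @^-1` _ = `]x - a, y - a]%classic); last first.
  by apply/seteqP; split=> t; rewrite /phi/= !in_itv/= ltrBlDr lerBrDr.
rewrite !lebesgue_measure_itv/= !lte_fin ltrD2r.
by case: ifPn => // _; rewrite -!EFinB; congr (_%:E); ring.
Qed.

Lemma measurable_rV_shift n (v : 'rV[R]_n) : measurable_fun setT (fun x : 'rV[R]_n => x + v).
Proof.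
apply/measurable_fun_rVP => i.
rewrite (_ : (fun _ => _) = (fun x : 'rV[R]_n => x 0 i) \+ cst (v 0 i)).
  apply: measurable_realfun.measurable_funD; first exact: measurable_coord.
  exact: measurable_cst.
by apply/funext => x; rewrite !mxE.
Qed.

(** The translation splits into one of the first coordinate and one of the rest; uniqueness of the
    product measure on rectangles reduces the claim to the two factors. *)
Lemma lebesgue_rV_shift n (v : 'rV[R]_n) (A : set 'rV[R]_n) : measurable A ->
  lebesgue_rV n ((fun x => x + v) @^-1` A) = lebesgue_rV n A.
Proof.
elim: n v A => [|n IH] v A mA.
  congr (_ _); apply/seteqP; split=> x /=; rewrite [x + v](_ : _ = x)//;
    by rewrite (thinmx0 v) addr0.
rewrite /= /lebesgue_rV_step /pushforward.
have [v0 [w vE]] : exists v0 w, v = cons_rV (v0, w).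
  exists (v 0 ord0), (\row_j v 0 (lift ord0 j)); apply/rowP => j; rewrite /cons_rV mxE/=.
  by case: unliftP => [k ->|->]; rewrite ?mxE.
pose phi (z : measurableTypeR R * 'rV[R]_n) : measurableTypeR R * 'rV[R]_n :=
  ((z.1 + v0 : measurableTypeR R), z.2 + w).
have mphi : measurable_fun setT phi.
  apply: measurable_fun_pair.
    apply: measurable_realfun.measurable_funD => //.
  exact: (measurableT_comp (measurable_rV_shift w) measurable_snd).
pose mu := measure_function_pushforward__canonical__measure_function_Measure
  (lebesgue_measure \x lebesgue_rV n)%E mphi.
have mA' : measurable (@cons_rV R n @^-1` A).
  by rewrite -[X in measurable X]setTI; exact: measurable_cons_rV.
rewrite [RHS](@product_measure_unique _ _ _ _ _ _ _ mu)//.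
  congr (_ _); apply/seteqP; split=> -[t x] /=; rewrite vE /phi/=;
  by rewrite (_ : cons_rV (t, x) + cons_rV (v0, w) = cons_rV (t + v0, x + w))//;
    apply/rowP => j; rewrite !mxE; case: unlift => [k|]//=; rewrite !mxE.
move=> B C mB mC; rewrite /mu/= /pushforward.
rewrite (_ : phi @^-1` (B `*` C) = ((fun t : measurableTypeR R => t + v0 : measurableTypeR R) @^-1` B) `*` ((fun x => x + w) @^-1` C))//.
have mB' : measurable ((fun t : measurableTypeR R => t + v0 : measurableTypeR R) @^-1` B).
  rewrite -[X in measurable X]setTI.
  by apply: (@measurable_realfun.measurable_funD _ (measurableTypeR R) R setT id (cst v0)).
have mC' : measurable ((fun x => x + w) @^-1` C).
  by rewrite -[X in measurable X]setTI; exact: (measurable_rV_shift w).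
by rewrite product_measure1E//; congr (_ * _)%E; [exact: lebesgue_measure_shift|exact: IH].
Qed.

Lemma ge0_integral_shift n (v : 'rV[R]_n) (f : 'rV[R]_n -> \bar R) :
  measurable_fun setT f -> (forall x, 0 <= f x)%E ->
  (\int[lebesgue_rV n]_x f (x + v)%R = \int[lebesgue_rV n]_x f x)%E.
Proof.
move=> mf f0.
have ms := measurable_rV_shift v.
pose mu := measure_function_pushforward__canonical__measure_function_Measure
  (lebesgue_rV n) ms.
rewrite [RHS](eq_measure_integral mu); last first.
  by move=> A mA _; exact: esym (lebesgue_rV_shift v mA).
by rewrite [RHS]ge0_integral_pushforward// preimage_setT.
Qed.

Lemma integrable_shift n (v : 'rV[R]_n) (f : 'rV[R]_n -> \bar R) :
  (lebesgue_rV n).-integrable setT f ->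
  (lebesgue_rV n).-integrable setT (fun x => f (x + v)).
Proof.
move=> /integrableP[mf foo]; apply/integrableP; split.
  exact: (measurableT_comp mf (measurable_rV_shift v)).
rewrite (@ge0_integral_shift n v (fun x => `|f x|)%E)//.
exact: measurableT_comp.
Qed.

Lemma integral_shift n (v : 'rV[R]_n) (f : 'rV[R]_n -> \bar R) :
  (lebesgue_rV n).-integrable setT f ->
  (\int[lebesgue_rV n]_x f (x + v)%R = \int[lebesgue_rV n]_x f x)%E.
Proof.
move=> fi; have /integrableP[mf _] := fi.
have ms := measurable_rV_shift v.
pose mu := measure_function_pushforward__canonical__measure_function_Measure
  (lebesgue_rV n) ms.
rewrite [RHS](eq_measure_integral mu); last first.
  by move=> A mA _; exact: esym (lebesgue_rV_shift v mA).
rewrite [RHS]integral_pushforward// preimage_setT//.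
exact: integrable_shift.
Qed.

End translation.

Section box_supported.
Context {R : realType} {n : nat}.
Notation V := ('rV[R]_n).
Notation mu := (@lebesgue_rV R n).
Implicit Types (f g : V -> R) (x y v : V) (i : 'I_n) (r : R).

Lemma measurable_box r : measurable (box r : set V).
Proof.
rewrite (_ : box r = \bigcap_(i in [set: 'I_n]) (fun x : V => x 0 i) @^-1` `[- r, r]).
  apply: fin_bigcap_measurable => // i _; rewrite -[X in measurable X]setTI.
  exact: measurable_coord.
apply/seteqP; split=> x /= xr i; first by move=> _; rewrite /= in_itv/= -ler_norml.
by have := xr i Logic.I; rewrite /= in_itv/= -ler_norml.
Qed.

Lemma lebesgue_box r : 0 <= r -> mu (box r) = ((r *+ 2) ^+ n)%:E.
Proof.
move=> r0; rewrite (_ : box r = [set x | forall i, x 0 i \in `[- r, r]]).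
  rewrite (@lebesgue_rV_box R n (fun=> - r) (fun=> r)) => [|i]; last by rewrite ge0_cp.
  by rewrite prodr_const card_ord opprK.
by apply/seteqP; split=> x /= xr i; have := xr i; rewrite in_itv/= -ler_norml.
Qed.

Lemma subset_box r s : r <= s -> (box r : set V) `<=` box s.
Proof. by move=> rs x xr i; exact: le_trans (xr i) rs. Qed.

(** Wider than the compactly supported [elementary] functions: it also admits indicators of bounded
    sets, absolute values and products with bounded measurable functions, and still ensures
    integrability. *)
Record box_bounded f : Prop := BoxBounded {
  box_bounded_measurable : measurable_fun setT f;
  box_bounded_bound : exists C, forall x, `|f x| <= C;
  box_bounded_support : exists r, vanishes_off (box r) f }.

Lemma box_bounded_integrable f : box_bounded f -> mu.-integrable setT (EFin \o f).
Proof.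
move=> [mf [C fC] [r fr]]; apply/integrableP; split; first exact/measurable_EFinP.
pose s := `|r|; have s0 : 0 <= s by exact: normr_ge0.
have mb := measurable_box s.
apply: (@le_lt_trans _ _ (\int[mu]_x ((C * \1_(box s) x)%:E))%E).
  apply: ge0_le_integral => //.
  - by apply: measurableT_comp => //; exact/measurable_EFinP.
  - apply/measurable_EFinP; apply: measurable_realfun.measurable_funM => //.
  move=> x _; rewrite /= lee_fin indicE.
  have [xs|xs] := boolP (x \in box s); first by rewrite mulr1.
  rewrite fr ?normr0 ?mulr0// => xr; move/negP : xs; apply; rewrite inE.
  by apply: subset_box xr; exact: ler_norm.
have C0 : 0 <= C by apply: le_trans (fC 0).
under eq_integral do rewrite EFinM.
have mI : measurable_fun setT (EFin \o (\1_(box s) : V -> R)).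
  by apply/measurable_EFinP; exact: measurable_indic.
rewrite ge0_integralZl//.
rewrite integral_indic// setIT [X in (_ * X)%E](lebesgue_box s0).
by rewrite -EFinM ltry.
Qed.

Lemma elementary_box_bounded f r : elementary f -> vanishes_off (box r) f ->
  box_bounded f.
Proof.
move=> ef fr; split; [exact: elementary_measurable| |by exists r].
have [C fC] := elementary_bounded r ef; exists `|C| => x.
have [xr|xr] := pselect (box r x); last by rewrite fr// normr0.
by rewrite (le_trans (fC x xr))// ler_norm.
Qed.

Lemma box_boundedM f g : elementary f -> box_bounded g -> box_bounded (fun x => f x * g x).
Proof.
move=> ef [mg [C gC] [s gs]]; split.
- by apply: measurable_realfun.measurable_funM => //; exact: elementary_measurable.
- have [D fD] := elementary_bounded s ef; exists (`|D| * C) => x.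
  have [xs|xs] := pselect (box s x); last first.
    by rewrite gs// mulr0 normr0 mulr_ge0// (le_trans _ (gC 0)).
  by rewrite normrM ler_pM// (le_trans (fD x xs))// ler_norm.
- by exists s => x xs; rewrite gs// mulr0.
Qed.

Lemma box_boundedD f g : box_bounded f -> box_bounded g ->
  box_bounded (fun x => f x + g x).
Proof.
move=> [mf [C fC] [r fr]] [mg [D gD] [s gs]]; split.
- exact: measurable_realfun.measurable_funD.
- by exists (C + D) => x; rewrite (le_trans (ler_normD _ _))// lerD.
- exists (Order.max r s) => x xrs; rewrite fr ?gs ?addr0//; move: xrs; apply: contra_not.
    by apply: subset_box; rewrite le_max lexx orbT.
  by apply: subset_box; rewrite le_max lexx.
Qed.

Lemma elementary_line f x i (t : R) : elementary f ->
  is_derive t 1 (fun s : R => f (s *: delta_mx 0 i + x)) (partial i f (t *: delta_mx 0 i + x)).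
Proof.
move=> ef; set e : V := delta_mx 0 i.
have E : (fun h : R => h^-1 *: (((fun s : R => f (s *: e + x)) \o shift t) (h *: 1) - f (t *: e + x)))
  = (fun h : R => h^-1 *: ((f \o shift (t *: e + x)) (h *: e) - f (t *: e + x))).
  apply/funext => h /=; rewrite -[h *: 1]/(h * 1) mulr1 scalerDl addrA; congr (_ *: (f _ - _)).
have df : derivable f (t *: e + x) e.
  by apply: diff_derivable; exact: elementary_differentiable.
by apply: DeriveDef; [rewrite /derivable E|rewrite /partial /derive E].
Qed.

Lemma norm_delta_le1 i j : `|(delta_mx 0 i : V) 0 j| <= 1.
Proof. by rewrite !mxE eqxx; case: eqP => _; rewrite /= ?normr1 ?normr0. Qed.

Lemma elementary_lip f r i : elementary f -> exists2 C : R, 0 <= C &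
  forall x (t : R), box r x -> 0 <= t <= 1 -> `|f (t *: delta_mx 0 i + x) - f x| <= C * t.
Proof.
move=> ef; have [C fC] := elementary_bounded (r + 1) (elementary_partial i ef).
exists `|C| => // x t xr /andP[t0 t1].
have dF s := elementary_line x i s ef.
have [|c cI] := MVT_segment t0 (fun s _ => dF s).
  apply: continuous_subspaceT => s; apply: differentiable_continuous.
  by apply/derivable1_diffP; case: (dF s).
rewrite scale0r add0r subr0 => ->; rewrite normrM [`|t|]ger0_norm// ler_wpM2r//.
rewrite (le_trans (fC _ _)) ?ler_norm// => j.
move: cI; rewrite in_itv/= => /andP[c0 ct].
have -> : (c *: delta_mx 0 i + x : V) 0 j = x 0 j + c * (delta_mx 0 i : V) 0 j.
  by rewrite !mxE addrC.
rewrite (le_trans (ler_normD _ _))// lerD// normrM.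
by rewrite mulr_ile1 ?norm_delta_le1// ger0_norm// (le_trans ct).
Qed.

(** Each difference quotient has integral [0] by translation invariance, and dominated convergence
    passes to the derivative. *)
Lemma integral_partial i f r : elementary f -> vanishes_off (box r) f ->
  \int[mu]_x (partial i f x) = 0.
Proof.
move=> ef fr; set e : V := delta_mx 0 i.
have [C C0 fC] := elementary_lip (`|r| + 1) i ef.
pose t (k : nat) : R := k.+1%:R^-1.
have t01 k : 0 < t k <= 1.
  by rewrite invr_gt0 ltr0n/= invf_le1 ?ltr0n// ler1n.
pose F k x := (t k)^-1 * (f (t k *: e + x) - f x).
have eF k : elementary (F k).
  apply: elementaryZ; apply: elementaryB => //.
  rewrite (_ : (fun x => _) = (fun x => f (x + t k *: e))).
    exact: elementary_shift.
  by apply/funext => x; rewrite addrC.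
(* The enlarged box contains the supports of [f] and of its translates by steps of at most [1]. *)
have F0 k x : ~ box (`|r| + 1) x -> F k x = 0.
  move=> xr; have [/= t0 t1] := andP (t01 k).
  rewrite /F (fr x); last first.
    by apply: contra_not xr; apply: subset_box; rewrite ler_wpDr// ler_norm.
  rewrite fr ?subrr ?mulr0//; apply: contra_not xr => xr j.
  have -> : x 0 j = (t k *: e + x) 0 j - t k * e 0 j by rewrite !mxE; ring.
  rewrite (le_trans (ler_normB _ _))// lerD//.
    by rewrite (le_trans (xr j))// ler_norm.
  by rewrite normrM mulr_ile1 ?norm_delta_le1// ger0_norm// ltW.
have FC k x : `|F k x| <= C * \1_(box (`|r| + 1)) x.
  have [/= t0 t1] := andP (t01 k).
  rewrite indicE; have [xr|xr] := boolP (x \in box (`|r| + 1)); last first.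
    by rewrite F0 ?normr0 ?mulr0// => xr'; move/negP : xr; apply; rewrite inE.
  rewrite mulr1 /F normrM gtr0_norm ?invr_gt0// mulrC ler_pdivrMr//.
  by apply: fC; [rewrite inE in xr|rewrite ltW].
have bf : box_bounded f by exact: elementary_box_bounded fr.
have intF k : (\int[mu]_x (F k x)%:E = 0)%E.
  have i1 := box_bounded_integrable bf; have i2 := integrable_shift (t k *: e) i1.
  rewrite /F; under eq_integral do rewrite EFinM EFinB [(t k *: e + _)%R]addrC.
  rewrite integralZl//; last exact: integrableB.
  rewrite integralB// (integral_shift (t k *: e) i1) subee ?mule0//.
  exact: integrable_fin_num.
have dF x : F ^~ x @ \oo --> partial i f x.
  have df : derivable f x e.
    by apply: diff_derivable; exact: elementary_differentiable.
  have /cvgr_dnbhsP : (fun h : R => h^-1 *: ((f \o shift x) (h *: e) - f x)) @ 0^' --> partial i f x by exact: df.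
  apply; split.
    by move=> k; have /andP[t0 _] := t01 k; rewrite gt_eqF.
  exact: cvg_harmonic.
have mF k : measurable_fun setT (EFin \o F k).
  by apply/measurable_EFinP; exact: elementary_measurable.
have mP : measurable_fun setT (EFin \o partial i f).
  by apply/measurable_EFinP; apply: elementary_measurable; exact: elementary_partial.
have ig : mu.-integrable setT (EFin \o (fun x => C * \1_(box (`|r| + 1)) x)).
  apply: box_bounded_integrable; split.
  - apply: measurable_realfun.measurable_funM => //.
    apply: measurable_indic; exact: measurable_box.
  - exists C => x; rewrite indicE; case: (_ \in _); rewrite ?mulr1 ?mulr0 ?normr0//.
    by rewrite ger0_norm.
  - exists (`|r| + 1) => x xr; rewrite indicE; case: (boolP (_ \in _)); rewrite ?mulr0//.
    by rewrite inE.
have [] := @dominated_convergence _ _ _ mu setT measurableT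
  (fun k => EFin \o F k) (EFin \o partial i f)
  (EFin \o (fun x => C * \1_(box (`|r| + 1)) x)) mF mP _ ig _.
- by apply: aeW => x _ /=; apply: cvg_EFin; [exact: nearW|exact: dF].
- by apply: aeW => x k _ /=; rewrite lee_fin; exact: FC.
move=> _ _; under eq_fun do rewrite intF.
move=> /(cvg_lim (@ereal_hausdorff R)); rewrite lim_cst// => E.
by rewrite /Rintegral -[X in fine X]E.
Qed.

End box_supported.

Section partial_rules.
Context {R : realType} {n : nat}.
Notation V := ('rV[R]_n).
Notation mu := (@lebesgue_rV R n).
Implicit Types (f g : V -> R) (x : V) (i : 'I_n).

Lemma elementary_derivable f x v : elementary f -> derivable f x v.
Proof. by move=> ef; apply: diff_derivable; exact: elementary_differentiable. Qed.

Lemma partialD i f g : elementary f -> elementary g ->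
  partial i (fun x => f x + g x) = fun x => partial i f x + partial i g x.
Proof.
by move=> ef eg; apply/funext => x; rewrite /partial deriveD//; exact: elementary_derivable.
Qed.

Lemma partialM i f g : elementary f -> elementary g ->
  partial i (fun x => f x * g x) = fun x => f x * partial i g x + g x * partial i f x.
Proof.
by move=> ef eg; apply/funext => x; rewrite /partial deriveM//; exact: elementary_derivable.
Qed.

Lemma partial_cst i (c : R) : partial i (fun _ : V => c) = fun=> 0.
Proof. by apply/funext => x; rewrite /partial derive_cst. Qed.

Lemma partial_coord i j : partial i (fun x : V => x 0 j) = fun=> (j == i)%:R.
Proof.
apply/funext => x; rewrite /partial.
have [] // := @is_derive_quadratic R V (fun x : V => x 0 j) x (delta_mx 0 i) (j == i)%:R 0 1 ltr01 _.
by move=> t _; rewrite !mxE eqxx addrK subrr normr0 mul0r.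
Qed.

Lemma partial_vanishes_off i f (K : set V) : closed K -> vanishes_off K f ->
  vanishes_off K (partial i f).
Proof.
move=> cK fK x Kx; rewrite /partial (@near_eq_derive _ _ _ _ (fun=> 0)) ?derive_cst//.
have : nbhs x (~` K) by apply: open_nbhs_nbhs; split => //; exact: closed_openC.
by apply: filterS => y; exact: fK.
Qed.

Lemma closed_box (r : R) : closed (box r : set V).
Proof.
rewrite (_ : box r = \bigcap_(i in [set: 'I_n]) (fun x : V => x 0 i) @^-1` [set y : R | `|y| <= r]); last first.
  by apply/seteqP; split=> x xr j; [move=> _|]; exact: xr.
apply: closed_bigI => j _; apply: preimage_closed.
  by move=> x _; exact: coord_continuous.
rewrite (_ : mkset _ = `[- r, r]%classic); first exact: interval_closed.
by apply/seteqP; split=> y /=; rewrite in_itv/= ler_norml.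
Qed.

Lemma integral_by_parts i f g r : elementary f -> elementary g ->
  vanishes_off (box r) g ->
  \int[mu]_x (f x * partial i g x) = - \int[mu]_x (partial i f x * g x).
Proof.
move=> ef eg gr.
have fgr : vanishes_off (box r) (fun x => f x * g x).
  by move=> x /gr ->; rewrite mulr0.
have cb := @closed_box r.
have := integral_partial i (elementaryM ef eg) fgr.
rewrite partialM// RintegralD//.
- by move=> /eqP; rewrite addr_eq0 => /eqP ->; congr (- _); apply: eq_Rintegral => x _; rewrite mulrC.
- apply: box_bounded_integrable; apply: box_boundedM => //.
  apply: (elementary_box_bounded (r := r)); first exact: elementary_partial.
  exact: partial_vanishes_off.
- apply: box_bounded_integrable; apply: (elementary_box_bounded (r := r)).
    by apply: elementaryM => //; exact: elementary_partial.
  by move=> x /gr ->; rewrite mul0r.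
Qed.

End partial_rules.

(** * Orthogonality of planar harmonics *)

Section rotation.
Context {R : realType} {m : nat}.
Notation V := ('rV[R]_m.+2).
Notation mu := (@lebesgue_rV R m.+2).
Notation "'iC" := ('i%C : R[i]).
Notation i0 := (ord0 : 'I_m.+2).
Notation i1 := (lift ord0 ord0 : 'I_m.+2).
Implicit Types (f g chi : V -> R) (x : V) (k l M p : nat).

(** [k = 0] and [k = 1] give [Re (z ^ M)] and [- Im (z ^ M)]; larger [k] repeat these up to sign.
    With this index, differentiation and rotation become shifts of [k] and [M]. *)
Definition zharm k M x : R := complex.Re ('iC ^+ k * zcoord x ^+ M).

Lemma Re_zcoordM x w : complex.Re (zcoord x * w) =
  x 0 i0 * complex.Re w + x 0 i1 * complex.Re ('iC * w).
Proof. by case: w => a b /=; ring. Qed.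

Lemma zharmS k M : zharm k M.+1 = fun x => x 0 i0 * zharm k M x + x 0 i1 * zharm k.+1 M x.
Proof.
apply/funext => x; rewrite /zharm !exprS mulrCA Re_zcoordM.
by rewrite -!mulrA.
Qed.

Lemma zharmS2 k M x : zharm k.+2 M x = - zharm k M x.
Proof. by rewrite /zharm -ReN -addn2 exprD sqr_i mulrN1 mulNr. Qed.

Lemma zharm0 k : zharm k 0 = fun=> complex.Re ('iC ^+ k).
Proof. by apply/funext => x; rewrite /zharm expr0 mulr1. Qed.

Lemma elementary_zharm k M : elementary (zharm k M).
Proof.
elim: M k => [|M IH] k; first by rewrite zharm0; exact: elementary_cst.
rewrite zharmS; apply: elementaryD; apply: elementaryM => //; exact: elementary_coord.
Qed.

Lemma partial_zharm k M i : partial i (zharm k M) = fun x =>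
  M%:R * (if zdir i is Some l then zharm (k + l) M.-1 x else 0).
Proof.
elim: M k => [|M IH] k.
  by rewrite zharm0 partial_cst; apply/funext => x; rewrite mul0r.
have ec j : elementary (fun x : V => x 0 j) by exact: elementary_coord.
rewrite zharmS partialD; [|apply: elementaryM; [exact: ec|exact: elementary_zharm]..].
rewrite !partialM ?IH//; [|exact: elementary_zharm..].
apply/funext => x; rewrite !partial_coord /=.
have [->|ni0] := eqVneq i i0.
  rewrite /zdir/= mulr1 mulr0 addr0 !addn0; case: M {IH} => [|M].
    by rewrite !mul0r !mulr0 add0r addr0 mul1r.
  by rewrite zharmS -[M.+2%:R]natr1/=; ring.
have [->|ni1] := eqVneq i i1.
  rewrite /zdir/= mulr1 mulr0 addr0 !addn1; case: M {IH} => [|M].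
    by rewrite !mul0r !mulr0 add0r add0r mul1r.
  by rewrite zharmS -[M.+2%:R]natr1/=; ring.
by rewrite /zdir (negbTE ni0) (negbTE ni1) /= !mulr0 !addr0.
Qed.

Definition rotation f x : R := x 0 i0 * partial i1 f x - x 0 i1 * partial i0 f x.

Lemma rotationM f g : elementary f -> elementary g ->
  rotation (fun x => f x * g x) = fun x => f x * rotation g x + g x * rotation f x.
Proof. by move=> ef eg; apply/funext => x; rewrite /rotation !partialM//; ring. Qed.

Lemma rotation_zharm k M : rotation (zharm k M) = fun x => M%:R * zharm k.+1 M x.
Proof.
apply/funext => x; rewrite /rotation !partial_zharm /zdir/= addn0 addn1.
case: M => [|M]; first by rewrite !mul0r !mulr0 subrr.
by rewrite zharmS zharmS2/=; ring.
Qed.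

(** The field is divergence free: the coefficient of each partial derivative does not involve the
    variable of differentiation. *)
Lemma integral_rotation f r : elementary f -> vanishes_off (box r) f ->
  \int[mu]_x (rotation f x) = 0.
Proof.
move=> ef fr; rewrite /rotation.
have bb i j : box_bounded (fun x => x 0 i * partial j f x).
  apply: box_boundedM; first exact: elementary_coord.
  apply: (elementary_box_bounded (r := r)); first exact: elementary_partial.
  apply: partial_vanishes_off => //; exact: closed_box.
rewrite RintegralB//; [|exact: box_bounded_integrable..].
have part i j : i != j -> \int[mu]_x (x 0 i * partial j f x) = 0.
  move=> ij; rewrite (integral_by_parts _ _ ef fr)//; last exact: elementary_coord.
  rewrite partial_coord (negbTE ij).
  by under eq_Rintegral do rewrite mul0r; rewrite Rintegral_cst// mul0r oppr0.
by rewrite !part// subrr.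
Qed.

Section orthogonality.
Variables (chi : V -> R) (r : R).
Hypotheses (echi : elementary chi) (chir : vanishes_off (box r) chi).
Hypothesis (rchi : forall x, rotation chi x = 0).

Definition zpair k M l p : R := \int[mu]_x (zharm k M x * (zharm l p x * chi x)).

Lemma box_bounded_zpair k M l p :
  box_bounded (fun x => zharm k M x * (zharm l p x * chi x)).
Proof.
apply: box_boundedM; first exact: elementary_zharm.
apply: box_boundedM; first exact: elementary_zharm.
exact: elementary_box_bounded chir.
Qed.

Lemma zpairC k M l p : zpair k M l p = zpair l p k M.
Proof. by apply: eq_Rintegral => x _; ring. Qed.

Lemma zpairS2l k M l p : zpair k.+2 M l p = - zpair k M l p.
Proof.
rewrite -mulN1r /zpair -RintegralZl//; last exact/box_bounded_integrable/box_bounded_zpair.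
by apply: eq_Rintegral => x _; rewrite zharmS2; ring.
Qed.

(** The rotation field applied to the whole product has integral [0]. The weight contributes nothing
    by [rchi], and on a harmonic of degree [M] the field acts as [M] times a quarter turn. *)
Lemma zpair_rotation k M l p : M%:R * zpair k.+1 M l p + p%:R * zpair k M l.+1 p = 0.
Proof.
rewrite /zpair -!RintegralZl//; [|exact/box_bounded_integrable/box_bounded_zpair..].
have e1 := elementary_zharm k M; have e2 := elementary_zharm l p.
have e3 := elementaryM e2 echi.
have := @integral_rotation (fun x => zharm k M x * (zharm l p x * chi x)) r.
rewrite (rotationM e1 e3) (rotationM e2 echi) !rotation_zharm.
have -> : (fun x => zharm k M x * (zharm l p x * rotation chi x + chi x * (p%:R * zharm l.+1 p x)) + zharm l p x * chi x * (M%:R * zharm k.+1 M x))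
  = (fun x => M%:R * (zharm k.+1 M x * (zharm l p x * chi x)) + p%:R * (zharm k M x * (zharm l.+1 p x * chi x))).
  by apply/funext => x; rewrite rchi; ring.
have i1 := elementary_cst.
rewrite RintegralD//.
- by apply; [exact: elementaryM|move=> x /chir ->; rewrite !mulr0].
- by apply/box_bounded_integrable/box_boundedM; [exact: elementary_cst|exact: box_bounded_zpair].
- by apply/box_bounded_integrable/box_boundedM; [exact: elementary_cst|exact: box_bounded_zpair].
Qed.

(** The relation is applied twice: the square of the rotation field is symmetric for the pairing,
    with eigenvalue [- M ^ 2] on degree [M], so the pairing is multiplied by [M ^ 2 - p ^ 2] to give
    [0]. *)
Lemma zpair_neq k M l p : M != p -> zpair k M l p = 0.
Proof.
move=> Mp; have h1 := zpair_rotation k.+1 M l p; have h2 := zpair_rotation k M l.+1 p.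
rewrite zpairS2l in h1.
have h3 : zpair k M l.+2 p = - zpair k M l p by rewrite zpairC zpairS2l zpairC.
rewrite h3 in h2.
have E : (M%:R ^+ 2 - p%:R ^+ 2) * zpair k M l p = 0 :> R.
  have -> : (M%:R ^+ 2 - p%:R ^+ 2) * zpair k M l p =
    - M%:R * (M%:R * - zpair k M l p + p%:R * zpair k.+1 M l.+1 p)
    + p%:R * (M%:R * zpair k.+1 M l.+1 p + p%:R * - zpair k M l p) by ring.
  by rewrite h1 h2 !mulr0 addr0.
move/eqP : E; rewrite mulf_eq0 subr_eq0 => /orP[|/eqP//].
by rewrite eqrXn2// eqr_nat (negbTE Mp).
Qed.

Lemma zpair_diag10 p : (0 < p)%N -> zpair 1 p 0 p = 0.
Proof.
move=> p0; have := zpair_rotation 0 p 0 p; rewrite -mulrDr [zpair 0 _ 1 _]zpairC.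
by move/eqP; rewrite mulf_eq0 pnatr_eq0 -leqn0 leqNgt p0/= -mulr2n mulrn_eq0/= => /eqP.
Qed.

(** [Re (z ^ p)] and [Im (z ^ p)] have the same weighted norm, and their squares add up to
    [|z| ^ (2 p)]. *)
Lemma zpair_diag p : (0 < p)%N -> zpair 0 p 0 p *+ 2 =
  \int[mu]_x ((x 0 i0 ^+ 2 + x 0 i1 ^+ 2) ^+ p * chi x).
Proof.
move=> p0; have := zpair_rotation 0 p 1 p.
rewrite [zpair 0 _ 2 _]zpairC zpairS2l -mulrDr => /eqP.
rewrite mulf_eq0 pnatr_eq0 -leqn0 leqNgt p0/= subr_eq0 => /eqP E.
rewrite mulr2n -{2}E /zpair -RintegralD//; [|exact/box_bounded_integrable/box_bounded_zpair..].
apply: eq_Rintegral => x _.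
rewrite !mulrA -mulrDl; congr (_ * _); rewrite /zharm expr0 expr1 mul1r.
have -> : x 0 i0 ^+ 2 + x 0 i1 ^+ 2 = Normc.normc (zcoord x) ^+ 2.
  by rewrite sqr_sqrtr// addr_ge0 ?sqr_ge0.
rewrite -exprM mulnC exprM -cmodX; case: (zcoord x ^+ p) => a b /=.
by rewrite sqr_sqrtr ?addr_ge0 ?sqr_ge0//; ring.
Qed.

(** Each of the [k] integrations by parts brings out the degree of the harmonic and lowers it by
    one. For [M < k] the falling factorial is [0], so the truncated [M - k] does no harm. *)
Lemma integral_zharm_iter_partial (g : V -> R) k l M : elementary g -> vanishes_off (box r) g ->
  \int[mu]_x (zharm l M x * iter_partial (nseq k i0) g x) =
  (-1) ^+ k * (M ^_ k)%:R * \int[mu]_x (zharm l (M - k) x * g x).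
Proof.
move=> eg gr; elim: k M => [|k IH] M; first by rewrite expr0 ffactn0 !mul1r subn0.
have gk : vanishes_off (box r) (iter_partial (nseq k i0) g).
  elim: k {IH} => //= k IH; apply: partial_vanishes_off => //; exact: closed_box.
have ek : elementary (iter_partial (nseq k i0) g) by exact: elementary_iter_partial.
rewrite /= (integral_by_parts _ _ ek gk)//; last exact: elementary_zharm.
rewrite partial_zharm /zdir/= addn0.
under eq_Rintegral do rewrite -mulrA.
rewrite RintegralZl//; last first.
  apply: box_bounded_integrable; apply: box_boundedM; first exact: elementary_zharm.
  exact: elementary_box_bounded gk.
rewrite IH ffactnS natrM exprS -subn1 -subnDA add1n; ring.
Qed.

End orthogonality.
End rotation.

(** * Translates of the series against the test function *)

Section binomial_sum.
Context {R : realType}.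
Notation cmod := (@Normc.normc R).

Lemma bin_le_exp2 n k : ('C(n, k) <= 2 ^ n)%N.
Proof.
elim: n k => [|n IH] [|k]; rewrite ?bin0 ?expn_gt0//.
by rewrite binS expnS mul2n -addnn leq_add.
Qed.

(** With [q = 2 ^ (j - 1)], the binomial coefficient is at most [4 ^ q] and the exponent of [w]
    exceeds [q]. The threshold [1 / 16] leaves [|w| 4 ^ - q], which is far below [|w| / j0]. *)
Lemma lacunary_bin_term_le (w : R[i]) j0 j : (0 < j0 < j)%N -> cmod w <= 16^-1 ->
  `|'C(2 ^ j, (2 ^ j0).-1)%:R * complex.Re (w ^+ (2 ^ j - (2 ^ j0).-1))|
    <= cmod w * j0%:R^-1.
Proof.
move=> /andP[j00 j0j] w16; have c0 := cmod_ge0 w.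
have w1 : cmod w <= 1 by rewrite (le_trans w16)// invf_le1// ler1n.
pose q := (2 ^ j.-1)%N.
have q2 : (2 ^ j = q.*2)%N by rewrite /q -mul2n -expnS prednK// (leq_trans _ j0j).
have j0q : (2 ^ j0 <= q)%N by rewrite leq_exp2l// -ltnS prednK// (leq_trans _ j0j).
have qe : (q.+1 <= 2 ^ j - (2 ^ j0).-1)%N.
  rewrite leq_subRL; last by rewrite q2 -addnn (leq_trans (leq_pred _))// (leq_trans j0q)// leq_addr.
  by rewrite addnS -addSn prednK ?expn_gt0// q2 -addnn leq_add2r.
rewrite normrM [`|_%:R|]ger0_norm//.
apply: (@le_trans _ _ ((2 ^ q.*2)%:R * (cmod w * cmod w ^+ q))).
  apply: ler_pM => //; first by rewrite ler_nat -q2 bin_le_exp2.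
  rewrite (le_trans (norm_Re_le _))// cmodX -exprS.
  by apply: ler_wiXn2l => //; rewrite c0.
rewrite mulrCA ler_wpM2l// natrX -mul2n exprM -exprMn.
apply: (@le_trans _ _ (2^-1 ^+ j)).
  apply: (@le_trans _ _ (4^-1 ^+ q)).
    rewrite lerXn2r ?nnegrE ?mulr_ge0 ?invr_ge0//.
    have -> : 4^-1 = 2%:R ^+ 2 * 16^-1 :> R by field.
    by rewrite ler_wpM2l.
  have -> : 4^-1 = 2^-1 ^+ 2 :> R by field.
  rewrite -exprM mul2n -q2; apply: ler_wiXn2l.
  - by rewrite invr_ge0.
  - by rewrite invf_le1// ler1n.
  - by rewrite ltnW// ltn_expl.
rewrite exprVn lef_pV2 ?posrE ?exprn_gt0 ?ltr0n//.
by rewrite -natrX ler_nat (leq_trans (ltnW j0j))// ltnW// ltn_expl.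
Qed.

(** The terms [j < j0] vanish, since [1 < j0] makes [2 ^ j < 2 ^ j0 - 1]. The term [j0] is the main
    one. Each later term has a factor [|w| / j0], and the tail of the inverse squares gives another
    [1 / j0]. *)
Lemma lacunary_bin_sum_ge (w : R[i]) j0 J : (1 < j0 <= J)%N -> cmod w <= 16^-1 ->
  (j0%:R ^+ 2)^-1 * ((2 ^ j0)%:R * complex.Re w - cmod w) <=
  \sum_(1 <= j < J.+1) (j%:R ^+ 2)^-1 *
    ('C(2 ^ j, (2 ^ j0).-1)%:R * complex.Re (w ^+ (2 ^ j - (2 ^ j0).-1))).
Proof.
move=> /andP[j01 j0J] w16; have c0 := cmod_ge0 w.
have j00 : (0 < j0)%N by rewrite ltnW.
rewrite (@big_cat_nat _ _ _ j0)//= ?leqW//.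
rewrite big_nat_cond big1 ?add0r; last first.
  move=> j /[!andbT] /andP[_ jj0]; rewrite bin_small ?mul0r ?mulr0//.
  rewrite -ltnS prednK ?expn_gt0//; case: j0 j01 jj0 {j0J j00} => // j0 j01 jj0.
  rewrite (@leq_ltn_trans (2 ^ j0).+1)//; first by rewrite ltnS leq_exp2l.
  rewrite expnS mul2n -addnn -addn1 ltn_add2l -{1}(expn0 2) ltn_exp2l//.
rewrite big_ltn//.
have -> : (2 ^ j0 - (2 ^ j0).-1 = 1)%N by rewrite -subn1 subKn ?expn_gt0.
rewrite expr1 -subn1 bin_sub ?expn_gt0// bin1 mulrBr lerD2l.
rewrite lerNl -sumrN.
apply: (@le_trans _ _ (\sum_(j0.+1 <= j < J.+1) (j%:R ^+ 2)^-1 * (cmod w * j0%:R^-1))).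
  rewrite big_nat_cond [leRHS]big_nat_cond; apply: ler_sum => j /[!andbT] /andP[j0j _].
  rewrite -mulrN ler_wpM2l ?invr_ge0 ?sqr_ge0//.
  rewrite (le_trans (ler_norm _))// normrN subn1; apply: lacunary_bin_term_le => //.
  by rewrite j00.
rewrite -mulr_suml mulrA mulrC mulrA.
rewrite expr2 invfM ler_wpM2r// ler_wpM2l ?invr_ge0//.
exact: sum_inv_sqr_le.
Qed.

End binomial_sum.

Section pairing.
Context {R : realType} {m : nat}.
Notation V := ('rV[R]_m.+2).
Notation mu := (@lebesgue_rV R m.+2).
Notation cmod := (@Normc.normc R).
Notation i0 := (ord0 : 'I_m.+2).
Implicit Types (f g : V -> R) (x h : V).

Lemma zcoordD x h : zcoord (x + h) = zcoord x + zcoord h.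
Proof. by rewrite /zcoord !mxE. Qed.

Lemma zharm_shift M x h : zharm 0 M (x + h) =
  \sum_(i < M.+1) 'C(M, i)%:R * (complex.Re (zcoord h ^+ (M - i)) * zharm 0 i x
     + complex.Im (zcoord h ^+ (M - i)) * zharm 1 i x).
Proof.
rewrite /zharm expr0 mul1r zcoordD addrC exprDn.
have Re_sum (F : 'I_M.+1 -> R[i]) : complex.Re (\sum_i F i) = \sum_i complex.Re (F i).
  by apply: (big_morph _ (@ReD R)).
rewrite Re_sum; apply: eq_bigr => i _.
rewrite -mulr_natl -(rmorph_nat (@real_complex R)) Re_real mul1r expr1; congr (_ * _).
by case: (zcoord h ^+ _) (zcoord x ^+ _) => a b [c e] /=; ring.
Qed.

Lemma box_bounded_sum (I : Type) (s : seq I) (F : I -> V -> R) :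
  (forall i, box_bounded (F i)) -> box_bounded (fun x => \sum_(i <- s) F i x).
Proof.
move=> bF; elim: s => [|a s IH].
  rewrite (_ : (fun x => _) = fun=> 0); last by apply/funext => x; rewrite big_nil.
  by apply: (elementary_box_bounded (r := 0)) => //; exact: elementary_cst.
rewrite (_ : (fun x => _) = fun x => F a x + \sum_(i <- s) F i x).
  exact: box_boundedD.
by apply/funext => x; rewrite big_cons.
Qed.

Lemma Rintegral_sum (I : Type) (s : seq I) (F : I -> V -> R) :
  (forall i, box_bounded (F i)) ->
  \int[mu]_x (\sum_(i <- s) F i x) = \sum_(i <- s) \int[mu]_x (F i x).
Proof.
move=> bF; elim: s => [|a s IH].
  rewrite big_nil; under eq_Rintegral do rewrite big_nil.
  by rewrite Rintegral_cst// mul0r.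
rewrite big_cons -IH -RintegralD//; first by apply: eq_Rintegral => x _; rewrite big_cons.
  exact: box_bounded_integrable.
exact/box_bounded_integrable/box_bounded_sum.
Qed.

Variables (chi : V -> R) (r : R) (p k : nat).
Hypotheses (echi : elementary chi) (chir : vanishes_off (box r) chi).
Hypothesis (rchi : forall x, rotation chi x = 0).
Hypothesis p0 : (0 < p)%N.

Definition wave x : R := zharm 0 p x * chi x.
Definition dwave : V -> R := iter_partial (nseq k i0) wave.
(** The only pairing of [dwave] with a [zharm l M], [l <= 1], that may differ from [0]: the one with
    [zharm 0 (p + k)]. *)
Definition wave_gain : R := (-1) ^+ k * ((p + k) ^_ k)%:R * zpair chi 0 p 0 p.

Lemma elementary_wave : elementary wave.
Proof. by apply: elementaryM => //; exact: elementary_zharm. Qed.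

Lemma wave_vanishes : vanishes_off (box r) wave.
Proof. by move=> x /chir; rewrite /wave => ->; rewrite mulr0. Qed.

Lemma elementary_dwave : elementary dwave.
Proof. by apply: elementary_iter_partial; exact: elementary_wave. Qed.

Lemma iter_partial_vanishes_off (K : set V) f s : closed K -> vanishes_off K f ->
  vanishes_off K (iter_partial s f).
Proof. by move=> cK fK; elim: s => //= i s; exact: partial_vanishes_off. Qed.

Lemma dwave_vanishes : vanishes_off (box r) dwave.
Proof. by apply: iter_partial_vanishes_off; [exact: closed_box|exact: wave_vanishes]. Qed.

Lemma box_bounded_zharm_dwave l M : box_bounded (fun x => zharm l M x * dwave x).
Proof.
apply: box_boundedM; first exact: elementary_zharm.
by apply: (elementary_box_bounded _ dwave_vanishes); exact: elementary_dwave.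
Qed.

(** Integration by parts lowers the degree to [M - k], to be compared with [p]. At equal degrees,
    [l = 1] is excluded by the orthogonality of [Re (z ^ p)] and [Im (z ^ p)]. *)
Lemma zharm_dwave l M : (l <= 1)%N -> \int[mu]_x (zharm l M x * dwave x) =
  ((l == 0%N) && (M == p + k)%N)%:R * wave_gain.
Proof.
move=> l1; rewrite (integral_zharm_iter_partial _ _ _ elementary_wave wave_vanishes).
rewrite -[X in _ * X]/(zpair chi l (M - k) 0 p).
have [->|Mpk] := eqVneq M (p + k)%N.
  rewrite andbT addnK; case: l l1 => [|[|//]] _; first by rewrite mul1r.
  by rewrite (zpair_diag10 echi chir rchi)// mulr0 mul0r.
rewrite andbF mul0r; have [Mk|kM] := ltnP M k; first by rewrite ffact_small// mulr0 mul0r.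
rewrite (zpair_neq echi chir rchi) ?mulr0//.
by apply: contra Mpk => /eqP <-; rewrite subnK.
Qed.

Lemma zharm_shift_dwave M h : \int[mu]_x (zharm 0 M (x + h) * dwave x) =
  'C(M, p + k)%:R * complex.Re (zcoord h ^+ (M - (p + k))) * wave_gain.
Proof.
under eq_Rintegral do rewrite zharm_shift mulr_suml.
pose F (i : 'I_M.+1) x : R := 'C(M, i)%:R * (complex.Re (zcoord h ^+ (M - i)) * zharm 0 i x
     + complex.Im (zcoord h ^+ (M - i)) * zharm 1 i x) * dwave x.
have FE i : F i = fun x => 'C(M, i)%:R * complex.Re (zcoord h ^+ (M - i)) * (zharm 0 i x * dwave x)
    + 'C(M, i)%:R * complex.Im (zcoord h ^+ (M - i)) * (zharm 1 i x * dwave x).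
  by apply/funext => x; rewrite /F; ring.
have bb c l i : box_bounded (fun x => c * (zharm l i x * dwave x)).
  apply: box_boundedM; first exact: elementary_cst.
  exact: box_bounded_zharm_dwave.
rewrite (@Rintegral_sum _ _ F); last by move=> i; rewrite FE; exact: box_boundedD.
have IF i : \int[mu]_x (F i x) = (i == p + k :> nat)%:R *
   ('C(M, i)%:R * complex.Re (zcoord h ^+ (M - i)) * wave_gain).
  rewrite FE RintegralD//; [|exact: box_bounded_integrable..].
  rewrite !RintegralZl//; [|exact/box_bounded_integrable/box_bounded_zharm_dwave..].
  by rewrite !zharm_dwave//=; ring.
under eq_bigr do rewrite IF.
have [pkM|Mpk] := ltnP (p + k) M.+1.
  rewrite (bigD1 (Ordinal pkM))//= eqxx mul1r big1 ?addr0// => i.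
  by move=> /negbTE ni; rewrite (_ : (i == p + k :> nat) = false) ?mul0r// -ni.
rewrite big1 ?bin_small ?mul0r// => i _.
by rewrite ltn_eqF ?mul0r// (leq_trans _ Mpk).
Qed.

End pairing.

Section box_bounded_integrals.
Context {R : realType} {n : nat}.
Notation V := ('rV[R]_n).
Notation mu := (@lebesgue_rV R n).
Implicit Types (f g : V -> R) (h : V).

Lemma Rintegral_shift f h : box_bounded f -> \int[mu]_x f (x + h) = \int[mu]_x f x.
Proof.
move=> bf; rewrite /Rintegral; congr fine.
exact: (integral_shift h (box_bounded_integrable bf)).
Qed.

Lemma box_bounded_shift f h : box_bounded f -> box_bounded (fun x => f (x + h)).
Proof.
move=> [mf [C fC] [r fr]]; split.
- exact: (measurableT_comp mf (measurable_rV_shift h)).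
- by exists C => x.
- exists (r + \sum_i `|h 0 i|) => x xr; apply: fr; apply: contra_not xr => xr i.
  have -> : x 0 i = (x + h) 0 i - h 0 i by rewrite !mxE addrK.
  rewrite (le_trans (ler_normB _ _))// lerD//.
  by rewrite (bigD1 i)//= lerDl sumr_ge0.
Qed.

Lemma box_bounded_mul (U g : V -> R) C : measurable_fun setT U ->
  (forall x, `|U x| <= C) -> box_bounded g -> box_bounded (fun x => U x * g x).
Proof.
move=> mU UC [mg [D gD] [s gs]]; split.
- exact: measurable_realfun.measurable_funM.
- by exists (C * D) => x; rewrite normrM ler_pM.
- by exists s => x xs; rewrite gs// mulr0.
Qed.

Lemma box_boundedZ c f : box_bounded f -> box_bounded (fun x => c * f x).
Proof. by move=> bf; apply: box_boundedM => //; exact: elementary_cst. Qed.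

Lemma box_boundedB f g : box_bounded f -> box_bounded g -> box_bounded (fun x => f x - g x).
Proof.
move=> bf bg; rewrite (_ : (fun x => _) = fun x => f x + -1 * g x).
  by apply: box_boundedD => //; exact: box_boundedZ.
by apply/funext => x; rewrite mulN1r.
Qed.

Lemma box_bounded_norm f : box_bounded f -> box_bounded (fun x => `|f x|).
Proof.
move=> [mf [C fC] [r fr]]; split.
- exact: measurableT_comp.
- by exists C => x; rewrite normr_id.
- by exists r => x /fr ->; rewrite normr0.
Qed.

Lemma norm_Rintegral_le f g : box_bounded f -> box_bounded g ->
  (forall x, `|f x| <= g x) -> `|\int[mu]_x f x| <= \int[mu]_x g x.
Proof.
move=> bf bg fg; have i1 := box_bounded_integrable bf.
apply: le_trans (le_normr_Rintegral _ i1) _ => //.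
apply: le_Rintegral => //; last exact: box_bounded_integrable.
exact: (box_bounded_integrable (box_bounded_norm bf)).
Qed.

End box_bounded_integrals.

Lemma le_of_forall_natV {R : realType} (a b C : R) j0 :
  (forall J, (j0 <= J)%N -> (0 < J)%N -> a - C / J%:R <= b) -> a <= b.
Proof.
move=> h; apply/ler_addgt0Pr => e e0.
pose J := (maxn j0 (Num.truncn (`|C| / e)).+1).
have J0 : (0 < J)%N by rewrite leq_max orbT.
have := h J (leq_maxl _ _) J0; rewrite lerBlDr => /le_trans; apply; rewrite lerD2l.
rewrite ler_pdivrMr ?ltr0n// (le_trans (ler_norm C))// mulrC -ler_pdivrMr//.
by rewrite (le_trans (ltW (truncnS_gt _)))// ler_nat leq_maxr.
Qed.

Section pairing_lower_bound.
Context {R : realType} {m : nat}.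
Notation V := ('rV[R]_m.+2).
Notation mu := (@lebesgue_rV R m.+2).
Notation cmod := (@Normc.normc R).
Implicit Types (f g : V -> R) (x h : V).

Lemma psum_zterm00 x J : psum (zterm 0 0 (zcoord x)) J =
  \sum_(j <- index_iota 1 J.+1) (j%:R ^+ 2)^-1 * zharm 0 (2 ^ j) x.
Proof.
by apply: eq_bigr => j _; rewrite /zterm /dcoef ffactn0 mulr1 subn0.
Qed.

Variables (chi : V -> R) (r : R) (p k j0 : nat) (h : V).
Hypotheses (echi : elementary chi) (chir : vanishes_off (box r) chi).
Hypothesis (rchi : forall x, rotation chi x = 0).
Hypotheses (p0 : (0 < p)%N) (j01 : (1 < j0)%N) (pk : (p + k = (2 ^ j0).-1)%N).
Hypothesis h16 : cmod (zcoord h) <= 16^-1.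
(** [U] will be the sum of the series on the unit ball [B], extended by [0]. Pairings with functions
    living on [B] then reduce to finite sums, up to an error of order [1 / J]. *)
Variables (U : V -> R) (B : set V) (C : R).
Hypotheses (mU : measurable_fun setT U) (UC : forall x, `|U x| <= C).
Hypothesis UB : forall x J, B x -> (0 < J)%N ->
  `|U x - psum (zterm 0 0 (zcoord x)) J| <= J%:R^-1.
Notation psi := (dwave chi p k).
Hypothesis psiB : vanishes_off B psi.
Hypothesis psihB : vanishes_off B (fun x => psi (x - h)).

Let bb_psi : box_bounded psi.
Proof. exact: (elementary_box_bounded (elementary_dwave _ _ echi) (dwave_vanishes _ _ chir)). Qed.

Let bb_zpsi l M : box_bounded (fun x => zharm l M x * psi x).
Proof. exact: (box_bounded_zharm_dwave _ _ echi chir). Qed.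

Lemma box_bounded_psum g J : box_bounded g ->
  box_bounded (fun x => psum (zterm 0 0 (zcoord x)) J * g x).
Proof.
move=> bg; apply: box_boundedM => //.
rewrite (_ : (fun x => _) = fun x => \sum_(j <- index_iota 1 J.+1) (j%:R ^+ 2)^-1 * zharm 0 (2 ^ j) x).
  by apply: elementary_sum => j _; apply: elementaryZ; exact: elementary_zharm.
by apply/funext => x; exact: psum_zterm00.
Qed.

Lemma integral_psum_dwave J : \int[mu]_x (psum (zterm 0 0 (zcoord x)) J * psi x) = 0.
Proof.
under eq_Rintegral do rewrite psum_zterm00 mulr_suml.
rewrite (@Rintegral_sum _ _ _ _ (fun j x => (j%:R ^+ 2)^-1 * zharm 0 (2 ^ j) x * psi x)); last first.
  move=> j; rewrite (_ : (fun x => _) = fun x => (j%:R ^+ 2)^-1 * (zharm 0 (2 ^ j) x * psi x)).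
    by apply: box_boundedZ; exact: bb_zpsi.
  by apply/funext => x; rewrite mulrA.
rewrite big_nat_cond big1// => j /[!andbT] /andP[j1 _].
under eq_Rintegral do rewrite -mulrA.
rewrite RintegralZl//; last by apply: box_bounded_integrable; exact: bb_zpsi.
rewrite (zharm_dwave k echi chir rchi p0)//= pk (_ : (_ == _) = false) ?mul0r ?mulr0//.
(* the degree [2 ^ j0 - 1] is odd, those of the series are even *)
apply/negP => /eqP /(congr1 odd); rewrite -subn1 oddB ?expn_gt0//.
by rewrite !oddX /= !orbF (gtn_eqF (ltnW j01)) (gtn_eqF j1).
Qed.

Lemma integral_psum_dwave_shift J :
  \int[mu]_x (psum (zterm 0 0 (zcoord x)) J * psi (x - h)) =
  (\sum_(1 <= j < J.+1) (j%:R ^+ 2)^-1 *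
    ('C(2 ^ j, (2 ^ j0).-1)%:R * complex.Re (zcoord h ^+ (2 ^ j - (2 ^ j0).-1))))
  * wave_gain chi p k.
Proof.
rewrite -(@Rintegral_shift _ _ (fun x => psum (zterm 0 0 (zcoord x)) J * psi (x - h)) h); last first.
  exact/box_bounded_psum/box_bounded_shift.
under eq_Rintegral do rewrite addrK psum_zterm00 mulr_suml.
have bb j : box_bounded (fun x => zharm 0 (2 ^ j) (x + h) * psi x).
  by apply: box_boundedM => //; apply: elementary_shift; exact: elementary_zharm.
rewrite (@Rintegral_sum _ _ _ _ (fun j x => (j%:R ^+ 2)^-1 * zharm 0 (2 ^ j) (x + h) * psi x)); last first.
  move=> j; rewrite (_ : (fun x => _) = fun x => (j%:R ^+ 2)^-1 * (zharm 0 (2 ^ j) (x + h) * psi x)).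
    exact/box_boundedZ.
  by apply/funext => x; rewrite mulrA.
rewrite mulr_suml; apply: eq_bigr => j _.
under eq_Rintegral do rewrite -mulrA.
rewrite RintegralZl//; last exact: box_bounded_integrable.
by rewrite (zharm_shift_dwave k echi chir rchi p0) pk mulrA.
Qed.

Lemma integral_approx g J : (0 < J)%N -> box_bounded g -> vanishes_off B g ->
  `|\int[mu]_x (U x * g x) - \int[mu]_x (psum (zterm 0 0 (zcoord x)) J * g x)|
    <= J%:R^-1 * \int[mu]_x `|g x|.
Proof.
move=> J0 bg gB.
have b1 := box_bounded_mul mU UC bg; have b2 := box_bounded_psum J bg.
have b3 := box_bounded_norm bg.
rewrite -RintegralB//; [|exact: box_bounded_integrable..].
rewrite -RintegralZl//; last exact: box_bounded_integrable.
apply: norm_Rintegral_le; [exact: box_boundedB|exact: box_boundedZ|move=> x].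
rewrite -mulrBl normrM; have [Bx|Bx] := pselect (B x); last by rewrite gB// normr0 !mulr0.
by rewrite ler_wpM2r// UB.
Qed.

(** For every partial sum the first pairing is [0], and the translated one is the binomial sum times
    [wave_gain]. The lower bound on that sum does not depend on [J], which may tend to infinity. *)
Lemma pairing_lower_bound :
  `|wave_gain chi p k| * ((j0%:R ^+ 2)^-1 *
     ((2 ^ j0)%:R * complex.Re (zcoord h) - cmod (zcoord h)))
  <= `|\int[mu]_x (U x * psi x) - \int[mu]_x (U x * psi (x - h))|.
Proof.
pose psih x := psi (x - h).
have bb_psih : box_bounded psih by exact: box_bounded_shift.
apply: (@le_of_forall_natV _ _ _ (\int[mu]_x `|psi x| + \int[mu]_x `|psih x|) j0) => J j0J J0.
have a1 := integral_approx J0 bb_psi psiB.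
have a2 := integral_approx J0 bb_psih psihB.
rewrite integral_psum_dwave subr0 in a1; rewrite integral_psum_dwave_shift in a2.
have := lacunary_bin_sum_ge (introT andP (conj j01 j0J)) h16.
set S := \sum_(1 <= j < J.+1) _ in a2 *; set L := _ * (_ - _).
rewrite -/psih; move: (\int[mu]_x (U x * psi x)) (\int[mu]_x (U x * psih x)) a1 a2.
move: (\int[mu]_x `|psi x|) (\int[mu]_x `|psih x|) (wave_gain _ _ _) L S => c1 c2 K L S a b a1 a2 LS.
have KS : `|K| * L <= `|S * K|.
  by rewrite normrM mulrC ler_wpM2r// (le_trans LS)// ler_norm.
rewrite lerBlDr (le_trans KS)// mulrDl ![_ / J%:R]mulrC.
have -> : S * K = - (a - b) + a - (b - S * K) by ring.
rewrite (le_trans (ler_normB _ _))// addrA lerD// (le_trans (ler_normD _ _))//.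
by rewrite normrN lerD2l.
Qed.

End pairing_lower_bound.

(** * A rotation-invariant bump near the boundary *)

Section bump.
Context {R : realType} {m : nat}.
Notation V := ('rV[R]_m.+2).
Notation mu := (@lebesgue_rV R m.+2).
Notation i0 := (ord0 : 'I_m.+2).
Notation i1 := (lift ord0 ord0 : 'I_m.+2).
Notation il i := (lift ord0 (lift ord0 i) : 'I_m.+2).
Implicit Types (x h : V) (e : R).

Definition zsqr x : R := x 0 i0 ^+ 2 + x 0 i1 ^+ 2.
Definition rest_sqr x : R := \sum_(i < m) x 0 (il i) ^+ 2.

Lemma enorm_sqr x : enorm x ^+ 2 = zsqr x + rest_sqr x.
Proof.
rewrite sqr_sqrtr; last by rewrite sumr_ge0// => i _; exact: sqr_ge0.
by rewrite big_ord_recl big_ord_recl addrA.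
Qed.

Lemma rest_sqr_ge0 x : 0 <= rest_sqr x.
Proof. by rewrite sumr_ge0// => i _; exact: sqr_ge0. Qed.

Lemma unit_ballP x : unit_ball R m.+2 x <-> zsqr x + rest_sqr x < 1.
Proof.
rewrite -enorm_sqr /unit_ball/= -[X in _ <-> is_true (_ < X)](expr1n _ 2).
by rewrite ltr_pXn2r ?nnegrE ?sqrtr_ge0.
Qed.

(* The ellipsoidal shell on which [|z|^2] is within [e] of [1 - 3 e] and the
   other coordinates are at most of size [sqrt e]. *)
Definition shell_fun e x : R :=
  1 - ((zsqr x - (1 - 3 * e)) * e^-1) ^+ 2 - rest_sqr x * e^-1.

Definition shell e : set V := [set x | 0 <= shell_fun e x].

Definition shell_bump e x : R := flat 0 (shell_fun e x).

Lemma elementary_zsqr : elementary zsqr.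
Proof. by apply: elementaryD; apply: elementaryX; exact: elementary_coord. Qed.

Lemma elementary_rest_sqr : elementary rest_sqr.
Proof. by apply: elementary_sum => i _; apply: elementaryX; exact: elementary_coord. Qed.

Lemma elementary_shell_fun e : elementary (shell_fun e).
Proof.
have ec c := @elementary_cst R m.+2 c.
apply: elementaryB; last by apply: elementaryM => //; exact: elementary_rest_sqr.
apply: elementaryB => //; apply: elementaryX; apply: elementaryM => //.
by apply: elementaryB => //; exact: elementary_zsqr.
Qed.

Lemma elementary_bump e : elementary (shell_bump e).
Proof. by apply: elementary_flat; exact: elementary_shell_fun. Qed.

Lemma rotationD (f g : V -> R) : elementary f -> elementary g ->
  rotation (fun x => f x + g x) = fun x => rotation f x + rotation g x.
Proof. by move=> ef eg; apply/funext => x; rewrite /rotation !partialD//; ring. Qed.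

Lemma rotation_coord j : rotation (fun x : V => x 0 j) =
  fun x => x 0 i0 * (j == i1)%:R - x 0 i1 * (j == i0)%:R.
Proof. by rewrite /rotation !partial_coord. Qed.

Lemma rotation_cst (c : R) : rotation (fun _ : V => c) = fun=> 0.
Proof. by apply/funext => x; rewrite /rotation !partial_cst !mulr0 subrr. Qed.

Lemma rotation_flat k (f : V -> R) : elementary f -> (forall x, rotation f x = 0) ->
  forall x, rotation (fun y => flat k (f y)) x = 0.
Proof.
move=> ef rf x; have dP i := is_derive_comp1 (delta_mx 0 i)
  (elementary_differentiable x ef) (is_derive_flat k (f x)).
rewrite /rotation /partial (@derive_val _ _ _ _ _ _ _ (dP i0)) (@derive_val _ _ _ _ _ _ _ (dP i1)).
have := rf x; rewrite /rotation /partial; set c := flat _ _ - _.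
set D0 := 'D_(delta_mx 0 i0) f x; set D1 := 'D_(delta_mx 0 i1) f x => E.
transitivity (c * (x 0 i0 * D1 - x 0 i1 * D0)); last by rewrite E mulr0.
by rewrite mulrBr !(mulrCA c).
Qed.

(** Bundling the two properties lets rotation invariance propagate through the algebraic
    construction of [shell_fun]. *)
Definition rot0 (f : V -> R) := elementary f /\ forall x, rotation f x = 0.

Lemma rot0_cst c : rot0 (fun=> c).
Proof. by split; [exact: elementary_cst|move=> x; rewrite rotation_cst]. Qed.

Lemma rot0D f g : rot0 f -> rot0 g -> rot0 (fun x => f x + g x).
Proof.
move=> [ef f0] [eg g0]; split; first exact: elementaryD.
by move=> x; rewrite rotationD// f0 g0 addr0.
Qed.

Lemma rot0M f g : rot0 f -> rot0 g -> rot0 (fun x => f x * g x).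
Proof.
move=> [ef f0] [eg g0]; split; first exact: elementaryM.
by move=> x; rewrite rotationM// f0 g0 !mulr0 addr0.
Qed.

Lemma rot0B f g : rot0 f -> rot0 g -> rot0 (fun x => f x - g x).
Proof.
move=> f0 g0; rewrite (_ : (fun x => _) = (fun x => f x + -1 * g x)).
  by apply: rot0D => //; apply: rot0M => //; exact: rot0_cst.
by apply/funext => x; rewrite mulN1r.
Qed.

Lemma rot0_zsqr : rot0 zsqr.
Proof.
split; first exact: elementary_zsqr.
have ec j := @elementary_coord R m.+2 j.
rewrite (_ : zsqr = fun x => x 0 i0 * x 0 i0 + x 0 i1 * x 0 i1); last first.
  by apply/funext => x; rewrite /zsqr !expr2.
move=> x; rewrite rotationD; [|exact: elementaryM..].
by rewrite !rotationM// !rotation_coord/=; ring.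
Qed.

Lemma rot0_rest_sqr : rot0 rest_sqr.
Proof.
rewrite (_ : rest_sqr = fun x => \sum_(i <- enum 'I_m) x 0 (il i) * x 0 (il i)); last first.
  by apply/funext => x; rewrite /rest_sqr big_enum/=; apply: eq_bigr => i _; rewrite expr2.
elim: (enum _) => [|a s IH].
  rewrite (_ : (fun x => _) = fun=> 0); first exact: rot0_cst.
  by apply/funext => x; rewrite big_nil.
rewrite (_ : (fun x => _) = fun x => x 0 (il a) * x 0 (il a) + \sum_(i <- s) x 0 (il i) * x 0 (il i)).
  apply: rot0D => //; suff r0 : rot0 (fun x => x 0 (il a)) by exact: rot0M.
  by split; [exact: elementary_coord|move=> x; rewrite rotation_coord/= !mulr0 subrr].
by apply/funext => x; rewrite big_cons.
Qed.

Lemma rotation_bump e x : rotation (shell_bump e) x = 0.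
Proof.
have r1 : rot0 (fun x => (zsqr x - (1 - 3 * e)) * e^-1).
  apply: rot0M; last exact: rot0_cst.
  by apply: rot0B; [exact: rot0_zsqr|exact: rot0_cst].
apply: rotation_flat; first exact: elementary_shell_fun.
suff [] : rot0 (shell_fun e) by [].
apply: rot0B; last by apply: rot0M; [exact: rot0_rest_sqr|exact: rot0_cst].
by apply: rot0B; [exact: rot0_cst|exact: (rot0M r1 r1)].
Qed.

Lemma bump_vanishes e : vanishes_off (shell e) (shell_bump e).
Proof.
move=> x /negP; rewrite -ltNge => x0; rewrite /shell_bump /flat ifF//.
by apply/negbTE; rewrite -leNgt ltW.
Qed.

Lemma closed_shell e : closed (shell e).
Proof.
rewrite (_ : shell e = shell_fun e @^-1` [set y | 0 <= y]); last by [].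
apply: preimage_closed; last exact: closed_ge.
move=> x _; apply: differentiable_continuous.
exact/elementary_differentiable/elementary_shell_fun.
Qed.

(** The last two bounds add up to [|x| ^ 2 <= 1 - e]: this is the room left for translations, and
    the reason for centring the shell at [1 - 3 e]. *)
Lemma shellP e x : 0 < e -> shell e x ->
  [/\ 1 - 4 * e <= zsqr x, zsqr x <= 1 - 2 * e & rest_sqr x <= e].
Proof.
move=> e0; rewrite /shell/= /shell_fun.
set a := (_ * e^-1); set b := _ * e^-1 => h.
have b0 : 0 <= b by rewrite mulr_ge0 ?rest_sqr_ge0// invr_ge0 ltW.
have a2 : a ^+ 2 <= 1 by move: h; lra.
have b1 : b <= 1 by move: h; have := sqr_ge0 a; lra.
have /ler_normlP[a1 a3] : `|a| <= 1.
  by rewrite -(@ler_pXn2r _ 2)// ?nnegrE// real_normK ?num_real// expr1n.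
have aE : zsqr x = a * e + (1 - 3 * e) by rewrite /a mulfVK ?subrK// gt_eqF.
have bE : rest_sqr x = b * e by rewrite /b mulfVK// gt_eqF.
have h1 : a * e <= e by rewrite ler_piMl// ltW.
have h2 : - e <= a * e by rewrite lerNl -mulNr ler_piMl// ltW.
have h3 : b * e <= e by rewrite ler_piMl// ltW.
split; rewrite ?aE ?bE//; lra.
Qed.

Lemma coord_sqr_le x i : x 0 i ^+ 2 <= zsqr x + rest_sqr x.
Proof.
rewrite -enorm_sqr sqr_sqrtr; last by rewrite sumr_ge0// => j _; exact: sqr_ge0.
by rewrite (bigD1 i)//= lerDl sumr_ge0// => j _; exact: sqr_ge0.
Qed.

Lemma shell_box e : 0 < e -> shell e `<=` box 1.
Proof.
move=> e0 x /(shellP e0)[_ x1 x2] i.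
rewrite -(@ler_pXn2r _ 2)// ?nnegrE// real_normK ?num_real// expr1n.
by rewrite (le_trans (coord_sqr_le x i))//; lra.
Qed.

(** Each coordinate adds at most [2 eta + eta ^ 2 <= 3 eta] to [|x| ^ 2 <= 1 - e], in total less
    than [e]. *)
Lemma shell_shift_ball e x h (eta : R) : 0 < e -> e <= 1 -> shell e x ->
  (forall i, `|h 0 i| <= eta) -> 4 * m.+2%:R * eta <= e -> unit_ball R m.+2 (x + h).
Proof.
move=> e0 e1 xe heta he; have [_ x1 x2] := shellP e0 xe.
have eta0 : 0 <= eta by apply: le_trans (heta i0).
have m0 : (1 : R) <= m.+2%:R by rewrite ler1n.
have eta1 : eta <= 1.
  have := ler_wpM2r eta0 m0; move: he; lra.
apply/unit_ballP; rewrite -enorm_sqr sqr_sqrtr; last first.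
  by rewrite sumr_ge0// => j _; exact: sqr_ge0.
apply: (@le_lt_trans _ _ (\sum_i (x 0 i ^+ 2 + 3 * eta))).
  apply: ler_sum => i _; rewrite !mxE sqrrD -addrA lerD2l.
  have xi := shell_box e0 xe i; have hi := heta i.
  have h1 : x 0 i * h 0 i <= eta.
    rewrite (le_trans (ler_norm _))// normrM -[leRHS]mul1r ler_pM//.
  have h2 : h 0 i ^+ 2 <= eta.
    rewrite -[h 0 i ^+ 2]real_normK ?num_real// expr2 -[leRHS]mul1r ler_pM//.
    exact: le_trans hi eta1.
  by rewrite mulr2n; lra.
rewrite big_split/= sumr_const card_ord -mulr_natl.
have -> : \sum_i x 0 i ^+ 2 = zsqr x + rest_sqr x.
  by rewrite big_ord_recl big_ord_recl addrA.
have := ler_wpM2r eta0 m0; move: he x1 x2; set q := m.+2%:R; nra.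
Qed.

Lemma bump_ge0 e x : 0 <= shell_bump e x. Proof. exact: flat_ge0. Qed.

Lemma bump_le1 e x : shell_bump e x <= 1. Proof. exact: flat_le_fact. Qed.

Lemma bump_ge e x : 2^-1 <= shell_fun e x -> expR (- 2) <= shell_bump e x.
Proof.
move=> s2; have s0 : 0 < shell_fun e x by rewrite (lt_le_trans _ s2)// invr_gt0.
rewrite /shell_bump /flat s0 expr0 mul1r ler_expR lerN2.
by rewrite -[leRHS]invrK lef_pV2// posrE// invr_gt0.
Qed.

End bump.

Lemma bernoulli_ge {R : realType} (a : R) n : 0 <= a <= 1 -> 1 - n%:R * a <= (1 - a) ^+ n.
Proof.
move=> /andP[a0 a1]; elim: n => [|n IH]; first by rewrite mul0r subr0.
rewrite exprS -natr1; have a1' : 0 <= 1 - a by lra.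
apply: le_trans (ler_wpM2l a1' IH).
have : 0 <= n%:R * a * a by rewrite !mulr_ge0.
by move=> h; rewrite -subr_ge0 (_ : _ - _ = n%:R * a * a)//; ring.
Qed.

Section bump_mass.
Context {R : realType} {m : nat}.
Notation V := ('rV[R]_m.+2).
Notation mu := (@lebesgue_rV R m.+2).
Notation i0 := (ord0 : 'I_m.+2).
Notation i1 := (lift ord0 ord0 : 'I_m.+2).
Implicit Types (x h : V) (e delta : R).

(** The outer half of the shell, away from its edge: there the bump is at least [exp (- 2)], and
    [|z| ^ (2 p) >= 1 - 3 p e]. *)
Definition shell_core e : set V :=
  [set x | 2^-1 <= shell_fun e x /\ 1 - 3 * e <= zsqr x].

Lemma measurable_shell_core e : measurable (shell_core e).
Proof.
have mge (f : V -> R) c : elementary f -> measurable [set x | c <= f x].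
  move=> ef; rewrite (_ : mkset _ = f @^-1` `[c, +oo[); last first.
    by apply/seteqP; split=> x /=; rewrite in_itv/= andbT.
  by rewrite -[X in measurable X]setTI; exact: elementary_measurable.
rewrite (_ : shell_core e = [set x | 2^-1 <= shell_fun e x] `&` [set x | 1 - 3 * e <= zsqr x])//.
by apply: measurableI; apply: mge; [exact: elementary_shell_fun|exact: elementary_zsqr].
Qed.

Lemma shell_core_sub e : shell_core e `<=` shell e.
Proof. by move=> x [h _]; rewrite /shell/= (le_trans _ h)// invr_ge0. Qed.

(** For a fixed first coordinate [t], [s] is where [|z| ^ 2] reaches [1 - 3 e]. A width [e / 8]
    beyond it adds at most [3 e / 8], because [2 s + w <= 3]. The two quantities subtracted in
    [shell_fun] are then at most [1 / 4] each. *)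
Lemma shell_core_section e delta t s (v : 'rV[R]_m.+1) : 0 < e -> e <= 16^-1 ->
  4 * (m%:R * delta ^+ 2) <= e -> 0 <= t <= 2^-1 ->
  s = Num.sqrt (1 - 3 * e - t ^+ 2) ->
  s <= v 0 ord0 <= s + e / 8 ->
  (forall i : 'I_m, `|v 0 (lift ord0 i)| <= delta) ->
  shell_core e (cons_rV (t, v)).
Proof.
move=> e0 e16 hdelta /andP[t0 t1] sE /andP[v1 v2] vi.
have x0E : cons_rV (t, v) 0 i0 = t by rewrite mxE unlift_none.
have x1E : cons_rV (t, v) 0 i1 = v 0 ord0 by rewrite mxE liftK.
have xiE (i : 'I_m) : cons_rV (t, v) 0 (lift ord0 (lift ord0 i)) = v 0 (lift ord0 i).
  by rewrite mxE liftK.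
have e4 : 16 * e <= 1 by rewrite -ler_pdivlMl// mulr1.
have t2 : t ^+ 2 <= 4^-1.
  have -> : 4^-1 = 2^-1 * 2^-1 :> R by field.
  by rewrite expr2 ler_pM.
have q4 : 4^-1 + 4^-1 + 4^-1 + 4^-1 = 1 :> R by field.
have s2 : s ^+ 2 = 1 - 3 * e - t ^+ 2 by rewrite sE sqr_sqrtr//; lra.
have s0 : 0 <= s by rewrite sE sqrtr_ge0.
have s1 : s <= 1.
  rewrite -(@ler_pXn2r _ 2)// ?nnegrE// expr1n s2; have := sqr_ge0 t; lra.
have zE : zsqr (cons_rV (t, v)) = t ^+ 2 + v 0 ord0 ^+ 2 by rewrite /zsqr x0E x1E.
pose w := v 0 ord0 - s.
have w0 : 0 <= w by rewrite /w; lra.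
have we : 8 * w <= e by rewrite /w; lra.
have zE2 : zsqr (cons_rV (t, v)) - (1 - 3 * e) = w * (2 * s + w).
  rewrite zE (_ : v 0 ord0 = s + w); last by rewrite /w; ring.
  by rewrite sqrrD s2; ring.
have zw0 : 0 <= w * (2 * s + w) by rewrite mulr_ge0// addr_ge0// mulr_ge0.
have zw1 : 2 * (w * (2 * s + w)) <= e.
  have : w * (2 * s + w) <= w * 3.
    by rewrite ler_wpM2l//; lra.
  lra.
have restE : 4 * rest_sqr (cons_rV (t, v)) <= e.
  apply: le_trans hdelta; rewrite ler_wpM2l//.
  apply: (@le_trans _ _ (\sum_(i < m) delta ^+ 2)).
    apply: ler_sum => i _; rewrite xiE -[v _ _ ^+ 2]real_normK ?num_real//.
    by rewrite lerXn2r ?nnegrE// (le_trans _ (vi i)).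
  by rewrite sumr_const card_ord mulr_natl.
split; last by rewrite -subr_ge0 zE2.
rewrite /shell_fun zE2; set a := _ / e; set b := _ / e.
have a1 : 0 <= a by rewrite divr_ge0// ltW.
have a2 : a <= 2^-1 by rewrite ler_pdivrMr//; lra.
have b1 : b <= 4^-1 by rewrite ler_pdivrMr//; lra.
have : a ^+ 2 <= 4^-1.
  have -> : 4^-1 = 2^-1 * 2^-1 :> R by field.
  by rewrite expr2 ler_pM.
have -> : 2^-1 = 4^-1 + 4^-1 :> R by field.
by lra.
Qed.

(** The boxes inside the core move with the first coordinate, so the measure is bounded section by
    section, for [t] in [[0, 1 / 2]]. *)
Lemma mu_shell_core_ge e delta : 0 < e -> e <= 16^-1 -> 0 <= delta ->
  4 * (m%:R * delta ^+ 2) <= e ->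
  ((2^-1 * (e / 8 * (delta *+ 2) ^+ m))%:E <= mu (shell_core e))%E.
Proof.
move=> e0 e16 d0 hd.
set c := e / 8 * (delta *+ 2) ^+ m.
have c0 : 0 <= c by rewrite mulr_ge0 ?exprn_ge0 ?mulrn_wge0// divr_ge0// ltW.
have mW : measurable (@cons_rV R m.+1 @^-1` shell_core e).
  rewrite -[X in measurable X]setTI; apply: measurable_cons_rV => //.
  exact: measurable_shell_core.
pose I := `[0, 2^-1]%classic : set (measurableTypeR R).
have mI0 : measurable I by exact: measurable_itv.
have mI : measurable_fun setT (EFin \o (\1_I : measurableTypeR R -> R)).
  by apply/measurable_EFinP; exact: measurable_indic.
rewrite -[mu _]/((lebesgue_measure \x lebesgue_rV m.+1)%E (@cons_rV R m.+1 @^-1` shell_core e)).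
rewrite /product_measure1.
apply: (@le_trans _ _ (\int[lebesgue_measure]_t (c * \1_I t)%:E)%E).
  under eq_integral do rewrite EFinM.
  rewrite ge0_integralZl//.
  rewrite integral_indic//= setIT.
  have -> : lebesgue_measure I = 2^-1%:E.
    by rewrite /I lebesgue_measure_itv/= lte_fin invr_gt0 ltr0n sube0.
  by rewrite -EFinM mulrC.
apply: ge0_le_integral => //.
- by move=> t _; rewrite lee_fin mulr_ge0.
- apply/measurable_EFinP; apply: measurable_realfun.measurable_funM => //.
- exact: measurable_fun_xsection.
move=> t _; rewrite indicE; have [tI|tI] := boolP (t \in I); last by rewrite mulr0.
have {}tI : 0 <= t <= 2^-1 by move: tI; rewrite inE /I/= in_itv.
rewrite mulr1 /=; pose s := Num.sqrt (1 - 3 * e - t ^+ 2).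
pose a (i : 'I_m.+1) := if unlift ord0 i is Some _ then - delta else s.
pose b (i : 'I_m.+1) := if unlift ord0 i is Some _ then delta else s + e / 8.
have ab i : a i <= b i.
  rewrite /a /b; case: unlift => [_|]; first by rewrite ge0_cp.
  by rewrite lerDl divr_ge0// ltW.
pose Bx : set 'rV[R]_m.+1 := [set x | forall i, x 0 i \in `[a i, b i]].
have muB : lebesgue_rV m.+1 Bx = c%:E.
  rewrite lebesgue_rV_box// big_ord_recl /a /b unlift_none.
  under eq_bigr do rewrite liftK.
  by rewrite prodr_const card_ord opprK addrAC subrr add0r -mulr2n.
have mB : measurable Bx.
  rewrite (_ : Bx = \bigcap_(i in [set: 'I_m.+1]) (fun x : 'rV[R]_m.+1 => x 0 i) @^-1` `[a i, b i]).
    apply: fin_bigcap_measurable => // i _; rewrite -[X in measurable X]setTI.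
    exact: measurable_coord.
  by apply/seteqP; split=> x /= xr i; [move=> _|]; exact: xr.
rewrite -muB; apply: le_measure.
- by rewrite inE.
- by rewrite inE; exact: measurable_xsection.
move=> v vab; rewrite /xsection/= inE /=.
apply: (@shell_core_section e delta t s) => //.
  by have := vab ord0; rewrite /a /b unlift_none in_itv.
by move=> i; have := vab (lift ord0 i); rewrite /a /b liftK in_itv/= ler_norml.
Qed.

(** [6 p e <= 1] gives [|z| ^ (2 p) >= 1 / 2] on the core. The [64] collects this [1 / 2], the
    length [1 / 2] of the range of [t], the width [e / 8], and the [2] of [zpair_diag]. *)
Lemma zpair_bump_ge e delta p : 0 < e -> e <= 16^-1 -> 0 <= delta ->
  4 * (m%:R * delta ^+ 2) <= e -> 6 * (p%:R * e) <= 1 -> (0 < p)%N ->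
  expR (- 2) * (e * (delta *+ 2) ^+ m) <= 64 * zpair (shell_bump e : V -> R) 0 p 0 p.
Proof.
move=> e0 e16 d0 hd pe p0.
have e4 : 16 * e <= 1 by rewrite -ler_pdivlMl// mulr1.
have bv : vanishes_off (box 1) (shell_bump e : V -> R).
  move=> x xb; apply: bump_vanishes; apply: contra_not xb; exact: shell_box.
have := zpair_diag (elementary_bump e) bv (rotation_bump e) p0.
set f := (fun x : V => (x 0 i0 ^+ 2 + x 0 i1 ^+ 2) ^+ p * shell_bump e x) => fE.
have ef : elementary f.
  by apply: elementaryM; [apply: elementaryX; exact: elementary_zsqr|exact: elementary_bump].
have bf : box_bounded f.
  by apply: (elementary_box_bounded (r := 1) ef) => x /bv xb; rewrite /f xb mulr0.
have mW := measurable_shell_core e.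
have bI : box_bounded (\1_(shell_core e) : V -> R).
  split.
  - exact: measurable_indic.
  - exists 1 => x; rewrite indicE; case: (_ \in _); rewrite ?normr1 ?normr0//.
  - exists 1 => x xb; rewrite indicE; case: (boolP (x \in _)) => //; rewrite inE.
    by move=> /shell_core_sub /(shell_box e0).
have lo : 2^-1 * expR (- 2) * \int[mu]_x (\1_(shell_core e) x) <= zpair (shell_bump e : V -> R) 0 p 0 p *+ 2.
  rewrite fE -RintegralZl//; last exact: box_bounded_integrable.
  apply: le_Rintegral => //; [|exact: box_bounded_integrable|].
    by apply: (@box_bounded_integrable _ _ (fun x => 2^-1 * expR (- 2) * \1_(shell_core e) x)); exact: box_boundedZ.
  move=> x _; rewrite indicE; have [xW|xW] := boolP (x \in _); last first.
    by rewrite mulr0 /f mulr_ge0 ?bump_ge0// exprn_ge0// addr_ge0// sqr_ge0.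
  move: xW; rewrite inE => -[x1 x2]; rewrite mulr1 /f.
  apply: ler_pM; [by rewrite invr_ge0|exact: expR_ge0| |exact: bump_ge].
  apply: (@le_trans _ _ ((1 - 3 * e) ^+ p)); last first.
    have z0 : 0 <= 1 - 3 * e by lra.
    by rewrite lerXn2r ?nnegrE// (le_trans z0).
  apply: (@le_trans _ _ (1 - p%:R * (3 * e))); last by apply: bernoulli_ge; lra.
  by lra.
have mul : 2^-1 * (e / 8 * (delta *+ 2) ^+ m) <= \int[mu]_x (\1_(shell_core e) x).
  rewrite -lee_fin /Rintegral fineK; last exact: (integrable_fin_num _ (box_bounded_integrable bI)).
  by rewrite integral_indic// setIT; exact: mu_shell_core_ge.
move: lo mul; set X := zpair _ _ _ _ _; set I := Rintegral _ _ _; set D := (delta *+ 2) ^+ m.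
have x0 : 0 <= 2^-1 * expR (- 2) :> R by rewrite mulr_ge0// expR_ge0.
move=> lo /(ler_wpM2l x0) /le_trans/(_ lo).
move=> h; have {}h : 2^-1 * expR (- 2) * (2^-1 * (e / 8 * D)) <= 2 * X.
  by rewrite mulr_natl.
rewrite [leLHS](_ : _ = 32 * (2^-1 * expR (- 2) * (2^-1 * (e / 8 * D)))); last by field.
by rewrite [leRHS](_ : _ = 32 * (2 * X)) ?ler_wpM2l//; ring.
Qed.

End bump_mass.

(** * Increments of the weak derivatives *)

Section test_functions.
Context {R : realType} {m : nat}.
Notation V := ('rV[R]_m.+2).
Notation mu := (@lebesgue_rV R m.+2).
Notation B := (unit_ball R m.+2).
Implicit Types (f g phi : V -> R) (x h : V).

Lemma unit_ball_box : B `<=` box 1.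
Proof.
move=> x /unit_ballP x1 i.
rewrite -(@ler_pXn2r _ 2)// ?nnegrE// real_normK ?num_real// expr1n.
by rewrite (le_trans (coord_sqr_le x i))// ltW.
Qed.

Lemma elementary_test_function f K : elementary f -> closed K -> K `<=` B ->
  vanishes_off K f -> test_function B f.
Proof.
move=> ef cK KB fK.
have sK : closure [set x | f x != 0] `<=` K.
  rewrite [X in _ `<=` X](iffLR (closure_id K) cK).
  apply: closure_subset => x /= /eqP fx; apply: contrapT => /fK.
  exact: fx.
split; [by move=> k; exact: elementary_Ck| |exact: subset_trans KB].
apply: bounded_closed_compact; last exact: closed_closure.
exists 1; split => // M M1 x /sK/KB/unit_ball_box x1.
rewrite /= [leLHS]/Num.norm/= mx_normrE; apply: bigmax_le; first by rewrite (le_trans _ (ltW M1)).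
by move=> [i j] _ /=; rewrite ord1 (le_trans (x1 j))// ltW.
Qed.

Definition first_index k : multi_index m.+2 := [ffun i => if i == ord0 then k else 0%N].

Lemma mi_order_first k : mi_order (first_index k) = k.
Proof.
rewrite /mi_order big_ord_recl ffunE eqxx big1 ?addn0// => i _.
by rewrite ffunE.
Qed.

Lemma mi_partial_first k f : mi_partial (first_index k) f = iter_partial (nseq k ord0) f.
Proof.
rewrite /mi_partial; congr (iter_partial _ f).
rewrite enum_ordSl /= ffunE eqxx -map_comp /comp.
rewrite (_ : flatten _ = [::]) ?cats0//.
by elim: (enum _) => //= i s ->; rewrite ffunE cats0.
Qed.

Lemma measurable_unit_ball : measurable B.
Proof.
rewrite (_ : B = (fun x : V => zsqr x + rest_sqr x) @^-1` `]-oo, 1[); last first.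
  by apply/seteqP; split=> x; rewrite /= in_itv/= => /unit_ballP.
rewrite -[X in measurable X]setTI; apply: elementary_measurable => //.
by apply: elementaryD; [exact: elementary_zsqr|exact: elementary_rest_sqr].
Qed.

(** Meant for extensions by zero of functions in [L2_on], which can be translated without regard to
    the domain. *)
Definition square_integrable (G : V -> R) : Prop :=
  measurable_fun setT G /\ (\int[mu]_x (G x ^+ 2)%:E < +oo)%E.

Lemma square_integrableP G : square_integrable G ->
  mu.-integrable setT (EFin \o (fun x => G x ^+ 2)).
Proof.
move=> [mG Goo]; apply/integrableP; split.
  by apply/measurable_EFinP; exact: measurable_realfun.measurable_funX.
by under eq_integral do rewrite /= ger0_norm ?sqr_ge0//.
Qed.

Lemma square_integrable_mul G phi : square_integrable G -> box_bounded phi ->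
  mu.-integrable setT (EFin \o (fun x => G x * phi x)).
Proof.
move=> Gi bp; have [mG _] := Gi; have [mp _ _] := bp.
have [_ [C pC] _] := bp.
have bp2 : box_bounded (fun x => phi x * phi x) by exact: box_bounded_mul mp pC bp.
apply: (@le_integrable _ _ _ mu setT measurableT _
    (fun x => (G x ^+ 2)%:E + (phi x * phi x)%:E)%E).
- by apply/measurable_EFinP; exact: measurable_realfun.measurable_funM.
- move=> x _ /=; rewrite lee_fin normrM [leRHS]ger0_norm; last first.
    by rewrite addr_ge0 ?sqr_ge0// -expr2 sqr_ge0.
  rewrite -[G x ^+ 2]real_normK ?num_real// -expr2 -[phi x ^+ 2]real_normK ?num_real//.
  have := sqr_ge0 (`|G x| - `|phi x|); rewrite sqrrB; have := sqr_ge0 (`|G x|).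
  have := sqr_ge0 (`|phi x|); lra.
- apply: (integrableD measurableT (square_integrableP Gi)).
  exact: (box_bounded_integrable bp2).
Qed.

Lemma square_integrable_shift G h : square_integrable G ->
  square_integrable (fun x => G (x + h)).
Proof.
move=> [mG Goo]; split; first exact: (measurableT_comp mG (measurable_rV_shift h)).
rewrite (ge0_integral_shift h (f := fun x => (G x ^+ 2)%:E))//.
  by apply/measurable_EFinP; exact: measurable_realfun.measurable_funX.
by move=> x; rewrite lee_fin sqr_ge0.
Qed.

Lemma L2_on_restrict g : L2_on B g -> square_integrable (g \_ B).
Proof.
move=> [mg goo]; split.
  by apply/(measurable_restrictT _ measurable_unit_ball).
rewrite integral_mkcond in goo; apply: le_lt_trans goo.
rewrite le_eqVlt; apply/orP; left; apply/eqP; apply: eq_integral => x _.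
by rewrite /patch; case: ifPn => // _; rewrite expr0n.
Qed.

Lemma Rintegral_restrict_mul g phi :
  (\int[mu]_(x in B) (g x * phi x)%:E = \int[mu]_x ((g \_ B) x * phi x)%:E)%E.
Proof.
rewrite integral_mkcond; apply: eq_integral => x _.
by rewrite /patch; case: ifPn => // _; rewrite mul0r.
Qed.

Lemma weak_partial_first k u g phi : square_integrable (g \_ B) ->
  weak_partial B (first_index k) u g -> test_function B phi -> box_bounded phi ->
  \int[mu]_x ((u \_ B) x * iter_partial (nseq k ord0) phi x) =
  (-1) ^+ k * \int[mu]_x ((g \_ B) x * phi x).
Proof.
move=> Gi wg tphi bphi; have := wg phi tphi.
rewrite mi_partial_first mi_order_first !Rintegral_restrict_mul => E.
rewrite /Rintegral E fineM//.
exact: (integrable_fin_num _ (square_integrable_mul Gi bphi)).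
Qed.

End test_functions.

Lemma sqr_sub_le {R : realFieldType} (a b : R) : (a - b) ^+ 2 <= 2 * a ^+ 2 + 2 * b ^+ 2.
Proof.
rewrite -subr_ge0 (_ : _ - _ = (a + b) ^+ 2) ?sqr_ge0//; ring.
Qed.

Lemma norm_mul_le_amgm {R : realFieldType} (c a z : R) : 0 < c ->
  `|a * z| <= (2 * c)^-1 * a ^+ 2 + c / 2 * z ^+ 2.
Proof.
move=> c0; rewrite normrM -[a ^+ 2]real_normK ?num_real// -[z ^+ 2]real_normK ?num_real//.
move: `|a| `|z| => {}a {}z.
rewrite -subr_ge0 (_ : _ - _ = (2 * c)^-1 * (a - c * z) ^+ 2).
  by rewrite mulr_ge0 ?sqr_ge0// invr_ge0 mulr_ge0// ltW.
by field; rewrite gt_eqF.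
Qed.

Section increment.
Context {R : realType} {m : nat}.
Notation V := ('rV[R]_m.+2).
Notation mu := (@lebesgue_rV R m.+2).
Notation B := (unit_ball R m.+2).
Notation cmod := (@Normc.normc R).
Notation u := (@zseries R m 0 0).
Implicit Types (f g phi G : V -> R) (x h : V).

Lemma Rintegral_mul_shift G phi h :
  mu.-integrable setT (EFin \o (fun x => G x * phi (x - h))) ->
  \int[mu]_x (G x * phi (x - h)) = \int[mu]_x (G (x + h) * phi x).
Proof.
move=> iG; rewrite /Rintegral -(integral_shift h iG).
by congr fine; apply: eq_integral => x _; rewrite /= addrK.
Qed.

Lemma integrable_increment G h (K : set V) : measurable K -> square_integrable G ->
  mu.-integrable setT (EFin \o (fun x => \1_K x * (G x - G (x + h)) ^+ 2)).
Proof.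
move=> mK Gi; have Ghi := square_integrable_shift h Gi.
have [mG _] := Gi; have [mGh _] := Ghi.
apply: (@le_integrable _ _ _ mu setT measurableT _
    (fun x => 2%:E * (G x ^+ 2)%:E + 2%:E * (G (x + h)%R ^+ 2)%:E)%E).
- apply/measurable_EFinP; apply: measurable_realfun.measurable_funM.
    exact: measurable_indic.
  apply: measurable_realfun.measurable_funX.
  exact: measurable_realfun.measurable_funB.
- move=> x _ /=; rewrite lee_fin ger0_norm; last by rewrite mulr_ge0 ?sqr_ge0.
  rewrite [leRHS]ger0_norm; last by rewrite addr_ge0// mulr_ge0// sqr_ge0.
  apply: le_trans (sqr_sub_le _ _).
  by rewrite ler_piMl ?sqr_ge0// indicE; case: (_ \in _).
- apply: (integrableD measurableT).
    by apply: (integrableZl measurableT); exact: square_integrableP.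
  by apply: (integrableZl measurableT); exact: (square_integrableP Ghi).
Qed.

(** Cauchy-Schwarz with the weight [c] fixed in advance: half of [c * X] is absorbed on the left,
    and no square root appears. *)
Lemma cauchy_schwarz_const (c X Y Z : R) : 0 < c ->
  c * X <= Z -> Z <= (2 * c)^-1 * Y + c / 2 * X -> c ^+ 2 * X <= Y.
Proof.
move=> c0 h1 h2.
have h3 : c * X <= (2 * c)^-1 * Y + c / 2 * X := le_trans h1 h2.
have c20 : 0 < 2 * c by rewrite mulr_gt0.
have := ler_wpM2l (ltW c20) h3; rewrite mulrDr mulVKf ?gt_eqF//.
have -> : 2 * c * (c / 2 * X) = c ^+ 2 * X by field.
have -> : 2 * c * (c * X) = c ^+ 2 * X + c ^+ 2 * X by ring.
by rewrite lerD2r.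
Qed.

(** The same [W] majorises [phi ^ 2] and measures the gain. It will be [Re (z ^ p) ^ 2 * chi] rather
    than [phi ^ 2], which has [chi ^ 2], because its integral is the diagonal pairing. *)
Lemma increment_of_pairing G phi W h (K : set V) (c : R) : 0 < c ->
  square_integrable G -> measurable K -> box_bounded phi -> vanishes_off K phi ->
  box_bounded W -> (forall x, phi x ^+ 2 <= W x) ->
  c * \int[mu]_x W x <= `|\int[mu]_x (G x * phi x) - \int[mu]_x (G (x + h) * phi x)| ->
  c ^+ 2 * \int[mu]_x W x <= \int[mu]_x (\1_K x * (G x - G (x + h)) ^+ 2).
Proof.
move=> c0 Gi mK bphi phiK bW phiW cX.
have iE := integrable_increment h mK Gi.
have iGp := square_integrable_mul Gi bphi.
have iGhp := square_integrable_mul (square_integrable_shift h Gi) bphi.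
rewrite -RintegralB// in cX.
apply: (cauchy_schwarz_const c0 cX).
have i1 : mu.-integrable setT
    (EFin \o (fun x => (2 * c)^-1 * (\1_K x * (G x - G (x + h)) ^+ 2))).
  by apply: eq_integrable (integrableZl measurableT (2 * c)^-1 iE).
have i2 : mu.-integrable setT (EFin \o (fun x => c / 2 * W x)).
  by apply: box_bounded_integrable; exact: box_boundedZ.
have i3 : mu.-integrable setT (EFin \o (fun x => G x * phi x - G (x + h) * phi x)).
  by apply: eq_integrable (integrableB measurableT iGp iGhp).
rewrite -(RintegralZl _ _ iE)// -(RintegralZl (c / 2) _ (box_bounded_integrable bW))//.
rewrite -RintegralD//.
apply: le_trans (le_normr_Rintegral _ i3) _ => //.
apply: le_Rintegral => //.
- exact: integrable_norm.
- by apply: eq_integrable (integrableD measurableT i1 i2).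
move=> x _; rewrite -mulrBl.
have W0 : 0 <= W x by exact: le_trans (sqr_ge0 _) (phiW x).
have [xe|xe] := pselect (K x); last first.
  rewrite phiK// mulr0 normr0; apply: addr_ge0; apply: mulr_ge0 => //.
  - by rewrite invr_ge0 mulr_ge0// ltW.
  - by apply: mulr_ge0; rewrite ?sqr_ge0.
  - by rewrite divr_ge0// ltW.
rewrite indicE mem_set// mul1r.
apply: le_trans (norm_mul_le_amgm _ _ c0) _.
by rewrite lerD2l ler_wpM2l// divr_ge0// ltW.
Qed.

Lemma measurable_shell e : measurable (shell e : set V).
Proof.
rewrite (_ : shell e = shell_fun e @^-1` `[0, +oo[); last first.
  by apply/seteqP; split=> x /=; rewrite in_itv/= andbT.
rewrite -[X in measurable X]setTI; apply: elementary_measurable => //.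
exact: elementary_shell_fun.
Qed.

Lemma wave_sqr_le e p x : wave (shell_bump e) p x ^+ 2 <=
  zharm 0 p x * (zharm 0 p x * shell_bump e x).
Proof.
rewrite /wave exprMn mulrA -expr2 ler_wpM2l ?sqr_ge0// expr2.
by rewrite ler_piMl ?bump_ge0// bump_le1.
Qed.

Lemma zcoord_le (h : V) (rho : R) : (forall i, rho <= h 0 i <= 2 * rho) -> 0 < rho ->
  cmod (zcoord h) <= 4 * rho.
Proof.
move=> hh r0; apply: (le_trans (cmod_le_norm _ _)).
have := hh ord0; have := hh (lift ord0 ord0) => /andP[a1 a2] /andP[b1 b2].
rewrite !ger0_norm; try lra.
Qed.

Variables (g : V -> R) (k j0 : nat).
Hypotheses (L2u : L2_on B u) (L2g : L2_on B g).
Hypothesis wg : weak_partial B (first_index k) u g.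
Hypotheses (j02 : (2 < j0)%N) (kj0 : (k < (2 ^ j0).-1)%N).
Notation G := (g \_ B).
Notation N := ((2 ^ j0)%:R : R).

(** The factor [8] gives [p e <= 1 / 8] for [p <= N], within the condition [6 p e <= 1] of
    [zpair_bump_ge]. *)
Definition shell_scale : R := (8 * N)^-1.
Notation e := shell_scale.

Lemma shell_scale_gt0 : 0 < e.
Proof. by rewrite invr_gt0 mulr_gt0// ltr0n expn_gt0. Qed.

Lemma shell_scale_le : e <= 16^-1.
Proof.
rewrite lef_pV2 ?posrE ?mulr_gt0 ?ltr0n ?expn_gt0//.
have : (2 : R) <= N by rewrite ler_nat -{1}(expn1 2) leq_exp2l// ltnW// ltnW.
lra.
Qed.

Lemma restrict_bounded x : `|(u \_ B) x| <= 2.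
Proof.
rewrite /patch; case: ifPn => [|_]; last by rewrite normr0.
rewrite inE => /unit_ball_zdisk xB; rewrite -[leRHS]mul1r.
have x1 : cmod (zcoord x) < 1 by [].
by apply: lim_psum_norm_le => //; apply: zterm00_dominated; exact: (ltW x1).
Qed.

Lemma restrict_approx x J : B x -> (0 < J)%N ->
  `|(u \_ B) x - psum (zterm 0 0 (zcoord x)) J| <= J%:R^-1.
Proof.
move=> Bx J0; rewrite /patch mem_set// -[leRHS]mul1r.
have x1 : cmod (zcoord x) < 1 by exact: unit_ball_zdisk.
by apply: lim_psum_tail => //; apply: zterm00_dominated; exact: (ltW x1).
Qed.

(** Lower bound on the pairing divided by [zpair], for steps with coordinates in [[rho, 2 rho]]. The
    last factor comes from [N Re h - |h| >= N rho - 4 rho >= N rho / 2], as [N >= 8]. *)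
Definition increment_gain (rho : R) : R :=
  ((2 ^ j0).-1 ^_ k)%:R * ((j0%:R ^+ 2)^-1 * (N * rho / 2)).

Lemma N_ge8 : (8 : R) <= N.
Proof. by rewrite (ler_nat _ 8) -[8%N]/(2 ^ 3)%N leq_exp2l. Qed.

Lemma zpair_diag_ge0 e' p : 0 <= zpair (shell_bump e' : V -> R) 0 p 0 p.
Proof.
apply: Rintegral_ge0 => x _; rewrite mulrA -expr2 mulr_ge0 ?sqr_ge0//.
exact: bump_ge0.
Qed.

Lemma wave_gain_lower h (rho : R) p e' : 0 < rho -> (forall i, rho <= h 0 i <= 2 * rho) ->
  (p + k = (2 ^ j0).-1)%N ->
  increment_gain rho * zpair (shell_bump e' : V -> R) 0 p 0 p <=
  `|wave_gain (shell_bump e' : V -> R) p k| * ((j0%:R ^+ 2)^-1 *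
     (N * complex.Re (zcoord h) - cmod (zcoord h))).
Proof.
move=> r0 hh pk; have zh := zcoord_le hh r0; have X0 := zpair_diag_ge0 e' p.
rewrite /wave_gain pk !normrM normrX normrN1 expr1n mul1r.
rewrite normr_nat (ger0_norm X0) /increment_gain mulrAC.
rewrite ler_wpM2l ?mulr_ge0// ler_wpM2l ?invr_ge0 ?sqr_ge0//.
have /andP[h1 h2] := hh ord0; rewrite -[complex.Re _]/(h 0 ord0).
have a1 : N * rho <= N * h 0 ord0 by rewrite ler_wpM2l.
have a2 : 8 * rho <= N * rho by rewrite ler_wpM2r ?N_ge8// ltW.
by move: zh a1 a2; move: (cmod _) (N * rho) (N * h 0 ord0) => x y z; lra.
Qed.

Lemma increment_gain_gt0 rho : 0 < rho -> 0 < increment_gain rho.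
Proof.
move=> r0; rewrite mulr_gt0 ?ltr0n ?ffact_gt0 ?(ltnW kj0)// mulr_gt0 ?invr_gt0 ?exprn_gt0 ?ltr0n//.
  by rewrite (ltn_trans _ j02).
by rewrite divr_gt0// mulr_gt0// (lt_le_trans _ N_ge8).
Qed.

(** The condition [8 (m + 2) rho <= e] keeps the translated shell inside the ball and [|h|] below
    [1 / 16]. *)
Lemma increment_lower h (rho : R) : 0 < rho -> 8 * m.+2%:R * rho <= e ->
  (forall i, rho <= h 0 i <= 2 * rho) ->
  increment_gain rho ^+ 2 *
    zpair (shell_bump e : V -> R) 0 ((2 ^ j0).-1 - k) 0 ((2 ^ j0).-1 - k)
  <= \int[mu]_x (\1_(shell e) x * (G x - G (x + h)) ^+ 2).
Proof.
move=> r0 hre hh; set p := ((2 ^ j0).-1 - k)%N.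
have e0 := shell_scale_gt0; have e16 := shell_scale_le.
have zh := zcoord_le hh r0.
have h16 : cmod (zcoord h) <= 16^-1.
  have m1 : (1 : R) <= m.+2%:R by rewrite ler1n.
  have : 8 * rho <= 8 * m.+2%:R * rho by rewrite -mulrA ler_wpM2l// ler_peMl// ltW.
  by move: hre; lra.
have e1 : e <= 1 by rewrite (le_trans e16)// invf_le1// ler1n.
have p0 : (0 < p)%N by rewrite subn_gt0.
have pk : (p + k = (2 ^ j0).-1)%N by rewrite subnK// ltnW.
have ech := @elementary_bump R m e.
have chir : vanishes_off (box 1) (shell_bump e : V -> R).
  by move=> x xb; apply: bump_vanishes; apply: contra_not xb; exact: shell_box.
have rch := @rotation_bump R m e.
pose phi : V -> R := wave (shell_bump e) p; pose psi := dwave (shell_bump e : V -> R) p k.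
have ephi : elementary phi by exact: elementary_wave.
have phiK : vanishes_off (shell e) phi.
  by move=> x /bump_vanishes xe; rewrite /phi /wave xe mulr0.
have phib : vanishes_off (box 1) phi.
  by move=> x /chir xe; rewrite /phi /wave xe mulr0.
have psiK : vanishes_off (shell e) psi.
  by apply: iter_partial_vanishes_off => //; exact: closed_shell.
have he i : `|h 0 i| <= 2 * rho.
  by have /andP[a1 a2] := hh i; rewrite ger0_norm//; lra.
have hre' : 4 * m.+2%:R * (2 * rho) <= e by move: hre; lra.
have shB x : shell e x -> B (x + h) by move=> xe; exact: (shell_shift_ball e0 e1 xe he hre').
have sB : shell e `<=` B.
  move=> x xe; rewrite -[x]addr0; apply: (shell_shift_ball e0 e1 xe (eta := 0)).
    by move=> i; rewrite mxE normr0.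
  by rewrite mulr0 ltW.
pose K' : set V := [set x | shell e (x - h)].
have K'B : K' `<=` B by move=> x /shB; rewrite subrK.
have cK' : closed K'.
  rewrite (_ : K' = (fun x => shell_fun e (x - h)) @^-1` [set y | 0 <= y]); last by [].
  apply: preimage_closed; last exact: closed_ge.
  move=> x _; apply: differentiable_continuous; apply: elementary_differentiable.
  exact: (elementary_shift (- h) (elementary_shell_fun e)).
have t1 : test_function B phi by exact: (elementary_test_function ephi (@closed_shell _ _ e) sB phiK).
have ephih : elementary (fun x => phi (x - h)) by exact: elementary_shift.
have t2 : test_function B (fun x => phi (x - h)).
  by apply: (elementary_test_function ephih cK' K'B) => x Kx; exact: phiK.
have Gi := L2_on_restrict L2g; have [mU _] := L2_on_restrict L2u.
have bphi : box_bounded phi by exact: elementary_box_bounded phib.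
have bphih : box_bounded (fun x => phi (x - h)) by exact: box_bounded_shift.
(* The weak derivative is tested on [phi] and on its translate. Moving the translation onto [G]
   makes the difference an increment of [G] against [phi]; the sign [(-1) ^ k] disappears in the
   absolute value. *)
have E1 := weak_partial_first Gi wg t1 bphi.
have E2 := weak_partial_first Gi wg t2 bphih.
rewrite iter_partial_shift in E2.
rewrite -[iter_partial _ _]/psi in E1; rewrite -[iter_partial _ _]/psi in E2.
have psiB : vanishes_off B psi by move=> x xB; apply: psiK; apply: contra_not xB; exact: sB.
have psihB : vanishes_off B (fun x => psi (x - h)).
  by move=> x xB; apply: psiK; apply: contra_not xB; exact: K'B.
have PL := pairing_lower_bound ech chir rch p0 (ltnW j02) pk h16 mU restrict_bounded restrict_approx psiB psihB.
have c0 := increment_gain_gt0 r0.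
have iGp := square_integrable_mul Gi bphi; have iGph := square_integrable_mul Gi bphih.
have E3 := Rintegral_mul_shift iGph.
rewrite E1 E2 E3 -mulrBr [leRHS]normrM normrX normrN1 expr1n mul1r in PL.
have bW := box_bounded_zpair ech chir 0 p 0 p.
have IP := increment_of_pairing c0 Gi (measurable_shell e) bphi phiK bW (wave_sqr_le e p).
apply: (IP h); exact: le_trans (wave_gain_lower e r0 hh pk) PL.
Qed.

End increment.

(** * Gagliardo seminorm *)

Section gagliardo_lower_bound.
Context {R : realType} {m : nat}.
Notation V := ('rV[R]_m.+2).
Notation mu := (@lebesgue_rV R m.+2).
Notation B := (unit_ball R m.+2).
Implicit Types (x h : V).

Lemma measurable_enorm n : measurable_fun setT (@enorm R n).
Proof.
apply: (@measurableT_comp _ _ _ _ _ _ (@Num.sqrt R)).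
  by apply: continuous_measurable_fun; exact: sqrt_continuous.
apply: elementary_measurable; apply: elementary_sum => i _.
by apply: elementaryX; exact: elementary_coord.
Qed.

Lemma enorm_le n (x : 'rV[R]_n) (c : R) : 0 <= c -> (forall i, `|x 0 i| <= c) -> enorm x <= n%:R * c.
Proof.
move=> c0 xc; rewrite /enorm -(@ler_pXn2r _ 2)// ?nnegrE ?sqrtr_ge0 ?mulr_ge0//.
rewrite sqr_sqrtr ?sumr_ge0// => [|i _]; last exact: sqr_ge0.
apply: (@le_trans _ _ (\sum_(i < n) c ^+ 2)).
  apply: ler_sum => i _; rewrite -[x _ _ ^+ 2]real_normK ?num_real//.
  by rewrite lerXn2r ?nnegrE.
rewrite sumr_const card_ord -[leLHS]mulr_natl exprMn ler_wpM2r ?sqr_ge0// -natrX ler_nat.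
by case: n {x xc} => // n; rewrite -mulnn leq_pmulr.
Qed.

Lemma measurable_rV_pair_sub n : measurable_fun setT
  (fun z : 'rV[R]_n * 'rV[R]_n => z.1 - z.2).
Proof.
apply/measurable_fun_rVP => i.
rewrite (_ : (fun _ => _) = (fun z : 'rV[R]_n * 'rV[R]_n => z.1 0 i) \- (fun z => z.2 0 i)).
  by apply: measurable_realfun.measurable_funB;
    [exact: (measurableT_comp (measurable_coord i) measurable_fst)|
     exact: (measurableT_comp (measurable_coord i) measurable_snd)].
by apply/funext => x; rewrite !mxE.
Qed.

Lemma measurable_rV_pair_add n : measurable_fun setT
  (fun z : 'rV[R]_n * 'rV[R]_n => (z.1, z.2 + z.1)).
Proof.
apply: measurable_fun_pair; first exact: measurable_fst.
apply/measurable_fun_rVP => i.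
rewrite (_ : (fun _ => _) = (fun z : 'rV[R]_n * 'rV[R]_n => z.2 0 i) \+ (fun z => z.1 0 i)).
  by apply: measurable_realfun.measurable_funD;
    [exact: (measurableT_comp (measurable_coord i) measurable_snd)|
     exact: (measurableT_comp (measurable_coord i) measurable_fst)].
by apply/funext => x; rewrite !mxE.
Qed.

(** Both domains become indicators, so that the substitution [y = x + h] and Tonelli apply on the
    whole space. *)
Definition gagliardo_kernel (G : V -> R) (P : R) (z : V * V) : R :=
  \1_B z.1 * \1_B z.2 * ((G z.1 - G z.2) ^+ 2 * enorm (z.1 - z.2) `^ (- P)).

Lemma gagliardo_kernel_ge0 G P z : 0 <= gagliardo_kernel G P z.
Proof. by apply: mulr_ge0; [rewrite mulr_ge0|rewrite mulr_ge0 ?sqr_ge0 ?powR_ge0]. Qed.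

Lemma measurable_gagliardo_kernel G P : measurable_fun setT G ->
  measurable_fun setT (gagliardo_kernel G P).
Proof.
move=> mG; have mB := @measurable_unit_ball R m.
have mI : measurable_fun setT (\1_B : V -> R) by exact: measurable_indic.
have m1 (f : V -> R) : measurable_fun setT f -> measurable_fun setT (fun z : V * V => f z.1).
  by move=> mf; exact: (measurableT_comp mf measurable_fst).
have m2 (f : V -> R) : measurable_fun setT f -> measurable_fun setT (fun z : V * V => f z.2).
  by move=> mf; exact: (measurableT_comp mf measurable_snd).
apply: measurable_realfun.measurable_funM.
  by apply: measurable_realfun.measurable_funM; [exact: m1|exact: m2].
apply: measurable_realfun.measurable_funM.
  apply: measurable_realfun.measurable_funX.
  by apply: measurable_realfun.measurable_funB; [exact: m1|exact: m2].
apply: (measurableT_comp (measurable_powR (- P))).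
exact: (measurableT_comp (@measurable_enorm _) (@measurable_rV_pair_sub _)).
Qed.

Lemma measurable_gagliardo_section G P x : measurable_fun setT G ->
  measurable_fun setT (fun y => gagliardo_kernel G P (x, y)).
Proof.
move=> mG; apply: (measurableT_comp (measurable_gagliardo_kernel P mG)).
by apply: measurable_fun_pair; [exact: measurable_cst|exact: measurable_id].
Qed.

Lemma integral_shift_nng x (k : V -> R) : measurable_fun setT k -> (forall y, 0 <= k y) ->
  (\int[mu]_h (k (h + x)%R)%:E = \int[mu]_y (k y)%:E)%E.
Proof.
move=> mk k0; apply: (ge0_integral_shift x (f := EFin \o k)).
  exact/measurable_EFinP.
by move=> y; rewrite lee_fin.
Qed.

Lemma gagliardoE (t : R) (g : V -> R) : (gagliardo B t g =
  \int[mu]_x \int[mu]_y (gagliardo_kernel (g \_ B) (m.+2%:R + 2 * t) (x, y))%:E)%E.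
Proof.
rewrite /gagliardo integral_mkcond; apply: eq_integral => x _.
rewrite {1}/patch; case: ifPn => xB; last first.
  rewrite integral0_eq// => y _; rewrite /gagliardo_kernel/= indicE (negbTE xB).
  by rewrite !mul0r.
rewrite integral_mkcond; apply: eq_integral => y _.
rewrite /gagliardo_kernel/= !indicE xB mul1r {1}/patch; case: ifPn => yB; last first.
  by rewrite !mul0r.
by rewrite mul1r powRN /patch xB yB.
Qed.

(** After [y = x + h] and an exchange of integrals, only the cube of steps with coordinates in
    [[rho, 2 rho]] is kept. Its volume is [rho ^ (m + 2)], and [|h| <= 2 (m + 2) rho] on it bounds
    the kernel from below. *)
Lemma gagliardo_ge (t rho l : R) (g : V -> R) (K : set V) : 0 <= t -> 0 < rho ->
  measurable K -> K `<=` B -> square_integrable (g \_ B) ->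
  (forall x h, K x -> (forall i, rho <= h 0 i <= 2 * rho) -> B (x + h)) ->
  (forall h, (forall i, rho <= h 0 i <= 2 * rho) ->
    l <= \int[mu]_x (\1_K x * ((g \_ B) x - (g \_ B) (x + h)) ^+ 2)) ->
  0 <= l ->
  ((rho ^+ m.+2 * ((m.+2%:R * (2 * rho)) `^ (- (m.+2%:R + 2 * t)) * l))%:E
     <= gagliardo B t g)%E.
Proof.
move=> t0 r0 mK KB Gi KhB hl l0; set G := g \_ B; set P := m.+2%:R + 2 * t.
have [mG _] := Gi.
have P0 : 0 <= P by rewrite addr_ge0// mulr_ge0.
pose H : set V := [set h | forall i, h 0 i \in `[rho, 2 * rho]].
have r2 : rho <= 2 * rho by lra.
have muH : mu H = (rho ^+ m.+2)%:E.
  rewrite (@lebesgue_rV_box R m.+2 (fun=> rho) (fun=> 2 * rho))//.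
  by rewrite prodr_const card_ord (_ : 2 * rho - rho = rho)//; lra.
have mH : measurable H.
  rewrite (_ : H = \bigcap_(i in [set: 'I_m.+2]) (fun x : V => x 0 i) @^-1` `[rho, 2 * rho]).
    apply: fin_bigcap_measurable => // i _; rewrite -[X in measurable X]setTI.
    exact: measurable_coord.
  by apply/seteqP; split=> x /= xr i; [move=> _|]; exact: xr.
set q := _ `^ (- P); have q0 : 0 <= q by exact: powR_ge0.
pose F (z : V * V) : \bar R := (gagliardo_kernel G P (z.1, z.2 + z.1))%:E.
have mF : measurable_fun setT F.
  apply/measurable_EFinP.
  exact: (measurableT_comp (measurable_gagliardo_kernel P mG) (@measurable_rV_pair_add _)).
have F0 z : (0 <= F z)%E by rewrite lee_fin gagliardo_kernel_ge0.
rewrite gagliardoE.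
have -> : (\int[mu]_x \int[mu]_y (gagliardo_kernel G P (x, y))%:E =
    \int[mu]_x \int[mu]_h F (x, h))%E.
  apply: eq_integral => x _; apply/esym.
  apply: (integral_shift_nng x (k := fun y => gagliardo_kernel G P (x, y))).
    exact: measurable_gagliardo_section.
  by move=> y; exact: gagliardo_kernel_ge0.
rewrite fubini_tonelli//.
apply: (@le_trans _ _ (\int[mu]_h ((q * l) * \1_H h)%:E)%E).
  have mI : measurable_fun setT (EFin \o (\1_H : V -> R)).
    by apply/measurable_EFinP; exact: measurable_indic.
  under eq_integral do rewrite EFinM.
  rewrite ge0_integralZl// ?lee_fin ?mulr_ge0//.
  by rewrite integral_indic// setIT [X in (_ * X)%E]muH -EFinM lee_fin mulrC.
apply: ge0_le_integral => //.
- by move=> h _; rewrite lee_fin !mulr_ge0.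
- apply/measurable_EFinP; apply: measurable_realfun.measurable_funM => //.
- exact: (measurable_fun_fubini_tonelli_G F).
move=> h _; rewrite indicE; have [hH|hH] := boolP (h \in H); last first.
  by rewrite mulr0; apply: integral_ge0 => x _; exact: F0.
have {}hH i : rho <= h 0 i <= 2 * rho.
  by move: hH; rewrite inE => /(_ i); rewrite in_itv.
rewrite mulr1.
have iE := integrable_increment h mK Gi.
apply: (@le_trans _ _ (\int[mu]_x (q * (\1_K x * (G x - G (x + h)) ^+ 2))%:E)%E).
  under eq_integral do rewrite EFinM.
  rewrite integralZl// EFinM lee_wpmul2l ?lee_fin//.
  have := hl h hH; rewrite -lee_fin => /le_trans; apply.
  by rewrite /Rintegral fineK//; exact: (integrable_fin_num _ iE).
have mI1 : measurable_fun setT (EFin \o (fun x => q * (\1_K x * (G x - G (x + h)) ^+ 2))).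
  apply/measurable_EFinP; apply: measurable_realfun.measurable_funM.
    exact: measurable_cst.
  by have /integrableP[/measurable_EFinP] := iE.
have mI2 : measurable_fun setT (fun x => F (x, h)).
  apply: (measurableT_comp mF).
  by apply: measurable_fun_pair; [exact: measurable_id|exact: measurable_cst].
apply: ge0_le_integral; [exact: measurableT| |exact: mI1|exact: mI2|] => x _.
  by rewrite lee_fin; apply: mulr_ge0 => //; apply: mulr_ge0; rewrite ?sqr_ge0.
rewrite lee_fin indicE.
have [xK|xK] := boolP (x \in K); last first.
  by rewrite mul0r mulr0; exact: gagliardo_kernel_ge0.
rewrite inE in xK; rewrite mul1r /gagliardo_kernel /= !indicE mem_set; last exact: KB.
rewrite [h + x]addrC mem_set; last exact: KhB.
rewrite !mul1r mulrC ler_wpM2l ?sqr_ge0//.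
rewrite opprD addrA subrr add0r.
have hle : enorm (- h) <= m.+2%:R * (2 * rho).
  apply: enorm_le => [|i]; first by rewrite mulr_ge0// ltW.
  by rewrite mxE normrN; have /andP[h1 h2] := hH i; rewrite ger0_norm//; lra.
have hgt : 0 < enorm (- h).
  rewrite sqrtr_gt0 (bigD1 ord0)//= ltr_wpDr//.
    by rewrite sumr_ge0// => i _; exact: sqr_ge0.
  by rewrite mxE sqrrN exprn_gt0//; have /andP[h1 h2] := hH ord0; lra.
rewrite /q !powRN lef_pV2 ?posrE ?powR_gt0//; last first.
  by rewrite mulr_gt0// mulr_gt0.
by apply: ge0_ler_powR; rewrite ?nnegrE// ltW// (lt_le_trans hgt).
Qed.

End gagliardo_lower_bound.

(** * Growth of the lower bound with the dyadic scale *)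

Section growth.
Context {R : realType}.

(** Every factor of the falling factorial is at least [n - k], which exceeds [n / 2]. *)
Lemma ffact_ge_half (n k : nat) : (k.*2 < n)%N -> (n%:R / 2) ^+ k <= (n.-1 ^_ k)%:R :> R.
Proof.
move=> kn; suff h j : (j <= k)%N -> (n%:R / 2) ^+ j <= (n.-1 ^_ j)%:R :> R by exact: h.
elim: j => [|j IH] jk; first by rewrite expr0 ffactn0.
rewrite ffactnSr natrM exprSr; apply: ler_pM; [|by rewrite divr_ge0|exact/IH/ltnW|].
  by rewrite exprn_ge0// divr_ge0.
rewrite ler_pdivrMr// -natrM ler_nat; move: kn jk; rewrite -muln2; lia.
Qed.

Lemma le_of_pmul (c x y : R) : 0 < c -> x <= c * y -> c^-1 * x <= y.
Proof. by move=> c0; rewrite ler_pdivrMl. Qed.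

(** [M ^ 5 * 2 ^ (- beta M)] is bounded: one power more than the [M ^ 4] to be beaten. *)
Lemma exp_beats_poly (c A beta : R) (M0 : nat) : 0 < c -> 0 < beta ->
  (forall M, (M0 <= M)%N -> c * (2 `^ beta) ^+ M <= A * M%:R ^+ 4) -> False.
Proof.
move=> c0 b0 h; pose y : R := (2 `^ beta)^-1.
have p1 : 1 < 2 `^ beta :> R.
  rewrite -[ltLHS](powRr0 2) -[X in X < _]/(2 `^ 0).
  by rewrite /powR pnatr_eq0/= ltr_expR ltr_pM2r// ln_gt0// ltr1n.
have y01 : 0 < y < 1.
  by rewrite invr_gt0 (lt_trans ltr01)//= invf_lt1 ?(lt_trans ltr01).
have [D D0 hD] := natX_geom_bounded 5 y01.
pose M := maxn M0 (Num.truncn (`|A| * D / c)).+1.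
have MM0 : (M0 <= M)%N by exact: leq_maxl.
have Mp : 0 < M%:R :> R by rewrite ltr0n leq_max orbT.
have hM : `|A| * D / c < M%:R.
  by apply: lt_le_trans (truncnS_gt _) _; rewrite ler_nat leq_maxr.
have := h M MM0; have := hD M.
have yM : y ^+ M * (2 `^ beta) ^+ M = 1.
  by rewrite -exprMn mulVf ?expr1n// gt_eqF// (lt_trans ltr01).
have yM0 : 0 <= y ^+ M by rewrite exprn_ge0// ltW//; case/andP : y01.
move=> h1 /(ler_wpM2r yM0); rewrite -mulrA [_ ^+ M * _]mulrC yM mulr1 => h2.
have : c * M%:R <= `|A| * D.
  apply: (@le_trans _ _ (A * M%:R ^+ 4 * y ^+ M * M%:R)).
    by rewrite ler_wpM2r// ltW.
  have -> : A * M%:R ^+ 4 * y ^+ M * M%:R = A * (M%:R ^+ 5 * y ^+ M) by ring.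
  apply: (@le_trans _ _ (`|A| * (M%:R ^+ 5 * y ^+ M))).
    by rewrite ler_wpM2r ?ler_norm// mulr_ge0// exprn_ge0// ltW.
  by rewrite ler_wpM2l.
by rewrite leNgt [c * _]mulrC -ltr_pdivrMr// hM.
Qed.

End growth.

Section sobolev.
Context {R : realType} {m : nat}.
Notation V := ('rV[R]_m.+2).
Notation mu := (@lebesgue_rV R m.+2).
Notation B := (unit_ball R m.+2).
Notation u := (@zseries R m 0 0).

(* The dyadic index [2 * M] is even so that the width of the shell in the last
   coordinates, the square root of [shell_scale], is of order [2 ^ - M]. *)
Definition increment_step (M : nat) : R := shell_scale (2 * M) / (8 * m.+2%:R).

(** The left-hand side of [increment_lower] at [N = 4 ^ M], with the largest step allowed there. *)
Definition increment_bound (k M : nat) : R :=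
  increment_gain k (2 * M) (increment_step M) ^+ 2 *
  zpair (shell_bump (shell_scale (2 * M)) : V -> R)
    0 ((2 ^ (2 * M)).-1 - k) 0 ((2 ^ (2 * M)).-1 - k).

Lemma increment_stepE M : increment_step M = (64 * m.+2%:R * (2 ^ (2 * M))%:R)^-1.
Proof.
rewrite /increment_step /shell_scale.
have : (2 ^ (2 * M))%:R != 0 :> R by rewrite pnatr_eq0 -lt0n expn_gt0.
move: ((2 ^ (2 * M))%:R : R) => N N0.
by field; rewrite N0/=.
Qed.

(** With [r = 2 ^ M] and [N = r ^ 2], the product of [N] and the step is constant, so the gain is at
    least of order [r ^ (2 k) / M ^ 2]. The diagonal pairing is at least of order [r ^ - 2], from
    the thickness of the shell, times [r ^ - m], from its widths. *)
Lemma increment_bound_ge k : exists2 C : R, 0 < C & forall M, (k + 2 <= M)%N ->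
  C * ((2 ^+ M) ^+ (4 * k) / (2 ^+ M) ^+ m.+2) <= increment_bound k M * M%:R ^+ 4.
Proof.
(* [128 (m + 2)] is the inverse of [N * increment_step / 2], and the [4] comes from
   [j0 ^ 2 = (2 M) ^ 2]. *)
pose a : R := (4 * (128 * m.+2%:R))^-1; pose b : R := 3 * m.+1%:R.
have a0 : 0 < a by rewrite invr_gt0 mulr_gt0// mulr_gt0.
have b0 : 0 < b by rewrite mulr_gt0.
exists ((2^-1 ^+ k * a) ^+ 2 * (expR (- 2) / (64 * 8 * b ^+ m))).
  apply: mulr_gt0; first by rewrite exprn_gt0// mulr_gt0// exprn_gt0// invr_gt0.
  by rewrite divr_gt0 ?expR_gt0// mulr_gt0// exprn_gt0.
move=> M kM.
pose r : R := 2 ^+ M; have r0 : 0 < r by rewrite exprn_gt0.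
have NE : (2 ^ (2 * M))%:R = r ^+ 2 :> R by rewrite /r natrX mulnC exprM.
have N2 : (2 * M < 2 ^ (2 * M))%N by exact: ltn_expl.
have kN : (k.*2 < 2 ^ (2 * M))%N.
  by apply: leq_ltn_trans N2; rewrite -muln2; lia.
have j02 : (2 < 2 * M)%N by lia.
have p0 : (0 < (2 ^ (2 * M)).-1 - k)%N.
  by move: N2; move: (2 ^ (2 * M))%N kM => N kM N2; lia.
have M0 : 0 < M%:R :> R by rewrite ltr0n; lia.
have gain_ge : 2^-1 ^+ k * a * (r ^+ 2) ^+ k * (M%:R ^+ 2)^-1 <= increment_gain k (2 * M) (increment_step M).
  have F := @ffact_ge_half R _ _ kN; rewrite NE exprMn in F.
  rewrite /increment_gain increment_stepE NE.
  set L := (r ^+ 2 * _ / 2); have -> : L = (128 * m.+2%:R)^-1.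
    by rewrite /L; field; rewrite gt_eqF// expf_neq0// gt_eqF.
  rewrite [leLHS](_ : _ = (r ^+ 2) ^+ k * 2^-1 ^+ k * (a * (M%:R ^+ 2)^-1)); last by ring.
  apply: ler_pM => //.
  - by rewrite mulr_ge0 ?exprn_ge0// ltW.
  - by rewrite mulr_ge0 ?invr_ge0 ?exprn_ge0 ?(ltW a0)// ltW.
  rewrite natrM exprMn /a !invfM le_eqVlt; apply/orP; left; apply/eqP.
  by field; rewrite -natrD pnatr_eq0/= gt_eqF.
have m1 : 1 + m%:R != 0 :> R by rewrite gt_eqF// ltr_wpDr.
have rn0 : r != 0 by rewrite gt_eqF.
have bn0 : b != 0 by rewrite gt_eqF.
(* Half-width in the last [m] coordinates: [4 m delta ^ 2 = m / (9 (m + 1) ^ 2 r ^ 2)] is below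
   [e = 1 / (8 r ^ 2)]. Using [m + 1] instead of [m] covers [m = 0]. *)
pose delta : R := (2 * b * r)^-1.
have d0 : 0 <= delta by rewrite invr_ge0 ltW// mulr_gt0// mulr_gt0.
have eE : shell_scale (2 * M) = (8 * r ^+ 2)^-1 :> R by rewrite /shell_scale NE.
have e0 := @shell_scale_gt0 R (2 * M).
have e16 := @shell_scale_le R (2 * M) j02.
have hd : 4 * (m%:R * delta ^+ 2) <= shell_scale (2 * M).
  rewrite eE /delta /b.
  have -> : 4 * (m%:R * (2 * (3 * m.+1%:R) * r)^-1 ^+ 2)
      = (r ^+ 2)^-1 * (m%:R / (9 * m.+1%:R ^+ 2)) :> R.
    by field; rewrite ?m1 ?rn0.
  rewrite [leRHS]invfM [leRHS]mulrC; apply: ler_wpM2l.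
    by rewrite invr_ge0 exprn_ge0// ltW.
  rewrite ler_pdivrMr ?mulr_gt0 ?exprn_gt0//.
  have m0' : (0 : R) <= m%:R by [].
  rewrite -[m.+1%:R]natr1; move: (m%:R : R) m0' => q q0.
  by have := sqr_ge0 q; rewrite sqrrD expr1n mulr1 -[q *+ 2]mulr_natl; lra.
set p := ((2 ^ (2 * M)).-1 - k)%N in p0 *.
have pe : 6 * (p%:R * shell_scale (2 * M)) <= 1 :> R.
  have pN : p%:R <= r ^+ 2 by rewrite -NE ler_nat (leq_trans (leq_subr _ _))// leq_pred.
  have : p%:R * (8 * r ^+ 2)^-1 <= 8^-1 :> R.
    by rewrite ler_pdivrMr ?mulr_gt0 ?exprn_gt0// mulrA mulVf ?mul1r.
  by rewrite eE; lra.
have X_ge := @zpair_bump_ge R m _ _ _ e0 e16 d0 hd pe p0.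
have dE : delta *+ 2 = (b * r)^-1.
  rewrite -mulr_natl /delta; field.
  by rewrite ?bn0 ?rn0.
rewrite /increment_bound -/p; move: (zpair _ _ _ _ _) X_ge => X X_ge.
rewrite dE eE in X_ge.
move: (increment_gain _ _ _) gain_ge => g gain_ge.
have {}X_ge : expR (- 2) / (64 * 8 * b ^+ m) / r ^+ m.+2 <= X.
  have s64 : (0 : R) < 64 by [].
  apply: le_trans (le_of_pmul s64 X_ge).
  have br : b ^+ m != 0 by rewrite expf_neq0.
  have rr : r ^+ m != 0 by rewrite expf_neq0.
  have -> : (b * r)^-1 ^+ m = (b ^+ m)^-1 * (r ^+ m)^-1.
    by rewrite exprVn [(b * r) ^+ m]exprMn invfM.
  have -> : r ^+ m.+2 = r ^+ 2 * r ^+ m by rewrite -exprD.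
  move: (r ^+ m) (b ^+ m) (expR _) br rr => x1 x2 x3 x10 x20.
  by rewrite le_eqVlt; apply/orP; left; apply/eqP; field; rewrite ?x10 ?x20 ?rn0.
have X0 : 0 <= expR (- 2) / (64 * 8 * b ^+ m) / r ^+ m.+2.
  by rewrite !mulr_ge0 ?invr_ge0 ?expR_ge0 ?exprn_ge0 ?mulr_ge0 ?exprn_ge0 ?(ltW b0) ?(ltW r0).
have g0 : 0 <= 2^-1 ^+ k * a * (r ^+ 2) ^+ k * (M%:R ^+ 2)^-1.
  by rewrite !mulr_ge0 ?invr_ge0 ?exprn_ge0 ?(ltW a0) ?(ltW r0)// invr_ge0.
have g2 : (2^-1 ^+ k * a * (r ^+ 2) ^+ k * (M%:R ^+ 2)^-1) ^+ 2 <= g ^+ 2.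
  by rewrite lerXn2r ?nnegrE// (le_trans g0).
have h1 := ler_pM (sqr_ge0 _) X0 g2 X_ge.
have h2 := ler_wpM2r (exprn_ge0 4 (ltW M0)) h1.
apply: (le_trans _ h2).
rewrite le_eqVlt; apply/orP; left; apply/eqP; rewrite -/r.
have k4 : (4 * k = 2 * k * 2)%N by rewrite -mulnA mulnCA mulnC.
have -> : r ^+ (4 * k) = ((r ^+ 2) ^+ k) ^+ 2 by rewrite k4 !exprM.
move: ((r ^+ 2) ^+ k) (2^-1 ^+ k) (expR _ / _) => x1 x2 x3.
by field; rewrite !gt_eqF// exprn_gt0.
Qed.

End sobolev.

Lemma ltn_double2 M : (1 < M)%N -> (2 < 2 * M)%N.
Proof. lia. Qed.

Section not_sobolev.
Context {R : realType} {m : nat}.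
Notation V := ('rV[R]_m.+2).
Notation mu := (@lebesgue_rV R m.+2).
Notation B := (unit_ball R m.+2).
Notation u := (@zseries R m 0 0).

Lemma powR2_exp (b : R) M : (2 `^ b) ^+ M = (2 ^+ M) `^ b.
Proof.
by rewrite -powR_mulrn ?powR_ge0// -powRrM mulrC powRrM powR_mulrn.
Qed.

(** Takes the place of the seminorm when the order [s] is an integer. *)
Lemma integral_increment_le G h (K : set V) : measurable K -> square_integrable G ->
  \int[mu]_x (\1_K x * (G x - G (x + h)) ^+ 2) <= 4 * \int[mu]_x (G x ^+ 2).
Proof.
move=> mK Gi; have iE := integrable_increment h mK Gi.
have i1 := square_integrableP Gi.
have i2 := square_integrableP (square_integrable_shift h Gi).
have E : \int[mu]_x (G (x + h) ^+ 2) = \int[mu]_x (G x ^+ 2).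
  by rewrite /Rintegral; congr fine; exact: (integral_shift h i1).
have j1 : mu.-integrable setT (EFin \o (fun x => 2 * G x ^+ 2)).
  by apply: eq_integrable (integrableZl measurableT 2 i1).
have j2 : mu.-integrable setT (EFin \o (fun x => 2 * G (x + h) ^+ 2)).
  by apply: eq_integrable (integrableZl measurableT 2 i2).
have -> : 4 * \int[mu]_x (G x ^+ 2) =
    \int[mu]_x (2 * G x ^+ 2 + 2 * G (x + h) ^+ 2).
  by rewrite RintegralD// !RintegralZl// E; ring.
apply: le_Rintegral => //; first by apply: eq_integrable (integrableD measurableT j1 j2).
move=> x _; apply: le_trans (sqr_sub_le _ _).
by rewrite ler_piMl ?sqr_ge0// indicE; case: (_ \in _).
Qed.

Lemma increment_step_gt0 M : 0 < @increment_step R m M.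
Proof. by rewrite divr_gt0 ?shell_scale_gt0// mulr_gt0. Qed.

Lemma increment_stepK M : 8 * m.+2%:R * @increment_step R m M = shell_scale (2 * M).
Proof. by rewrite mulrC divfK// mulf_neq0// pnatr_eq0. Qed.

Lemma shell_step_ball M x (h : V) : (1 < M)%N -> shell (shell_scale (2 * M)) x ->
  (forall i, increment_step (m := m) M <= h 0 i <= 2 * increment_step (m := m) M) ->
  B (x + h).
Proof.
move=> M1 xe hh; have r0 := increment_step_gt0 M.
have j02 : (2 < 2 * M)%N by exact: ltn_double2.
have e16 := @shell_scale_le R (2 * M) j02.
apply: (shell_shift_ball (shell_scale_gt0 _) _ xe (eta := 2 * increment_step (m := m) M)).
- by rewrite (le_trans e16)// invf_le1// ler1n.
- by move=> i; have /andP[h1 h2] := hh i; rewrite ger0_norm// (le_trans (ltW r0)).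
- by rewrite -increment_stepK le_eqVlt; apply/orP; left; apply/eqP; ring.
Qed.

Lemma shell_ball M : (1 < M)%N -> shell (shell_scale (2 * M)) `<=` B.
Proof.
move=> M1 x xe; have j02 : (2 < 2 * M)%N by exact: ltn_double2.
have e16 := @shell_scale_le R (2 * M) j02; have e0 := @shell_scale_gt0 R (2 * M).
rewrite -[x]addr0; apply: (shell_shift_ball e0 _ xe (eta := 0)).
- by rewrite (le_trans e16)// invf_le1// ler1n.
- by move=> i; rewrite mxE normr0.
- by rewrite mulr0 ltW.
Qed.

Lemma increment_bound_le (g : V -> R) k M (h : V) : L2_on B u -> L2_on B g ->
  weak_partial B (first_index k) u g -> (k + 2 <= M)%N ->
  (forall i, increment_step (m := m) M <= h 0 i <= 2 * increment_step (m := m) M) ->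
  increment_bound (m := m) k M <=
    \int[mu]_x (\1_(shell (shell_scale (2 * M))) x * ((g \_ B) x - (g \_ B) (x + h)) ^+ 2).
Proof.
move=> L2u L2g wg kM hh.
have j02 : (2 < 2 * M)%N by apply: ltn_double2; apply: leq_trans kM; rewrite addn2.
have kN : (k < (2 ^ (2 * M)).-1)%N.
  have : (2 * M < 2 ^ (2 * M))%N by exact: ltn_expl.
  by move: (2 ^ (2 * M))%N => N; lia.
apply: increment_lower => //; first exact: increment_step_gt0.
by rewrite increment_stepK.
Qed.

(** The powers of the step cancel up to the exponent [- 2 t], and the inverse of the step is at
    least [4 ^ M]. *)
Lemma step_powR_ge (t : R) M : 0 <= t ->
  (m.+2%:R * 2) `^ (- (m.+2%:R + 2 * t)) * (2 ^+ M) `^ (4 * t) <=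
  @increment_step R m M ^+ m.+2 *
    (m.+2%:R * (2 * @increment_step R m M)) `^ (- (m.+2%:R + 2 * t)).
Proof.
move=> t0; have r0 := increment_step_gt0 M.
rewrite [m.+2%:R * (2 * _)]mulrA [in leRHS]powRM ?(ltW r0) ?mulr_ge0// [leRHS]mulrCA ler_wpM2l ?powR_ge0//.
rewrite -[increment_step M ^+ _]powR_mulrn ?(ltW r0)// -powRD; last by rewrite (gt_eqF r0) implybT.
rewrite opprD addrA subrr add0r -[- (2 * t)]mulN1r [_ `^ (-1 * _)]powRrM powR_inv1 ?(ltW r0)//.
have -> : 4 * t = 2%:R * (2 * t) by ring.
rewrite powRrM powR_mulrn ?exprn_ge0//.
apply: ge0_ler_powR; rewrite ?nnegrE ?mulr_ge0 ?exprn_ge0 ?invr_ge0 ?(ltW r0)//.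
rewrite increment_stepE invrK natrX mulnC exprM ler_peMl ?exprn_ge0//.
by rewrite -natrM ler1n.
Qed.

Lemma zseries_not_in_Hs (s : R) : m.+2%:R / 4 < s -> ~ in_Hs s B u.
Proof.
move=> hs [L2u [D [HD HG]]].
have s0 : 0 <= s by rewrite (le_trans _ (ltW hs))// divr_ge0.
set k := Num.truncn s in HD HG; set t := s - k%:R in HG.
have t0 : 0 <= t by rewrite subr_ge0 truncn_le.
have sE : s = k%:R + t by rewrite addrC subrK.
have [L2g wg] := HD (first_index k) (eq_leq (mi_order_first k)).
set g := D (first_index k) in L2g wg.
have Gi := L2_on_restrict L2g.
have [C C0 hC] := @increment_bound_ge R m k.
pose beta := 4 * s - m.+2%:R.
have beta0 : 0 < beta.
  by move: hs; rewrite ltr_pdivrMr// /beta => hs; rewrite subr_gt0 mulrC.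
(* Both cases of [t] yield an upper bound of this form. Combined with [hC], it produces the exponent
   [4 t + 4 k - n = beta]. *)
suff [c [A [c0 cA]]] : exists c A : R, 0 < c /\ forall M, (k + 2 <= M)%N ->
    c * (2 ^+ M) `^ (4 * t) * @increment_bound R m k M <= A.
  have cC0 : 0 < c * C by rewrite mulr_gt0.
  apply: (exp_beats_poly (M0 := k + 2) (A := A) cC0 beta0) => M kM.
  have r0 : 0 < 2 ^+ M :> R by rewrite exprn_gt0.
  apply: (@le_trans _ _ (c * (2 ^+ M) `^ (4 * t) * @increment_bound R m k M * M%:R ^+ 4)).
    have -> : (2 `^ beta) ^+ M = (2 ^+ M) `^ (4 * t) * ((2 ^+ M) ^+ (4 * k) / (2 ^+ M) ^+ m.+2) :> R.
      rewrite powR2_exp -[(2 ^+ M) ^+ (4 * k)]powR_mulrn ?(ltW r0)//.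
      rewrite -[(2 ^+ M) ^+ m.+2]powR_mulrn ?(ltW r0)// -powRN.
      rewrite -!powRD ?(gt_eqF r0) ?implybT//; congr (_ `^ _).
      by rewrite /beta sE natrM; ring.
    rewrite mulrACA -[leRHS]mulrA; apply: ler_wpM2l; last exact: hC.
    by apply: mulr_ge0; [exact: ltW|exact: powR_ge0].
  by apply: ler_wpM2r; [exact: exprn_ge0|exact: cA].
move: t0; rewrite le_eqVlt => /predU1P[t0|t0].
  (* For [t = 0] a single admissible step suffices, and a constant vector is one. *)
  exists 1, (4 * \int[mu]_x ((g \_ B) x ^+ 2)); split => // M kM.
  rewrite -t0 mulr0 powRr0 !mul1r.
  pose h : V := const_mx (@increment_step R m M).
  apply: le_trans (integral_increment_le h (@measurable_shell _ _ (shell_scale (2 * M))) Gi).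
  apply: increment_bound_le => // i; rewrite mxE lexx/= ler_peMl ?ler1n//.
  by rewrite ltW// increment_step_gt0.
have Gfin := HG t0 (first_index k) (mi_order_first k).
exists ((m.+2%:R * 2) `^ (- (m.+2%:R + 2 * t))), (fine (gagliardo B t g)); split.
  by rewrite powR_gt0// mulr_gt0.
move=> M kM; have M1 : (1 < M)%N by apply: leq_trans kM; rewrite addn2.
have ib0 : 0 <= @increment_bound R m k M.
  by apply: mulr_ge0; [exact: sqr_ge0|exact: zpair_diag_ge0].
have gag0 : (0 <= gagliardo B t g)%E.
  rewrite gagliardoE; apply: integral_ge0 => x _; apply: integral_ge0 => y _.
  by rewrite lee_fin gagliardo_kernel_ge0.
rewrite -lee_fin fineK ?ge0_fin_numE//.
apply: le_trans (gagliardo_ge (l := @increment_bound R m k M) (rho := @increment_step R m M)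
  (ltW t0) (increment_step_gt0 M) (@measurable_shell _ _ (shell_scale (2 * M)))
  (shell_ball M1) Gi _ _ ib0).
- by rewrite lee_fin [leRHS]mulrA ler_wpM2r// step_powR_ge// ltW.
- by move=> x h; exact: shell_step_ball.
- by move=> h hh; exact: increment_bound_le.
Qed.

End not_sobolev.

Theorem proposition10 (R : realType) (n : nat) (n_ge2 : (2 <= n)%N) :
  let u : 'rV[R]_n -> R := lacunary n_ge2 in
  [/\ forall x, closed_unit_ball R n x -> cvgn (lacunary_psum n_ge2 x),
      harmonic_on (unit_ball R n) u,
      {within closed_unit_ball R n, continuous u},
      forall e : R, 0 < e -> ~ holder_on e (closed_unit_ball R n) u &
      forall sigma : R, (n%:R - 2) / 4 < sigma ->
        ~ in_Hs (sigma + 1 / 2) (unit_ball R n) u].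
Proof.
case: n n_ge2 => [|[|m]]// m_ge2 u; split.
- exact: lacunary_cvg.
- rewrite /u lacunaryE; exact: harmonic_zseries (@unit_ball_zdisk R m).
- exact: lacunary_continuous.
- exact: lacunary_not_holder.
(* [sigma + 1 / 2 > (n - 2) / 4 + 1 / 2 = n / 4]. *)
- move=> sigma hs; rewrite /u lacunaryE; apply: zseries_not_in_Hs; lra.
Qed.
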